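(* Let $(W,I)$ be a Coxeter system and $J\subset I$ a subset such that $W_J$ is finite. Let $\preceq$ be a reflection order on the set $T$ of reflections of $W$ such that the elements of $T\cap W_J$ come last. Then the labeling of the edges of $\mathcal{Q}^J$ by Type 1, Type 2 and Type 3 labels determined as in the context, with labels totally ordered by $\blacktriangleleft$, is an EL-labeling.
   Context: $(W,I)$ has simple reflections $s_i$, $i\in I$, length function $\ell$, Bruhat order $\le$ and set of reflections $T$. $W_J=\langle s_j : j\in J\rangle$. $W^J$ (resp. $W^J_{max}$) is the set of minimal (resp. maximal) length coset representatives of $W/W_J$. Let $\mathcal{I}^J\subset W^J_{max}\times W_J\times W^J$ be the set of triples $(x,u,w)$ with $x\le wu$. The poset $\mathcal{Q}^J$ has elements $\{\hat 0\}\cup\{Q_{x,u,w} : (x,u,w)\in\mathcal{I}^J\}$ (distinct triples give distinct elements), with order relation: $Q_{x,u,w}\le Q_{x',u',w'}$ if and only if there exist $u_1,u_2\in W_J$ with $u_1u_2=u$ and $\ell(u)=\ell(u_1)+\ell(u_2)$ such that $x'u'^{-1}\le xu_2^{-1}\le wu_1\le w'$; and $\hat 0<Q_{x,u,w}$ for all $Q_{x,u,w}$. Reflection order: a total order $\preceq$ on $T$ such that for every dihedral reflection subgroup $W'$ of $W$ (with canonical generators $r,s$) either $r\prec rsr\prec rsrsr\prec\dots\prec srsrs\prec srs\prec s$ or the reverse holds. ''Elements of $T\cap W_J$ come last'' means $t\prec t'$ whenever $t\in T\setminus W_J$ and $t'\in T\cap W_J$. Cover relations ($\lessdot$) in $\mathcal{Q}^J$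 are of three types. Type 1: $Q_{x',v,w'}\lessdot Q_{x,u,w}$ where for some $v_1,v_2\in W_J$ with $v=v_1v_2$, $\ell(v)=\ell(v_1)+\ell(v_2)$, one has $xu^{-1}=x'v_2^{-1}\le w'v_1\lessdot w$ (so $x=x'$, $u=v_2$, $w'v\lessdot wu$, $w'<w$). Type 2: the same with $xu^{-1}\lessdot x'v_2^{-1}\le w'v_1=w$ (so $w'=w$ and $xu^{-1}\lessdot x'v^{-1}$). Type 3: $\hat 0\lessdot Q_{x,u,w}$ with $x=wu$. Labels: a Type 1 edge is labeled by $(wu)^{-1}w'v\in T$; a Type 2 edge is labeled by $(x'v^{-1})^{-1}xu^{-1}\in T$; a Type 3 edge is labeled by the symbol $\emptyset$. Type 1 labels and Type 2 labels are regarded as elements of two disjoint copies of $T$. The total order $\blacktriangleleft$ on labels is: $\lambda\blacktriangleleft\emptyset\blacktriangleleft\mu$ for every Type 1 label $\lambda$ and Type 2 label $\mu$; and if $\lambda,\mu$ are both Type 1 labels, or both Type 2 labels, then $\lambda\blacktriangleleft\mu$ if and only if $\lambda\prec\mu$. EL-labeling: for a maximal chain $c=(x_0\gtrdot x_1\gtrdot\dots\gtrdot x_k)$ of an interval (read from top to bottom), let $\sigma(c)$ be the tuple of its edge labels in this order; $c$ is increasing if $\sigma(c)$ is weakly increasing; $c<_Lc'$ means $\sigma(c)$ lexicographically precedes $\sigma(c')$. The labeling is an EL-labeling if for every interval $[p,q]$ there is a unique increasing maximal chain $c$ in $[p,q]$, and $c<_Lc'$ for all other maximal chains $c'$ in $[p,q]$.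 *)

(* Defs.v *)
From mathcomp Require Import all_boot.
From mathcomp Require Import boolp classical_sets functions cardinality.

Set Implicit Arguments.
Unset Strict Implicit.
Unset Printing Implicit Defensive.

Local Open Scope classical_set_scope.
Local Open Scope group_scope.

(* The value [m i j = 0] encodes [m(i,j) = oo]. *)
Definition coxeter_matrix (I : Type) (m : I -> I -> nat) : Prop :=
  (forall i j, m i j = m j i) /\ (forall i j, m i j = 1%N <-> i = j).

Definition word (I : Type) (G : groupType) (s : I -> G) (c : seq I) : G :=
  \prod_(i <- c) s i.

Definition coxeter_relations (I : Type) (m : I -> I -> nat)
    (G : groupType) (s : I -> G) : Prop :=
  forall i j, (s i * s j) ^+ m i j = 1.

(* [W] is presented by the generators [s i] subject to [(s i s j)^(m i j) = 1].
   The relation for [m i j = 0] reads [1 = 1]; the relations for [i = j] give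
   [s i * s i = 1], so every element is a product of generators. *)
Definition coxeter_system (I : Type) (W : groupType) (s : I -> W) : Prop :=
  exists m : I -> I -> nat,
    [/\ coxeter_matrix m,
        coxeter_relations m s,
        forall x : W, exists c : seq I, word s c = x
      & forall (G : groupType) (f : I -> G), coxeter_relations m f ->
          exists phi : {multiplicative W -> G}, forall i, phi (s i) = f i].

Definition is_subgroup (W : groupType) (H : set W) : Prop :=
  [/\ H 1, forall x y, H x -> H y -> H (x * y) & forall x, H x -> H x^-1].

Definition generated (W : groupType) (A : set W) : set W :=
  smallest (@is_subgroup W) A.

Definition covers (P : Type) (le : P -> P -> Prop) (p q : P) : Prop :=
  [/\ le p q, p <> q & forall r, le p r -> le r q -> r = p \/ r = q].

Section Coxeter.
Variables (I : Type) (W : groupType) (s : I -> W).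

Definition ell (x : W) : nat :=
  xget 0%N [set n | (exists2 c, size c = n & word s c = x) /\
                    forall c, word s c = x -> (n <= size c)%N].

Definition reflections : set W := [set t | exists i x, t = s i ^ x].

Inductive bruhat_le (x : W) : W -> Prop :=
| bruhat_refl : bruhat_le x x
| bruhat_step y t : bruhat_le x y -> reflections t ->
    (ell y < ell (y * t))%N -> bruhat_le x (y * t).

Definition inversions (x : W) : set W :=
  [set t | reflections t /\ (ell (t * x) < ell x)%N].

Definition dihedral_reflection_subgroup (W' : set W) : Prop :=
  exists t1 t2, [/\ reflections t1, reflections t2, t1 <> t2
                  & W' = generated [set t1; t2]].

(* Dyer's canonical generators of a reflection subgroup. *)
Definition canonical_generators (W' : set W) : set W :=
  [set t | reflections t /\ inversions t `&` W' = [set t]].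

(* [alternating r s k] is the palindrome [r s r ... r] of length [2k+1]. *)
Definition alternating (r r' : W) (k : nat) : W := r * (r' * r) ^+ k.

Definition order_gt (x : W) (n : nat) : Prop :=
  forall j, (0 < j <= n)%N -> x ^+ j <> 1.

(* [r < r r' r < r r' r r' r < ... < r' r r' r r' < r' r r' < r'].
   If [r r'] has finite order [n], the reflections of [<r, r'>] are
   [alternating r r' k] for [k < n], and
   [alternating r' r l = alternating r r' (n - 1 - l)]; the [order_gt]
   conditions express that the two compared reflections are listed once each,
   in this order; they hold for all [k], [l] if [r r'] has infinite order. *)
Definition dihedral_increasing (lt : rel W) (r r' : W) : Prop :=
  (forall k l, (k < l)%N -> order_gt (r * r') l ->
     lt (alternating r r' k) (alternating r r' l) /\
     lt (alternating r' r l) (alternating r' r k)) /\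
  (forall k l, order_gt (r * r') (k + l).+1 ->
     lt (alternating r r' k) (alternating r' r l)).

Definition strict (le : rel W) : rel W := fun x y => le x y && (x != y).

(* The relation is only relevant on [reflections]. *)
Definition reflection_order (le : rel W) : Prop :=
  [/\ {in reflections &, antisymmetric le},
      {in reflections & &, transitive le},
      {in reflections &, total le}
    & forall (W' : set W) (r r' : W),
        dihedral_reflection_subgroup W' -> r <> r' ->
        canonical_generators W' = [set r; r'] ->
        dihedral_increasing (strict le) r r' \/
        dihedral_increasing (strict le) r' r].

Variable J : set I.

Definition parabolic : set W := generated (s @` J).

Definition min_rep : set W :=
  [set w | forall u, parabolic u -> (ell w <= ell (w * u))%N].

Definition max_rep : set W :=
  [set x | forall u, parabolic u -> (ell (x * u) <= ell x)%N].

Definition parabolic_last (le : rel W) : Prop :=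
  forall t t', reflections t -> ~ parabolic t ->
    reflections t' -> parabolic t' -> strict le t t'.

Definition IJ : set (W * W * W) :=
  [set p | let: (x, u, w) := p in
    [/\ max_rep x, parabolic u, min_rep w & bruhat_le x (w * u)]].

(* [None] is the bottom element. *)
Definition QJ : Type := option IJ.

Definition reduced_factorization (u u1 u2 : W) : Prop :=
  [/\ parabolic u1, parabolic u2, u1 * u2 = u
    & ell u = (ell u1 + ell u2)%N].

Definition triple_le (p p' : W * W * W) : Prop :=
  let: (x, u, w) := p in let: (x', u', w') := p' in
  exists u1 u2, [/\ reduced_factorization u u1 u2,
    bruhat_le (x' * u'^-1) (x * u2^-1),
    bruhat_le (x * u2^-1) (w * u1)
  & bruhat_le (w * u1) w'].

Definition QJ_le (p q : QJ) : Prop :=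
  match p, q with
  | None, _ => True
  | Some _, None => False
  | Some a, Some b => triple_le (val a) (val b)
  end.

Inductive label : Type :=
| Label1 of W
| LabelEmpty
| Label2 of W.

Definition label_lt (le : rel W) : rel label := fun a b =>
  match a, b with
  | Label1 t, Label1 t' => strict le t t'
  | Label1 _, _ => true
  | LabelEmpty, Label2 _ => true
  | LabelEmpty, _ => false
  | Label2 t, Label2 t' => strict le t t'
  | Label2 _, _ => false
  end.

(* [edge_label p q l]: the edge from [p] down to [q] is labeled by [l]. *)
Inductive edge_label : QJ -> QJ -> label -> Prop :=
| edge_type1 (a b : IJ) x u w x' v w' v1 v2 :
    val a = (x, u, w) -> val b = (x', v, w') ->
    reduced_factorization v v1 v2 ->
    x * u^-1 = x' * v2^-1 ->
    bruhat_le (x' * v2^-1) (w' * v1) ->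
    covers bruhat_le (w' * v1) w ->
    edge_label (Some a) (Some b) (Label1 ((w * u)^-1 * (w' * v)))
| edge_type2 (a b : IJ) x u w x' v w' v1 v2 :
    val a = (x, u, w) -> val b = (x', v, w') ->
    reduced_factorization v v1 v2 ->
    covers bruhat_le (x * u^-1) (x' * v2^-1) ->
    bruhat_le (x' * v2^-1) (w' * v1) ->
    w' * v1 = w ->
    edge_label (Some a) (Some b) (Label2 ((x' * v^-1)^-1 * (x * u^-1)))
| edge_type3 (a : IJ) x u w :
    val a = (x, u, w) -> x = w * u ->
    edge_label (Some a) None LabelEmpty.

End Coxeter.

Section ELLabeling.
Variables (P : Type) (le : P -> P -> Prop).
Variables (L : Type) (lt : rel L) (lab : P -> P -> L).

(* The maximal chains of [[p, q]] are the sequences [q :: c], from the top [q]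
   down to [p], with [c] as below. *)
Definition maximal_chain (p q : P) (c : seq P) : Prop :=
  path (fun a b => `[< covers le b a >]) q c /\ last q c = p.

Definition increasing (ls : seq L) : Prop :=
  sorted (fun a b => `[< a = b >] || lt a b) ls.

Fixpoint lex_lt (ls ls' : seq L) : Prop :=
  match ls, ls' with
  | _, [::] => False
  | [::], _ :: _ => True
  | a :: l, b :: l' => lt a b \/ a = b /\ lex_lt l l'
  end.

Definition EL_labeling : Prop :=
  forall p q, le p q ->
    exists c, [/\ maximal_chain p q c,
      increasing (pairmap lab q c),
      forall c', maximal_chain p q c' ->
        increasing (pairmap lab q c') -> c' = c
    & forall c', maximal_chain p q c' -> c' <> c ->
        lex_lt (pairmap lab q c) (pairmap lab q c')].

End ELLabeling.

(* Main.v *)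
From HB Require Import structures.
Require Import Defs.
From mathcomp Require Import all_boot.
From mathcomp Require Import boolp classical_sets functions cardinality.
From mathcomp Require Import zify.

(* Normalize [Q_{x,u,w}] by the Bruhat interval from [x * u^-1] up to [w].  A Type 1
   edge keeps [x] and moves [y = w * u] down a Bruhat cover [y * t] with [t] not in
   [W_J]; a Type 2 edge keeps [w] and moves [x * u^-1] up an arbitrary Bruhat cover
   below [w].  So an increasing chain from [Q_{x,u,w}] down to [Q_{x',v,w'}] is an
   increasing Bruhat chain from [w * u] down to some [w' * v'] with labels outside
   [W_J], followed by an increasing Bruhat chain from [x * v'^-1] up to [x' * v^-1].
   As the reflections of [W_J] come last, the first chain avoids them exactly when
   [w' * v'] is the largest element of [w' * W_J] below [w * u], and everything
   reduces to Dyer's theorem: in a Bruhat interval the increasing chain for a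
   reflection order is unique and its first label is the smallest one.

   Uniqueness in Dyer's theorem is obtained by counting increasing paths of the
   Bruhat graph by their length: the counts satisfy the recursion of the
   R-polynomials whatever the order, and the top one is at most 1.  The order may be
   changed because the class of reflection orders is stable under conjugating by a
   simple reflection [s i] the part of the order on one side of [s i].  Existence and
   extremality of the labels follow from the intervals of length two. *)

(** The two Bruhat chains in a chain of the poset share the intermediate [v']. Lengths add in
    [w' * v'] and subtract in [x * v'^-1], so a step that raises [w' * v'] inside its coset lowers
    [x * v'^-1]. Hence, if any [v'] links the two chains, the one with [w' * v'] largest does. For
    chains to the bottom element, the maximality of [x] in its coset keeps the reflections of [W_J]
    out of the increasing chain from [w * u] down to [x].

    The group may be infinite, with no longest element and no finite list of its reflections.
    Reflection orders are therefore restricted to finite lists that contain the labels of all Bruhat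
    graph edges below a fixed [y].

    Paths of every length are counted, not only saturated chains, because right multiplication by
    [s i] preserves the edges whose label is not [s i] but may turn a cover into an edge of length
    difference 3. Saturated chains are recovered as the paths of greatest possible length. *)

Set Implicit Arguments.
Unset Strict Implicit.
Unset Printing Implicit Defensive.

Local Open Scope group_scope.

(* The homomorphism from [W] to this semidirect product that maps [s i] to the pair
   of the indicator of [s i] and [s i] computes inversion sets in its first component. *)
Definition wreath (W : groupType) : Type := ((W -> bool) * W)%type.

Section Wreath.
Variable W : groupType.

HB.instance Definition _ := Choice.on (wreath W).

Definition wreath_one : wreath W := (fun=> false, 1).
Definition wreath_mul (a b : wreath W) : wreath W :=
  (fun t => a.1 t (+) b.1 (a.2^-1 * t * a.2), a.2 * b.2).
Definition wreath_inv (a : wreath W) : wreath W :=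
  (fun t => a.1 (a.2 * t * a.2^-1), a.2^-1).

Fact wreath_mulA : associative wreath_mul.
Proof.
move=> a b c; congr pair; last exact: mulgA.
by apply/funext => t; rewrite addbA invgM !mulgA.
Qed.
Fact wreath_mul1 : left_id wreath_one wreath_mul.
Proof.
case=> f x; congr pair; last exact: mul1g.
by apply/funext => t; rewrite /= invg1 mul1g mulg1.
Qed.
Fact wreath_mulr1 : right_id wreath_one wreath_mul.
Proof.
case=> f x; congr pair; last exact: mulg1.
by apply/funext => t; rewrite addbF.
Qed.
Fact wreath_mulV : left_inverse wreath_one wreath_inv wreath_mul.
Proof.
case=> f x; congr pair; last exact: mulVg.
by apply/funext => t; rewrite /= invgK addbb.
Qed.
Fact wreath_mulrV : right_inverse wreath_one wreath_inv wreath_mul.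
Proof.
case=> f x; congr pair; last exact: mulgV.
by apply/funext => t; rewrite /= !mulgA mulgV mul1g mulgK addbb.
Qed.

HB.instance Definition _ := isGroup.Build (wreath W)
  wreath_mulA wreath_mul1 wreath_mulr1 wreath_mulV wreath_mulrV.
End Wreath.

(* Rewriting with [mulgA] itself leaves a different, convertible, path to the magma
   structure of [W] in the goal, which [lia] does not identify with the usual one. *)
Lemma gmulA (W : groupType) (x y z : W) : x * (y * z) = x * y * z.
Proof. exact: mulgA. Qed.

Ltac gsimp := rewrite ?(invgM, invgK, gmulA, mulgK, mulgVK, mulgV, mulVg, mul1g, mulg1, invg1).

(** * Length, reflections and inversions *)

Section Basics.
Variables (I : Type) (W : groupType) (s : I -> W).
Hypothesis cox : coxeter_system s.

Local Notation T := (reflections s).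
Local Notation l := (ell s).

Lemma simple_invol i : s i * s i = 1.
Proof.
have [m [[_ /(_ i i)[_ /(_ erefl)h1] ] rel _ _]] := cox.
by have := rel i i; rewrite h1.
Qed.

Lemma simpleV i : (s i)^-1 = s i.
Proof. by apply: (mulgI (s i)); rewrite mulgV simple_invol. Qed.

Lemma word_cons i c : word s (i :: c) = s i * word s c.
Proof. by rewrite /word big_cons. Qed.
Lemma word_nil : word s [::] = 1.
Proof. by rewrite /word big_nil. Qed.
Lemma word_cat c d : word s (c ++ d) = word s c * word s d.
Proof. by rewrite /word big_cat. Qed.
Lemma word1 i : word s [:: i] = s i.
Proof. by rewrite word_cons word_nil mulg1. Qed.

Lemma word_rev c : word s (rev c) = (word s c)^-1.
Proof.
elim: c => [|i c IH]; first by rewrite /rev /= word_nil invg1.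
by rewrite rev_cons -cats1 word_cat IH word1 word_cons invgM simpleV.
Qed.

Lemma wordP x : exists c, word s c = x.
Proof. by have [m [_ _ + _]] := cox; apply. Qed.

Lemma ell_spec x : (exists2 c, size c = l x & word s c = x) /\
  forall c, word s c = x -> (l x <= size c)%N.
Proof.
pose P n := `[< exists2 c, size c = n & word s c = x >].
have exP : exists n, P n.
  by have [c h] := wordP x; exists (size c); apply/asboolP; exists c.
have [n /asboolP Pn nmin] := ex_minnP exP.
rewrite /ell; case: xgetP => [m ->//|/(_ n) []].
split=> // c h; apply: nmin; apply/asboolP; by exists c.
Qed.

Lemma ell_word x : exists2 c, size c = l x & word s c = x.
Proof. by have [] := ell_spec x. Qed.
Lemma ell_le c : (l (word s c) <= size c)%N.
Proof. by have [_] := ell_spec (word s c); apply. Qed.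

Lemma ell1 : l 1 = 0%N.
Proof. by apply/eqP; rewrite -leqn0 -word_nil ell_le. Qed.

Lemma ell_eq0 x : l x = 0%N -> x = 1.
Proof.
by move=> h0; have [c + <-] := ell_word x; rewrite h0 => /size0nil ->; rewrite word_nil.
Qed.

Lemma ellM x y : (l (x * y) <= l x + l y)%N.
Proof.
have [c <- ec] := ell_word x; have [d <- ed] := ell_word y.
by rewrite -{1}ec -{1}ed -word_cat -size_cat ell_le.
Qed.

Lemma ellV x : l x^-1 = l x.
Proof.
have h y : (l y^-1 <= l y)%N.
  by have [c <- ec] := ell_word y; rewrite -ec -word_rev -size_rev ell_le.
by apply/eqP; rewrite eqn_leq h -{1}(invgK x) h.
Qed.

Lemma ell_simple i : (l (s i) <= 1)%N.
Proof. by rewrite -word1 ell_le. Qed.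

Lemma refl_simple i : T (s i).
Proof. by exists i, 1; rewrite /conjg invg1 mul1g mulg1. Qed.

Lemma reflP t : T t <-> exists i x, t = x * s i * x^-1.
Proof.
split=> -[i [x ->]]; exists i, x^-1; rewrite /conjg; gsimp => //.
Qed.

Lemma refl_invol t : T t -> t * t = 1.
Proof. by case=> i [x ->]; rewrite /conjg; gsimp; rewrite -(gmulA x^-1) simple_invol mulg1 mulVg. Qed.

Lemma reflV t : T t -> t^-1 = t.
Proof. by move=> /refl_invol h; apply: (mulgI t); rewrite mulgV h. Qed.

Lemma refl_conj t x : T t -> T (x^-1 * t * x).
Proof. by case=> i [y ->]; exists i, (y * x); rewrite /conjg; gsimp. Qed.

Lemma refl_conjV t x : T t -> T (x * t * x^-1).
Proof. by move=> h; have := refl_conj (x^-1) h; gsimp. Qed.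

Lemma refl_conjT t r : T t -> T r -> T (r * t * r).
Proof. by move=> h hr; have := refl_conj r h; rewrite reflV. Qed.

Lemma mulgTK t x : T t -> x * t * t = x.
Proof. by move=> h; rewrite -gmulA refl_invol ?mulg1. Qed.
Lemma mulTgK t x : T t -> t * (t * x) = x.
Proof. by move=> h; rewrite gmulA refl_invol ?mul1g. Qed.
Lemma mulgSK i x : x * s i * s i = x.
Proof. exact/mulgTK/refl_simple. Qed.
Lemma mulSgK i x : s i * (s i * x) = x.
Proof. exact/mulTgK/refl_simple. Qed.

(** For a word [s1 s2 .. sn] these are the palindromes [s1 .. sk .. s1] of its nonempty prefixes. *)
Fixpoint prefix_refls (c : seq I) : seq W :=
  if c is i :: c' then s i :: [seq s i * t * s i | t <- prefix_refls c'] else [::].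

(** The first component of the relation for [s i] and [s j] counts exponents below [m.*2], and this
    periodicity makes the count even. *)
Lemma count_pow_double (p : W) (u : W) m : p ^+ m = 1 ->
  (\sum_(i < m.*2) (u == p ^+ i)%g = (\sum_(i < m) (u == p ^+ i)%g).*2)%N.
Proof.
move=> pm; rewrite -!(big_mkord xpredT (fun i => (u == p ^+ i) : nat)).
rewrite (big_cat_nat (n := m)) //= -?addnn ?leq_addr //; congr addn.
rewrite -{1}(add0n m) big_addn addnK; apply: eq_bigr => i _.
by rewrite expgnDr pm mulg1.
Qed.

(** The parity with which [t] occurs among the prefix reflections is the same for all words of an
    element: the pairs [f i] satisfy the Coxeter relations in the semidirect product, so the
    presentation extends [f] to [W]. *)
Lemma eta_exists : exists eta : W -> W -> bool,
  (forall c t, eta (word s c) t = odd (count_mem t (prefix_refls c))) /\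
  (forall x y t, eta (x * y) t = eta x t (+) eta y (x^-1 * t * x)).
Proof.
pose f i : wreath W := (fun t => t == s i, s i).
have [m [cm rel gen univ]] := cox.
have frel : coxeter_relations m f.
  move=> i j; set p := s i * s j.
  have sps : s i * p^-1 = p * s i by rewrite /p; gsimp; rewrite !simpleV; gsimp.
  have spk k : s i * (p ^+ k)^-1 = p ^+ k * s i.
    elim: k => [|k IH]; first by rewrite expg0 invg1 mul1g mulg1.
    by rewrite {1}expgSr invgM gmulA sps -gmulA IH gmulA -expgS.
  have ft : forall t, (f i * f j).1 t = (t == s i) (+) (t == p * s i).
    move=> t; rewrite /= simpleV /p; congr addb; apply/eqP/eqP => [<-|->].
      by rewrite !gmulA simple_invol mul1g mulgSK.
    by rewrite !gmulA simple_invol mul1g mulgSK.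
  (* The prefix reflections of the alternating word of length [k.*2] are the [p ^+ j0 * s i] with
     [j0 < k.*2]. *)
  have powE k : (f i * f j) ^+ k = ((fun t => odd (\sum_(j0 < k.*2) (t * s i == p ^+ j0)%g)), p ^+ k).
    elim: k => [|k IH].
      by rewrite !expg0; congr pair; apply/funext => t; rewrite big_ord0.
    rewrite expgSr IH; congr pair; last by rewrite expgSr.
    apply/funext => t.
    transitivity (odd (\sum_(j0 < k.*2) (t * s i == p ^+ j0)%g) (+) (f i * f j).1 ((p ^+ k)^-1 * t * p ^+ k)) => //.
    rewrite ft doubleS !big_ord_recr /= !oddD -addbA; congr addb.
    have E u : ((p ^+ k)^-1 * t * p ^+ k == u * s i) = (t * s i == p ^+ k * u * p ^+ k).
      rewrite -(inj_eq (mulgI (p ^+ k)) _ (u * s i)) !gmulA mulgV mul1g.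
      rewrite -(inj_eq (mulIg (s i)) _ (p ^+ k * u * s i)) mulgSK.
      rewrite -(gmulA t) -spk gmulA.
      by rewrite -(inj_eq (mulIg (p ^+ k)) _ (p ^+ k * u)) mulgVK.
    rewrite -[X in _ == X](mul1g (s i)) !E.
    by rewrite mulg1 -expgnDr addnn -expgSr -expgnDr addSn addnn !oddb.
  rewrite powE; congr pair; last exact: rel.
  apply/funext => t; rewrite count_pow_double ?odd_double //; exact: rel.
have [phi phif] := univ _ f frel.
have phi1 : phi 1 = 1.
  by apply: (mulgI (phi 1)); rewrite -gmulfM !mulg1.
have phiw c : phi (word s c) = word f c.
  elim: c => [|i c IH]; first by rewrite /word !big_nil.
  by rewrite word_cons gmulfM IH phif /word big_cons.
have phi2 x : (phi x).2 = x.
  have [c <-] := gen x; rewrite phiw; elim: c => [|i c IH].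
    by rewrite /word !big_nil.
  rewrite word_cons -[in RHS]IH /word big_cons //.
exists (fun x => (phi x).1); split=> [c t|x y t].
  rewrite phiw; elim: c t => [|i c IH] t; first by rewrite /word big_nil.
  transitivity ((t == s i) (+) (word f c).1 ((s i)^-1 * t * s i)).
    by rewrite /word big_cons.
  rewrite IH /= oddD eq_sym oddb; congr addb; congr odd.
  rewrite count_map; apply: eq_count => u /=.
  by rewrite simpleV; apply/eqP/eqP => [->|<-]; rewrite !gmulA simple_invol mul1g mulgSK.
rewrite gmulfM -[in RHS](phi2 x) //=; congr addb; by rewrite ?phi2.
Qed.

End Basics.

(** * Inversions and the strong exchange condition *)

Section Inversions.
Variables (I : Type) (W : groupType) (s : I -> W).
Hypothesis cox : coxeter_system s.

Local Notation T := (reflections s).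
Local Notation l := (ell s).

(** On the right, unlike [inversions], because edges of the Bruhat graph lead from [x] to [x * t];
    [rdn_inv] translates between the two sides. *)
Definition right_inversion (x t : W) : bool := (l (x * t) < l x)%N.
Local Notation rdn := right_inversion.

(** Multiplying by the palindrome of a prefix deletes the last letter of that prefix. The clause on
    [Q] says that no new letter appears, as parabolic words require; the last clause bounds the
    depth of [t], for the induction in [exists_canonical_pair]. *)
Lemma prefix_reflsP c t : t \in prefix_refls s c ->
  (exists c', [/\ (size c' < size c)%N, t * word s c = word s c' &
     forall Q : pred I, all Q c -> all Q c']) /\
  exists y i, t = y * s i * y^-1 /\ (l y < size c)%N.
Proof.
elim: c t => [|i c IH] t //=; rewrite in_cons => /orP[/eqP->|/mapP[u /IH[[c' [hc' ec' Qc']] [y [j [ey hy]]]] ->]].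
  split; first by exists c; rewrite word_cons (mulSgK cox); split=> // Q /andP[].
  by exists 1, i; rewrite mul1g invg1 mulg1 (ell1 cox) //.
split.
  exists (i :: c'); rewrite !word_cons -ec' !gmulA (mulgSK cox); split=> // Q /=.
  by case/andP=> -> /Qc'.
exists (s i * y), j; split; first by rewrite ey invgM (simpleV cox) !gmulA.
by have := ellM cox (s i) y; have := ell_simple cox i; rewrite /=; lia.
Qed.

(** If [eta x t] holds, [t] occurs in a reduced word of [x] and deletes a letter there. If it fails,
    the cocycle identity and [eta t t] make [eta (t * x) t] hold, and the first case applies to
    [t * x]. *)
Lemma left_inversion_cocycle : exists eta : W -> W -> bool,
  [/\ forall x t, T t -> eta x t = (l (t * x) < l x)%N,
      forall x y t, eta (x * y) t = eta x t (+) eta y (x^-1 * t * x),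
      forall t, T t -> eta t t
    & forall c t, eta (word s c) t -> t \in prefix_refls s c].
Proof.
have [eta [etaw etaM]] := eta_exists cox.
exists eta.
have eta_pre c t : eta (word s c) t -> t \in prefix_refls s c.
  by rewrite etaw; apply: contraLR => /count_memPn ->.
have eta1 t : eta 1 t = false by rewrite -(word_nil s) etaw.
have etas i t : eta (s i) t = (t == s i).
  by rewrite -[s i in LHS](word1 s) etaw /= addn0 oddb eq_sym.
have etaV x t : eta x^-1 t = eta x (x * t * x^-1).
  by have := etaM x x^-1 (x * t * x^-1); gsimp; rewrite eta1; case: (eta x _); case: (eta x^-1 _).
have etatt t : T t -> eta t t.
  move=> /(reflP s) [i [y ->]]; rewrite !etaM etaV etas; gsimp.
  by rewrite eqxx; case: (eta y _).
have dnE x t : T t -> eta x t = (l (t * x) < l x)%N.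
  move=> Tt; have key z : eta z t -> (l (t * z) < l z)%N.
    have [c <- <-] := ell_word cox z => /eta_pre /prefix_reflsP[[c' [h -> _]] _].
    exact: leq_ltn_trans (ell_le cox _) h.
  apply/idP/idP => [/key//|]; apply: contraLR => /negbTE h.
  have /key : eta (t * x) t by rewrite etaM etatt // mulVg mul1g h.
  by rewrite (mulTgK cox) // -leqNgt => /ltnW.
by [].
Qed.

(** The cocycle identity read on the right. Length comparisons are computed from it rather than from
    reduced words. *)
Lemma rdn_mul x y t : T t -> rdn (x * y) t = rdn y t (+) rdn x (y * t * y^-1).
Proof.
move=> Tt; have [eta [etaE etaM _ _]] := left_inversion_cocycle.
have rE z u : T u -> rdn z u = eta z^-1 u.
  move=> Tu; rewrite etaE // /right_inversion -(ellV cox (z * u)) -(ellV cox z) invgM.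
  by rewrite (reflV cox Tu).
rewrite !rE //; last exact: refl_conjV.
by rewrite invgM etaM invgK.
Qed.

Lemma rdn_exchange_word c t : T t -> rdn (word s c) t ->
  (exists c', [/\ (size c' < size c)%N, word s c * t = word s c' &
     forall Q : pred I, all Q c -> all Q c']) /\
  exists y i, t = y * s i * y^-1 /\ (l y < size c)%N.
Proof.
move=> Tt; have [eta [etaE etaM _ etaX]] := left_inversion_cocycle.
rewrite /right_inversion -(ellV cox (word s c * t)) -(ellV cox (word s c)) invgM.
rewrite (reflV cox Tt) -etaE // -(word_rev cox) => /etaX/prefix_reflsP.
rewrite size_rev => -[[c' [h1 h2 h3]] h4]; split=> //.
exists (rev c'); rewrite size_rev (word_rev cox) -h2 invgM (reflV cox Tt) (word_rev cox) invgK.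
by split=> // Q Qc; rewrite all_rev; apply: h3; rewrite all_rev.
Qed.

Lemma rdn_exchange x t : T t -> rdn x t ->
  exists y i, t = y * s i * y^-1 /\ (l y < l x)%N.
Proof. by have [c <- <-] := ell_word cox x => Tt /(rdn_exchange_word Tt)[]. Qed.

Lemma ell_refl_gt0 t : T t -> (0 < l t)%N.
Proof.
move=> Tt; have [eta [etaE _ /(_ t Tt) + _]] := left_inversion_cocycle.
by rewrite etaE // (refl_invol cox) // (ell1 cox).
Qed.

Lemma rdn_refl t : T t -> rdn t t.
Proof. by move=> Tt; rewrite /right_inversion (refl_invol cox) // (ell1 cox) ell_refl_gt0. Qed.

Lemma rdn_mulT x t : T t -> rdn (x * t) t = ~~ rdn x t.
Proof. by move=> Tt; rewrite rdn_mul // mulgK rdn_refl. Qed.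

Lemma rdnPn x t : T t -> ~~ rdn x t = (l x < l (x * t))%N.
Proof. by move=> Tt; rewrite -rdn_mulT // /right_inversion (mulgTK cox). Qed.

Lemma refl_neq1 t : T t -> t <> 1.
Proof. by move=> /ell_refl_gt0 + e; rewrite e (ell1 cox). Qed.

Lemma mulT_neq x t : T t -> x * t <> x.
Proof. by move=> /refl_neq1 + e; apply; apply: (mulgI x); rewrite mulg1. Qed.

Lemma ell_simple1 i : l (s i) = 1%N.
Proof.
by apply/eqP; rewrite eqn_leq (ell_simple cox) ell_refl_gt0 //; apply: refl_simple.
Qed.

Lemma ell_mulS x i : l (x * s i) = if rdn x (s i) then (l x).-1 else (l x).+1.
Proof.
have h y : (l (y * s i) <= (l y).+1)%N.
  by rewrite -addn1 -(ell_simple1 i) (ellM cox).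
have := h x; have := h (x * s i); rewrite (mulgSK cox).
have := rdnPn x (refl_simple s i); case: ifP; rewrite /right_inversion; lia.
Qed.

Lemma ell_parity x y : odd (l (x * y)) = odd (l x) (+) odd (l y).
Proof.
have [c _ <-] := ell_word cox y.
have hs i z : odd (l (z * s i)) = ~~ odd (l z).
  by rewrite ell_mulS /right_inversion; case: ifP => // h; lia.
elim/last_ind: c x => [|c i IH] x; first by rewrite word_nil mulg1 (ell1 cox) addbF.
by rewrite -cats1 word_cat word1 gmulA !hs IH; case: odd; case: odd.
Qed.

Lemma refl_odd t : T t -> odd (l t).
Proof.
move=> /(reflP s) [i [y ->]].
by rewrite !ell_parity (ellV cox) ell_simple1; case: odd.
Qed.

Lemma ell_refl_neq x t : T t -> l (x * t) != l x.
Proof. by move=> /refl_odd h; apply/eqP => /(congr1 odd); rewrite ell_parity h; case: odd. Qed.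

Lemma rdn1 t : rdn 1 t = false.
Proof. by rewrite /right_inversion (ell1 cox). Qed.

Lemma rdn_simple i t : T t -> rdn (s i) t = (t == s i).
Proof.
move=> Tt; apply/idP/eqP => [|->]; last exact/rdn_refl/refl_simple.
rewrite /right_inversion ell_simple1 ltnS leqn0 => /eqP/(ell_eq0 cox) e.
by apply: (mulgI (s i)); rewrite e (simple_invol cox).
Qed.

Lemma rdn_mulS x i t : T t -> t <> s i -> rdn (x * s i) (s i * t * s i) = rdn x t.
Proof.
move=> Tt ne; have Ts := refl_simple s i.
rewrite rdn_mul ?rdn_simple; try by apply: (refl_conjT cox).
rewrite (simpleV cox) !gmulA (simple_invol cox) mul1g (mulgSK cox).
rewrite (_ : _ == _ = false) //; apply/eqP => e; apply: ne.
by apply: (mulgI (s i)); apply: (mulIg (s i)); rewrite e (simple_invol cox) mul1g.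
Qed.

Lemma right_descent x : x <> 1 -> exists i, rdn x (s i).
Proof.
have [c + ex] := ell_word cox x; rewrite -ex {x ex}; elim/last_ind: c => [|c i _]; first by rewrite word_nil.
rewrite size_rcons -cats1 word_cat word1 => e _; exists i.
by rewrite /right_inversion (mulgSK cox) -e ltnS (ell_le cox).
Qed.

Lemma rdn_inv x t : T t -> rdn x t = (l (t * x^-1) < l x^-1)%N.
Proof. by move=> Tt; rewrite (ellV cox) -(ellV cox (t * _)) invgM invgK (reflV cox Tt). Qed.

End Inversions.

(** * Bruhat order *)

Section Bruhat.
Variables (I : Type) (W : groupType) (s : I -> W).
Hypothesis cox : coxeter_system s.

Local Notation T := (reflections s).
Local Notation l := (ell s).
Local Notation le := (bruhat_le s).
Local Notation rdn := (right_inversion s).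
Local Notation Ts := (refl_simple s).

Lemma bruhat_trans y x z : le x y -> le y z -> le x z.
Proof. by move=> xy yz; elim: yz => // z' t _ IH Tt h; apply: bruhat_step. Qed.

Lemma bruhat_edge x t : T t -> (l x < l (x * t))%N -> le x (x * t).
Proof. by move=> Tt h; apply: bruhat_step => //; apply: bruhat_refl. Qed.

Lemma bruhat_ell x y : le x y -> (l x <= l y)%N.
Proof. by elim=> // z t _ IH _ h; rewrite (leq_trans IH) // ltnW. Qed.

Lemma bruhat_eq x y : le x y -> (l y <= l x)%N -> x = y.
Proof.
case=> // z t /bruhat_ell h1 _ h2 h3.
by have := leq_ltn_trans h1 (leq_trans h2 h3); rewrite ltnn.
Qed.

Lemma bruhat_antisym x y : le x y -> le y x -> x = y.
Proof. by move=> xy /bruhat_ell; apply: bruhat_eq. Qed.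

Lemma bruhat_lt x y : le x y -> x <> y -> (l x < l y)%N.
Proof. by move=> xy ne; rewrite ltnNge; apply/negP => /(bruhat_eq xy). Qed.

Lemma bruhat1 y : le 1 y.
Proof.
have [n] := ubnP (l y); elim: n y => // n IH y; rewrite ltnS => hn.
case: (pselect (y = 1)) => [->|/(right_descent cox)[i hi]]; first exact: bruhat_refl.
rewrite -(mulgSK cox i y); apply: bruhat_step; first exact: IH (leq_trans hi hn).
  exact: Ts.
by rewrite (mulgSK cox).
Qed.

(** The only inversion of [s i] is [s i] itself, so by the cocycle identity conjugation carries
    every other comparison over. The lifting properties follow from this, edge by edge along a
    chain. *)
Lemma edge_mulS x i t : T t -> t <> s i -> (l x < l (x * t))%N ->
  T (s i * t * s i) /\ (l (x * s i) < l (x * s i * (s i * t * s i)))%N.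
Proof.
move=> Tt ne; have Tst := refl_conjT cox Tt (Ts i).
by rewrite -!(rdnPn cox) // (rdn_mulS cox).
Qed.

Lemma edge_mulSE x i t : x * s i * (s i * t * s i) = x * t * s i.
Proof. by rewrite !gmulA (mulgSK cox). Qed.

Lemma bruhat_mulS_l i x y : le x y -> le (x * s i) y \/ le (x * s i) (y * s i).
Proof.
elim=> [|y' t xy IH Tt h]; first by right; apply: bruhat_refl.
case: IH => IH; first by left; apply: bruhat_step.
case: (pselect (t = s i)) => [e|ne]; first by left; rewrite e.
right; have [h1 h2] := edge_mulS Tt ne h.
by rewrite -edge_mulSE; apply: bruhat_step.
Qed.

Lemma bruhat_mulS_r i x y : le x y -> le x (y * s i) \/ le (x * s i) (y * s i).
Proof.
elim=> [|y' t xy IH Tt h]; first by right; apply: bruhat_refl.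
case: (pselect (t = s i)) => [e|ne]; first by left; rewrite e (mulgSK cox).
have [h1 h2] := edge_mulS Tt ne h.
by case: IH => IH; [left|right]; rewrite -edge_mulSE; apply: bruhat_step.
Qed.

Lemma bruhat_S_up x i : ~~ rdn x (s i) -> le x (x * s i).
Proof. by rewrite (rdnPn cox) //; [apply: bruhat_edge|]; apply: Ts. Qed.

Lemma bruhat_S_down x i : rdn x (s i) -> le (x * s i) x.
Proof.
move=> h; rewrite -{2}(mulgSK cox i x); apply: bruhat_S_up.
by rewrite (rdn_mulT cox) ?negbK //; apply: Ts.
Qed.

Lemma lift_mulS_le i x y : le x y -> rdn y (s i) -> le (x * s i) y.
Proof.
by move=> /(bruhat_mulS_l i) [//|h] /bruhat_S_down; apply: bruhat_trans.
Qed.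
Lemma lift_mulS_up i x y : le x y -> ~~ rdn y (s i) -> le (x * s i) (y * s i).
Proof.
by move=> /(bruhat_mulS_l i) [h|//] /bruhat_S_up; apply: bruhat_trans.
Qed.
Lemma lift_le_mulS i x y : le x y -> ~~ rdn x (s i) -> le x (y * s i).
Proof.
by move=> /(bruhat_mulS_r i) [//|h] /bruhat_S_up /bruhat_trans; apply.
Qed.
Lemma lift_mulS_down i x y : le x y -> rdn x (s i) -> le (x * s i) (y * s i).
Proof.
by move=> /(bruhat_mulS_r i) [h|//] /bruhat_S_down /bruhat_trans; apply.
Qed.

Lemma ell_up x i : ~~ rdn x (s i) -> l (x * s i) = (l x).+1.
Proof. by move=> h; rewrite (ell_mulS cox) (negbTE h). Qed.
Lemma ell_dn x i : rdn x (s i) -> l x = (l (x * s i)).+1.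
Proof. by move=> h; rewrite (ell_mulS cox) h prednK // (leq_ltn_trans _ h). Qed.
Lemma rdn_S x i : rdn (x * s i) (s i) = ~~ rdn x (s i).
Proof. exact/(rdn_mulT cox)/Ts. Qed.

Lemma bruhat_step1 x y : le x y -> l y = (l x).+1 ->
  exists2 t, T t & y = x * t.
Proof.
case=> [/n_Sn //|z t xz Tt h e]; exists t => //; congr (_ * _).
by apply/esym/(bruhat_eq xz); rewrite -ltnS -e.
Qed.

(** Edges may raise the length by more than one, so a coatom cannot be read off a chain of edges. It
    is found for [y * s i], with [s i] a right descent of [y], and lifted back. *)
Lemma bruhat_coatom x y : le x y -> x <> y ->
  exists z t, [/\ le x z, T t, y = z * t & l y = (l z).+1].
Proof.
move=> xy ne.
suff [z [h1 h2 h3]] : exists z, [/\ le x z, le z y & l y = (l z).+1].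
  by have [t Tt e] := bruhat_step1 h2 h3; exists z, t.
have [n] := ubnP (l y); elim: n x y xy ne => // n IH x y xy ne; rewrite ltnS => hn.
have [i hi] : exists i, rdn y (s i).
  apply: (right_descent cox) => y1; have := bruhat_lt xy ne; by rewrite y1 (ell1 cox).
have base : le x (y * s i) -> exists z, [/\ le x z, le z y & l y = (l z).+1].
  by move=> h; exists (y * s i); split => //; [apply: bruhat_S_down|apply: ell_dn].
case hx: (rdn x (s i)); last first.
  by apply: base; apply: lift_le_mulS; rewrite ?hx.
have xy' := lift_mulS_down xy hx.
have ne' : x * s i <> y * s i by move/mulIg.
have [z [xz zy ez]] := IH _ _ xy' ne' (leq_trans hi hn).
case hz: (rdn z (s i)).
  apply: base; apply: bruhat_trans zy.
  by rewrite -(mulgSK cox i x); apply: lift_mulS_le.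
have hz' : ~~ rdn z (s i) by rewrite hz.
exists (z * s i); split.
- by rewrite -(mulgSK cox i x); apply: lift_mulS_up.
- apply: lift_mulS_le => //; apply: bruhat_trans zy _; exact: bruhat_S_down.
- by rewrite ell_up // (ell_dn hi) ez.
Qed.

Lemma bruhat_atom x y : le x y -> x <> y ->
  exists t, [/\ T t, le (x * t) y & l (x * t) = (l x).+1].
Proof.
have [n] := ubnP (l y); elim: n y => // n IH y; rewrite ltnS => hn xy ne.
have [z [t [xz Tt e ez]]] := bruhat_coatom xy ne.
case: (pselect (x = z)) => [xz'|ne'].
  by exists t; rewrite xz' -e; split => //; apply: bruhat_refl.
have zn : (l z < n)%N by rewrite -ez.
have [t' [Tt' h1 h2]] := IH z zn xz ne'.
exists t'; split => //; apply: bruhat_trans h1 _; rewrite e.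
by apply: bruhat_edge => //; rewrite -e ez.
Qed.

(** This finiteness lets extremal labels be chosen and the labels below [y] be listed even when [W]
    is infinite. *)
Lemma lower_finite y : exists L : seq W, forall z, le z y -> z \in L.
Proof.
have [n] := ubnP (l y); elim: n y => // n IH y; rewrite ltnS => hn.
case: (pselect (y = 1)) => [->|/(right_descent cox)[i hi]].
  by exists [:: 1] => z /bruhat_ell; rewrite (ell1 cox) leqn0 => /eqP/(ell_eq0 cox)->; rewrite inE.
have [L hL] := IH _ (leq_trans hi hn).
exists (L ++ [seq z * s i | z <- L]) => z /(bruhat_mulS_r i)[/hL h|/hL h]; rewrite mem_cat ?h //.
by apply/orP; right; apply/mapP; exists (z * s i); rewrite ?(mulgSK cox).
Qed.

Lemma bruhat_inv x y : le x y -> le x^-1 y^-1.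
Proof.
elim=> [|z t _ IH Tt h]; first exact: bruhat_refl.
rewrite invgM (reflV cox Tt).
have -> : t * z^-1 = z^-1 * (z * t * z^-1) by gsimp.
apply: bruhat_step => //; first exact: refl_conjV.
by gsimp; rewrite (ellV cox) -(ellV cox (t * _)) invgM invgK (reflV cox Tt).
Qed.

Lemma bruhat_mul_r a b u : le a b -> l (b * u) = (l b + l u)%N -> le (a * u) (b * u).
Proof.
have [n] := ubnP (l u); elim: n u => // n IH u; rewrite ltnS => hn ab.
case: (pselect (u = 1)) => [->|/(right_descent cox)[i hi]]; first by rewrite !mulg1.
move=> e; have h1 := ell_dn hi; have h2 := ellM cox b (u * s i).
have h3 := ell_mulS cox (b * u) i.
have e' : l (b * (u * s i)) = (l b + l (u * s i))%N.
  by move: h2 h3; rewrite !gmulA; case: ifP; lia.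
rewrite -(mulgSK cox i (a * u)) -(mulgSK cox i (b * u)) -!(gmulA _ u).
apply: lift_mulS_up; first by apply: IH => //; rewrite (leq_trans _ hn) ?h1.
by rewrite gmulA rdn_S negbK /right_inversion -gmulA e' e h1 addnS.
Qed.

Lemma bruhat_mul_l a b u : le a b -> l (u * b) = (l u + l b)%N -> le (u * a) (u * b).
Proof.
move=> ab e; rewrite -(invgK (u * a)) -(invgK (u * b)); apply: bruhat_inv.
rewrite !invgM; apply: bruhat_mul_r; first exact: bruhat_inv.
by rewrite -invgM !(ellV cox) e addnC.
Qed.

(* A form of [a * v^-1 <= c * v^-1] for the downward Demazure product. *)
Lemma bruhat_mulV a c v : le a c -> exists2 z, le z v & le (a * z^-1) (c * v^-1).
Proof.
have [n] := ubnP (l v); elim: n a c v => // n IH a c v; rewrite ltnS => hn ac.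
case: (pselect (v = 1)) => [->|/(right_descent cox)[i hi]].
  by exists 1; [exact: bruhat_refl|rewrite !invg1 !mulg1].
have hv : (l (v * s i) < n)%N by exact: leq_trans hi hn.
have ev : v^-1 = s i * (v * s i)^-1 by rewrite invgM (simpleV cox) (mulSgK cox).
rewrite ev gmulA; case: (bruhat_mulS_r i ac) => h.
  have [z z1 z2] := IH _ _ _ hv h; exists z => //.
  exact/(bruhat_trans z1)/bruhat_S_down.
have [z z1 z2] := IH _ _ _ hv h; exists (z * s i).
  have := bruhat_mulS_l i z1; rewrite (mulgSK cox) => -[h1|//].
  exact/(bruhat_trans h1)/bruhat_S_down.
by rewrite invgM (simpleV cox) gmulA.
Qed.

Lemma coversP x y : covers le x y <-> le x y /\ l y = (l x).+1.
Proof.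
split=> [[xy ne h]|[xy e]].
  split=> //; have [t [Tt h1 e1]] := bruhat_atom xy ne; rewrite -e1.
  have [e|-> //] : x * t = x \/ x * t = y.
    by apply: h => //; apply: bruhat_edge => //; rewrite e1.
  by have := mulT_neq cox Tt e.
split=> // [exy|r xr ry]; first by move: e; rewrite exy => /n_Sn.
case: (pselect (x = r)) => [->|ne]; [by left|right].
by apply: bruhat_eq ry _; rewrite e; apply: bruhat_lt.
Qed.

End Bruhat.

(** * Dihedral reflection subgroups *)

Section Generated.
Variable W : groupType.
Implicit Types (A B : set W) (x y : W).

Lemma generated_subgroup A : is_subgroup (generated A).
Proof.
split=> [|x y hx hy|x hx] B BB; have [[h1 hM hV] _] := BB => //.
  by apply: hM; [apply: hx|apply: hy].
by apply: hV; apply: hx.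
Qed.

Lemma generated_sub A x : A x -> generated A x.
Proof. by move=> Ax B [_]; apply. Qed.

Lemma generated_min A B : is_subgroup B -> (forall x, A x -> B x) ->
  forall x, generated A x -> B x.
Proof. by move=> sB AB x; apply. Qed.

Lemma generated1 A : generated A 1.
Proof. by case: (generated_subgroup A). Qed.
Lemma generatedM A x y : generated A x -> generated A y -> generated A (x * y).
Proof. by case: (generated_subgroup A) => _ h _; apply: h. Qed.
Lemma generatedV A x : generated A x -> generated A x^-1.
Proof. by case: (generated_subgroup A) => _ _; apply. Qed.

End Generated.

Section Dihedral.
Variables (I : Type) (W : groupType) (s : I -> W).
Hypothesis cox : coxeter_system s.

Local Notation T := (reflections s).
Local Notation l := (ell s).
Local Notation rdn := (right_inversion s).
Local Notation Ts := (refl_simple s).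

Implicit Types r t u c x y z g : W.

Definition dih (r r' : W) : set W := generated [set r; r']%classic.

(** The alternating word of [k] letters that ends in [r]; unlike [alternating], it also reaches the
    rotations. *)
Fixpoint altw (r r' : W) k : W := if k is k'.+1 then altw r' r k' * r else 1.

Lemma altw_odd r r' k : altw r r' k.*2.+1 = alternating r r' k.
Proof.
elim: k => [|k IH]; first by rewrite /= mul1g /alternating expg0 mulg1.
rewrite doubleS /=; move: IH; rewrite /= => ->.
by rewrite /alternating expgSr !gmulA.
Qed.

Lemma altw_even r r' k : altw r r' k.*2 = (r' * r) ^+ k.
Proof. by elim: k => // k IH; rewrite doubleS /= IH expgSr gmulA. Qed.

Lemma alternatingE r r' k : alternating r r' k = (r * r') ^+ k * r.
Proof.
elim: k => [|k IH]; first by rewrite /alternating !expg0 mulg1 mul1g.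
rewrite expgS -(gmulA _ _ r) -IH /alternating expgS !gmulA //.
Qed.

Lemma alternatingS r r' k : alternating r r' k.+1 = r * alternating r' r k * r.
Proof. by rewrite (alternatingE r' r) /alternating expgSr !gmulA. Qed.

Lemma dih_sym r r' : dih r r' = dih r' r.
Proof. by rewrite /dih; congr generated; rewrite classical_sets.setUC. Qed.

Lemma dih_l r r' : dih r r' r.
Proof. by apply: generated_sub; left. Qed.
Lemma dih_r r r' : dih r r' r'.
Proof. by apply: generated_sub; right. Qed.
Lemma dihM r r' x y : dih r r' x -> dih r r' y -> dih r r' (x * y).
Proof. exact: generatedM. Qed.
Lemma dih_conj r r' x y : dih r r' x -> dih r r' y -> dih r r' (x * y * x).
Proof. by move=> hx hy; do 2 apply: dihM => //. Qed.

Lemma dih_altw r r' k : dih r r' (altw r r' k).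
Proof.
elim: k r r' => [|k IH] r r'; first exact: generated1.
by apply: dihM; [rewrite dih_sym; apply: IH|apply: dih_l].
Qed.

Lemma dih_alternating r r' k : dih r r' (alternating r r' k).
Proof. by rewrite -altw_odd; apply: dih_altw. Qed.
Lemma dih_alternating' r r' k : dih r r' (alternating r' r k).
Proof. by rewrite dih_sym; apply: dih_alternating. Qed.

Lemma dihP r r' x : T r -> T r' -> dih r r' x ->
  exists k, x = altw r r' k \/ x = altw r' r k.
Proof.
move=> Tr Tr'; pose B : set W := fun x => exists k, x = altw r r' k \/ x = altw r' r k.
have Br y : B y -> B (y * r).
  case=> k [->|->]; last by exists k.+1; left.
  case: k => [|k] /=; first by exists 1%N; left.
  by exists k; right; rewrite (mulgTK cox).
have Br' y : B y -> B (y * r').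
  case=> k [->|->]; first by exists k.+1; right.
  case: k => [|k] /=; first by exists 1%N; right.
  by exists k; left; rewrite (mulgTK cox).
(* [B] is not visibly closed under products, so the subgroup used consists of the elements whose
   right translation, together with that of their inverse, preserves [B]. *)
pose D : set W := fun x => (forall y, B y -> B (y * x)) /\ (forall y, B y -> B (y * x^-1)).
have sD : is_subgroup D.
  split=> [|u v [u1 u2] [v1 v2]|u [u1 u2]].
  - by split=> y; rewrite ?invg1 mulg1.
  - split=> y By; first by rewrite gmulA; apply/v1/u1.
    by rewrite invgM gmulA; apply/u2/v2.
  - by split=> y; rewrite ?invgK; [apply: u2|apply: u1].
move=> hx; suff [h _] : D x by rewrite -[x]mul1g; apply: h; exists 0%N; left.
apply: (generated_min sD) hx => y [->|->]; split=> z; rewrite ?(reflV cox) //;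
  by [apply: Br|apply: Br'].
Qed.

Lemma altw_parity r r' k : T r -> T r' -> odd (l (altw r r' k)) = odd k.
Proof.
elim: k r r' => [|k IH] r r' Tr Tr'; first by rewrite /= (ell1 cox).
by rewrite /= (ell_parity cox) IH // (refl_odd cox) // addbT.
Qed.

Lemma refl_alternating r r' k : T r -> T r' -> T (alternating r r' k).
Proof.
elim: k r r' => [|k IH] r r' Tr Tr'; first by rewrite /alternating expg0 mulg1.
by rewrite alternatingS; apply: (refl_conjT cox) => //; apply: IH.
Qed.

Lemma dih_oddP r r' x : T r -> T r' -> dih r r' x -> odd (l x) ->
  exists k, x = alternating r r' k \/ x = alternating r' r k.
Proof.
move=> Tr Tr' /dihP[] // k [->|->]; rewrite altw_parity // => ok; exists k./2;
 [left|right]; by rewrite -altw_odd -[in LHS](odd_double_half k) ok.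
Qed.

Lemma dih_odd_refl r r' x : T r -> T r' -> dih r r' x -> odd (l x) -> T x.
Proof. by move=> Tr Tr' hx /(dih_oddP Tr Tr' hx)[k [->|->]]; apply: refl_alternating. Qed.

Lemma expgV_swap r r' n : T r -> T r' -> ((r * r') ^+ n)^-1 = (r' * r) ^+ n.
Proof. by move=> Tr Tr'; rewrite -expVgn; congr (_ ^+ n); rewrite invgM !(reflV cox). Qed.

Lemma order_gt_sym r r' n : T r -> T r' -> order_gt (r * r') n -> order_gt (r' * r) n.
Proof.
move=> Tr Tr' h j hj e; apply: (h j hj).
by apply: invg_inj; rewrite expgV_swap // e invg1.
Qed.

Lemma order_gtW (x : W) m n : (m <= n)%N -> order_gt x n -> order_gt x m.
Proof. by move=> mn h j /andP[h1 h2]; apply: h; rewrite h1 (leq_trans h2). Qed.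

(** The reflection is named from its nearer end. If [(r * r') ^+ j = 1] with [0 < j <= k.*2], the
    index [k] can be lowered to [k - j], or to [j - k - 1] counted from the other generator; so the
    least index is within the order bound. *)
Lemma dih_reflP r r' t : T r -> T r' -> T t -> dih r r' t ->
  exists k, order_gt (r * r') k.*2 /\ (t = alternating r r' k \/ t = alternating r' r k).
Proof.
move=> Tr Tr' Tt ht.
pose P k := `[< t = alternating r r' k \/ t = alternating r' r k >].
have exP : exists k, P k.
  by have [k h] := dih_oddP Tr Tr' ht (refl_odd cox Tt); exists k; apply/asboolP.
have [k /asboolP Pk kmin] := ex_minnP exP; exists k; split=> // j /andP[j0 jk] e.
have red a b : T a -> T b -> (a * b) ^+ j = 1 ->
    exists2 k', (k' < k)%N & alternating a b k = alternating a b k' \/ alternating a b k = alternating b a k'.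
  move=> Ta Tb ej; case: (leqP j k) => jk'.
    exists (k - j)%N; first by lia.
    by left; rewrite !alternatingE -{1}(subnK jk') expgnDr ej mulg1.
  exists (j - k).-1; first by lia.
  right; rewrite [in LHS]alternatingE /alternating.
  apply: (mulgI ((a * b) ^+ (j - k))); rewrite [LHS]gmulA -expgnDr subnK; last exact: ltnW.
  rewrite ej mul1g.
  rewrite -(expgV_swap (j - k) Tb Ta); apply: (mulgI ((b * a) ^+ (j - k))).
  rewrite [RHS]gmulA mulgV mul1g -[X in (b * a) ^+ X]prednK ?subn_gt0 // expgSr.
  by rewrite gmulA (mulgTK cox) // -alternatingE.
have [k' k'k h] : exists2 k', (k' < k)%N & t = alternating r r' k' \/ t = alternating r' r k'.
  case: Pk => ->; first by apply: red.
  have ej : (r' * r) ^+ j = 1 by rewrite -expgV_swap // e invg1.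
  by have [k' h1 h2] := red r' r Tr' Tr ej; exists k' => //; case: h2 => ->; [right|left].
by have := kmin k' (asboolT h); rewrite leqNgt k'k.
Qed.

End Dihedral.

(** * Canonical generators of dihedral reflection subgroups *)

Section CanonicalPairs.
Variables (I : Type) (W : groupType) (s : I -> W).
Hypothesis cox : coxeter_system s.

Local Notation T := (reflections s).
Local Notation l := (ell s).
Local Notation rdn := (right_inversion s).
Local Notation Ts := (refl_simple s).
Implicit Types r t u c x y z g : W.

(** For a reflection [r] of a reflection subgroup [D], this is Dyer's condition for a canonical
    generator, stated with right inversions. *)
Definition isolated r (D : set W) : Prop :=
  forall t, T t -> D t -> rdn r t -> t = r.

Definition canonical_pair r r' : Prop :=
  [/\ T r, T r', r <> r', isolated r (dih r r') & isolated r' (dih r r')].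

Lemma canonical_pair_sym r r' : canonical_pair r r' -> canonical_pair r' r.
Proof. by case=> h1 h2 h3 h4 h5; split=> //; [exact/nesym|rewrite dih_sym|rewrite dih_sym]. Qed.

Lemma rdn_isolated r D t : T r -> isolated r D -> T t -> D t -> rdn r t = (t == r).
Proof.
by move=> Tr ir Tt Dt; apply/idP/eqP => [/(ir t Tt Dt)//|->]; apply: (rdn_refl cox).
Qed.

Lemma simple_isolated i D : isolated (s i) D.
Proof. by move=> t Tt _; rewrite (rdn_simple cox) // => /eqP. Qed.

(** Inside its dihedral subgroup a canonical pair behaves like two simple reflections: isolation
    leaves each letter a single inversion there, and the cocycle identity adds up the contributions
    of the letters. *)
Lemma rdn_altw r r' k t : canonical_pair r r' -> T t -> dih r r' t ->
  rdn (altw r r' k) t = odd (\sum_(j < k) (t == alternating r r' j)).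
Proof.
elim: k r r' t => [|k IH] r r' t cp Tt Dt; first by rewrite big_ord0 /= (rdn1 cox).
have [Tr Tr' ne ir ir'] := cp.
have Drtr : dih r' r (r * t * r) by rewrite dih_sym; apply: dih_conj => //; apply: dih_l.
have Trtr := refl_conjT cox Tt Tr.
rewrite /= (rdn_mul cox) // (rdn_isolated Tr ir) // (reflV cox) // IH //; last exact: canonical_pair_sym.
rewrite big_ord_recl oddD oddb /=.
have -> : alternating r r' 0 = r by rewrite /alternating expg0 mulg1.
congr (_ (+) odd _); apply: eq_bigr => j _; congr nat_of_bool.
rewrite /bump /= add1n alternatingS; apply/eqP/eqP => [<-|->];
 by rewrite !gmulA (refl_invol cox) // mul1g (mulgTK cox).
Qed.

(** Written from its nearer end [a], the reflection [c] has [a] as an inversion, since the order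
    bound makes [a] occur exactly once among the reflections of the alternating word. Isolation of
    [c] then gives [c = a]. *)
Lemma canonical_pair_uniq r r' c : canonical_pair r r' -> T c -> dih r r' c ->
  isolated c (dih r r') -> c = r \/ c = r'.
Proof.
move=> cp Tc Dc ic.
have key a b k : canonical_pair a b -> isolated c (dih a b) -> order_gt (a * b) k.*2 ->
    c = alternating a b k -> c = a.
  move=> cpab ic' og ck; have [Ta Tb _ _ _] := cpab.
  apply/esym; apply: ic' => //; first exact: dih_l.
  rewrite ck -altw_odd rdn_altw //; last exact: dih_l.
  rewrite big_ord_recl {1}/alternating expg0 mulg1 eqxx big1 // => j _.
  apply/eqP; rewrite eqb0; apply/eqP => e.
  have /(_ j.+1) := order_gt_sym cox Ta Tb og; apply=> //=.
  by apply: (mulgI a); rewrite mulg1 [RHS]e.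
have [Tr Tr' _ _ _] := cp.
have [k [og [ck|ck]]] := dih_reflP cox Tr Tr' Tc Dc; [left|right]; apply: (key _ _ k) ck => //.
- exact: canonical_pair_sym.
- by rewrite dih_sym.
- exact: (order_gt_sym cox).
Qed.

Lemma canonical_generatorsE r r' : canonical_pair r r' ->
  canonical_generators s (dih r r') = [set r; r']%classic.
Proof.
move=> cp; have [Tr Tr' ne ir ir'] := cp.
have dnE c t : T c -> T t -> rdn c t <-> (l (t * c) < l c)%N.
  by move=> Tc Tt; rewrite (rdn_inv cox) // (reflV cox Tc).
apply/seteqP; split=> c /=.
  move=> [Tc e]; apply: (canonical_pair_uniq cp) => //.
    by have [] : (inversions s c `&` dih r r')%classic c by rewrite e.
  move=> t Tt Dt /(dnE c t Tc Tt) h.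
  by have : (inversions s c `&` dih r r')%classic t by []; rewrite e.
have can a : T a -> isolated a (dih r r') -> dih r r' a ->
    T a /\ (inversions s a `&` dih r r')%classic = [set a]%classic.
  move=> Ta ia Da; split=> //; apply/seteqP; split=> t /=.
    by move=> [[Tt /(dnE a t Ta Tt) h] Dt]; apply: ia.
  by move=> ->; split=> //; split=> //; apply/(dnE a a) => //; apply: (rdn_refl cox).
by case=> ->; apply: can => //; [apply: dih_l|apply: dih_r].
Qed.

(* Dyer's theorem for a dihedral subgroup containing [s i].  A reflection of the
   subgroup that is not isolated is conjugate, within the subgroup, to a
   reflection of smaller depth, so the isolated reflections generate; two isolated
   [c1], [c2] other than [s i] would make [c1 * s i * c2 = c2 * s i * c1] a
   reflection that is not an inversion of itself. *)
Lemma exists_canonical_pair i a b : T a -> T b -> a <> b -> dih a b (s i) ->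
  exists c, canonical_pair (s i) c /\ forall x, dih a b x -> dih (s i) c x.
Proof.
move=> Ta Tb ab Di; have Ti := Ts i.
pose D := dih a b.
pose chi : set W := fun c => [/\ T c, D c & isolated c D].
have chii : chi (s i) by split=> //; apply: simple_isolated.
have gen n : forall x j, (l x < n)%N -> D (x * s j * x^-1) -> generated chi (x * s j * x^-1).
  elim: n => // n IH x j; rewrite ltnS => hn; set u := x * s j * x^-1 => Du.
  have Tu : T u by apply: refl_conjV; apply: Ts.
  case: (pselect (isolated u D)) => [iu|niu]; first by apply: generated_sub.
  (* An inversion [w] of [u] in [D] other than [u] comes from [x^-1]: either [w] or [u * w * u] is
     an inversion of [x^-1]. That reflection has smaller depth, and conjugating [u] by it shortens
     [x]. *)
  have [v [Tv Dv vu hv]] : exists v, [/\ T v, D v, v <> u & rdn x^-1 v].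
    have [w [Tw Dw hw wu]] : exists w, [/\ T w, D w, rdn u w & w <> u].
      apply: contrapT => h; apply: niu => w Tw Dw hw; apply: contrapT => wu.
      by apply: h; exists w.
    have Tuwu := refl_conjT cox Tw Tu.
    have E : rdn u w = rdn x^-1 w (+) rdn x^-1 (u * w * u).
      rewrite {1}/u (rdn_mul cox) // invgK; congr (_ (+) _).
      rewrite (rdn_mul cox) ?(rdn_simple cox); try exact: refl_conj.
      have -> : (x^-1 * w * x == s j) = false.
        by apply/eqP => e; apply: wu; rewrite /u -e; gsimp.
      have := rdn_mul cox x^-1 x Tuwu; rewrite mulVg (rdn1 cox) /= => h.
      have := rdn_mul cox x x^-1 Tuwu; rewrite mulgV (rdn1 cox) invgK => h'.
      move: h'; rewrite /u; gsimp; rewrite (simpleV cox).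
      by case: (right_inversion _ _ _); case: (right_inversion _ _ _).
    case hw': (rdn x^-1 w); first by exists w.
    exists (u * w * u); split => //; last by move: hw; rewrite E hw'.
      by apply: dih_conj.
    move=> e; apply: wu; apply: (mulgI u); apply: (mulIg u).
    by rewrite e (refl_invol cox) // mul1g.
  have [y [k [ev hy]]] := rdn_exchange cox Tv hv.
  rewrite (ellV cox) in hy.
  have gv : generated chi v.
    by rewrite ev; apply: IH; [exact: leq_trans hy hn|rewrite -ev].
  have -> : u = v * (v * u * v) * v by rewrite !gmulA (refl_invol cox) // mul1g (mulgTK cox).
  have -> : v * u * v = (v * x) * s j * (v * x)^-1.
    by rewrite invgM (reflV cox Tv) /u !gmulA.
  apply: generatedM => //; apply: generatedM => //; apply: IH.
    apply: leq_trans hn; rewrite -(ellV cox x) -(ellV cox (v * x)) invgM (reflV cox Tv).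
    exact: hv.
  rewrite -(_ : v * u * v = (v * x) * s j * (v * x)^-1); first exact: dih_conj.
  by rewrite invgM (reflV cox Tv) /u !gmulA.
have gent t : T t -> D t -> generated chi t.
  by move=> /(reflP s) [j [x ->]]; apply: (gen (l x).+1).
have Da : D a by apply: dih_l.
have Db : D b by apply: dih_r.
have [c [[Tc Dc ic] cne]] : exists c, chi c /\ c <> s i.
  apply: contrapT => h.
  have one t : T t -> D t -> t = s i.
    move=> Tt Dt; have [|//] : t = 1 \/ t = s i; last by move/(refl_neq1 cox Tt).
    apply: (generated_min (B := fun x => x = 1 \/ x = s i)) (gent t Tt Dt).
      split; first by left.
        by move=> x y [->|->] [->|->]; rewrite ?mul1g ?mulg1 ?(simple_invol cox); [left|right|right|left].
      by move=> x [->|->]; rewrite ?invg1 ?(simpleV cox); [left|right].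
    move=> x cx; right; apply: contrapT => xne; apply: h; by exists x.
  by apply: ab; rewrite (one a) // (one b).
have rot r : T r -> D r -> exists k, s i * r = (a * b) ^+ k \/ s i * r = (b * a) ^+ k.
  move=> Tr Dr; have ev : ~~ odd (l (s i * r)) by rewrite (ell_parity cox) !(refl_odd cox).
  have Dir : dih a b (s i * r) by apply: dihM.
  have [k [e|e]] := dihP cox Ta Tb Dir; rewrite e (altw_parity cox) // in ev;
    exists k./2; [right|left]; by rewrite e -altw_even -{1}(odd_double_half k) (negbTE ev).
have comm r1 r2 : T r1 -> D r1 -> T r2 -> D r2 -> r1 * s i * r2 = r2 * s i * r1.
  move=> T1 D1 T2 D2; apply: (mulgI (s i)).
  have [k1 h1] := rot _ T1 D1; have [k2 h2] := rot _ T2 D2.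
  have cX : commute (a * b) (b * a).
    by rewrite /commute !gmulA !(mulgTK cox) // !(refl_invol cox).
  have cm : commute (s i * r1) (s i * r2).
    by case: h1 => ->; case: h2 => ->; apply: commuteX2; [ | |apply: commute_sym| ].
  by move: cm; rewrite /commute !gmulA.
have uniq c1 c2 : chi c1 -> chi c2 -> c1 <> s i -> c2 <> s i -> c1 = c2.
  move=> [T1 D1 i1] [T2 D2 i2] n1 n2; apply: contrapT => ne.
  pose g := c1 * s i * c2; have eg : g = c2 * s i * c1 by apply: comm.
  have Dg : D g by apply: dihM => //; apply: dihM.
  have Tg : T g.
    apply: (dih_odd_refl cox Ta Tb Dg).
    by rewrite /g !(ell_parity cox) !(refl_odd cox).
  have := rdn_refl cox Tg; rewrite {1}/g.
  have D2g : D (c2 * g * c2) by apply: dih_conj.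
  have T2g := refl_conjT cox Tg T2.
  rewrite (rdn_mul cox) // (reflV cox T2) (rdn_isolated T2 i2) //.
  rewrite (rdn_mul cox) // (simpleV cox) (rdn_simple cox) //.
  rewrite (rdn_isolated T1 i1); first last.
  - by apply: dih_conj.
  - exact: (refl_conjT cox).
  - have -> : (g == c2) = false.
      apply/eqP => e; apply: n1; apply: (mulIg (s i)); apply: (mulIg c2).
      by rewrite -/g e (simple_invol cox) mul1g.
    have -> : (c2 * g * c2 == s i) = false.
      apply/eqP => e; apply: ne; apply: (mulgI (s i)); apply: (mulIg c2).
      by rewrite (mulgTK cox) // -[in RHS]e eg !gmulA (refl_invol cox) // mul1g.
    have -> // : (s i * (c2 * g * c2) * s i == c1) = false.
      apply/eqP => e; apply: n2; apply: (mulIg (s i)); apply: (mulgI c1).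
      rewrite (simple_invol cox) mulg1 -[in RHS]e eg !gmulA (mulgTK cox) //.
      by rewrite (simple_invol cox) mul1g.
exists c.
have sub x : dih (s i) c x -> D x.
  by apply: generated_min; [exact: generated_subgroup|move=> y [->|->]].
split; last first.
  have chiD t : generated chi t -> dih (s i) c t.
    apply: (generated_min (generated_subgroup _)) => x cx.
    case: (pselect (x = s i)) => [->|xne]; first exact: dih_l.
    by rewrite (uniq x c) //; apply: dih_r.
  move=> x; apply: (generated_min (generated_subgroup _)) => y [->|->]; by apply: chiD; apply: gent.
split=> //; [exact/nesym|exact: simple_isolated|by move=> u Tu /sub; apply: ic].
Qed.

End CanonicalPairs.

(** * Reflection orders *)

Section ReflectionOrders.
Variables (I : Type) (W : groupType) (s : I -> W).
Hypothesis cox : coxeter_system s.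

Local Notation T := (reflections s).
Local Notation l := (ell s).
Local Notation rdn := (right_inversion s).
Local Notation Ts := (refl_simple s).
Implicit Types (r t u c x y z g a b : W) (lt : rel W).

(** A strict form confined to reflections, with the dihedral condition stated on canonical pairs;
    reversal and conjugation by [s i] are carried out on this form. *)
Record refl_order lt : Prop := ReflOrder {
  ro_refl : forall a b, lt a b -> T a /\ T b;
  ro_irr : forall a, lt a a = false;
  ro_trans : forall b a c, lt a b -> lt b c -> lt a c;
  ro_total : forall a b, T a -> T b -> a <> b -> lt a b \/ lt b a;
  ro_dih : forall r r', canonical_pair s r r' ->
    dihedral_increasing lt r r' \/ dihedral_increasing lt r' r }.

Lemma ro_asym lt a b : refl_order lt -> lt a b -> lt b a -> False.
Proof. by move=> ro h1 /(ro_trans ro h1); rewrite ro_irr. Qed.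

Lemma ro_nlt lt a b : refl_order lt -> T a -> T b -> a <> b -> ~~ lt a b -> lt b a.
Proof. by move=> ro Ta Tb ne /negbTE h; case: (ro_total ro Ta Tb ne); rewrite ?h. Qed.

Lemma ro_neq lt a b : refl_order lt -> lt a b -> a <> b.
Proof. by move=> ro h e; move: h; rewrite e ro_irr. Qed.

Lemma refl_order_of (le : rel W) : reflection_order s le ->
  refl_order (fun a b => [&& `[< T a >], `[< T b >] & strict le a b]).
Proof.
have P a b : reflect [/\ T a, T b & strict le a b] [&& `[< T a >], `[< T b >] & strict le a b].
  by apply: (iffP and3P) => -[h1 h2 h3]; split=> //; apply/asboolP.
case=> anti tr tot dihe; split.
- by move=> a b /P[].
- by move=> a; rewrite /strict eqxx !andbF.
- move=> b a c /P[Ta Tb /andP[ab ne1]] /P[_ Tc /andP[bc ne2]]; apply/P; split=> //.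
  rewrite /strict (tr b) ?inE //=; apply/eqP => e; rewrite -e in bc.
  by move/eqP: ne1; apply; apply: anti; rewrite ?inE ?ab.
- move=> a b Ta Tb ne; have := tot a b; rewrite !inE => /(_ Ta Tb)/orP[h|h]; [left|right];
  by apply/P; split; rewrite // /strict h; apply/eqP => //; apply/nesym.
- move=> r r' cp; have [Tr Tr' ne _ _] := cp.
  have up a b : T a -> T b -> dihedral_increasing (strict le) a b ->
     dihedral_increasing (fun a b => [&& `[< T a >], `[< T b >] & strict le a b]) a b.
    move=> Ta Tb [h1 h2]; split=> k k' h.
      by move=> /(h1 _ _ h)[h3 h4]; split; apply/P; split=> //; apply: refl_alternating.
    by have h3 := h2 _ _ h; apply/P; split=> //; apply: refl_alternating.
  have D : dihedral_reflection_subgroup s (dih r r') by exists r, r'.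
  by have [h|h] := dihe _ r r' D ne (canonical_generatorsE cox cp); [left|right]; apply: up.
Qed.

Lemma dihedral_increasing_rev lt r r' : T r -> T r' -> dihedral_increasing lt r r' ->
  dihedral_increasing (fun a b => lt b a) r' r.
Proof.
move=> Tr Tr' [h1 h2]; split=> k k'.
  by move=> kk' og; have [] := h1 _ _ kk' (order_gt_sym cox Tr' Tr og).
by move=> og; apply: h2; rewrite addnC; apply: (order_gt_sym cox Tr' Tr).
Qed.

Lemma refl_order_rev lt : refl_order lt -> refl_order (fun a b => lt b a).
Proof.
move=> ro; split.
- by move=> a b /(ro_refl ro)[].
- exact: ro_irr.
- by move=> b a c h1 h2; apply: ro_trans h2 h1.
- by move=> a b Ta Tb ne; apply: ro_total => //; apply/nesym.
- move=> r r' cp; have [Tr Tr' _ _ _] := cp.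
  by case: (ro_dih ro cp) => h; [right|left]; apply: dihedral_increasing_rev.
Qed.

Lemma order_gt1 r r' : T r -> T r' -> r <> r' -> order_gt (r * r') 1.
Proof.
move=> Tr Tr' ne [|[|j]] //= _ e; apply: ne; apply: (mulIg r').
by rewrite (refl_invol cox Tr').
Qed.

Lemma dihedral_first lt r r' t : canonical_pair s r r' -> dihedral_increasing lt r r' ->
  T t -> dih r r' t -> t <> r -> lt r t.
Proof.
move=> [Tr Tr' ne _ _] [h1 h2] Tt Dt tne.
have e0 : r = alternating r r' 0 by rewrite /alternating expg0 mulg1.
have [k [og [e|e]]] := dih_reflP cox Tr Tr' Tt Dt; rewrite e {1}e0.
  case: k og e => [|k] og e; first by case: tne; rewrite e -e0.
  by have [] := h1 0%N k.+1 isT (order_gtW _ og); rewrite -?addnn ?leq_addr.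
apply: h2; rewrite add0n; case: k og e => [|k] og _; first exact: order_gt1.
by apply: order_gtW og; rewrite doubleS !ltnS -addnn leq_addr.
Qed.

Lemma dihedral_last lt r r' t : canonical_pair s r r' -> dihedral_increasing lt r r' ->
  T t -> dih r r' t -> t <> r' -> lt t r'.
Proof.
move=> cp inc Tt Dt tne; have [Tr Tr' _ _ _] := cp.
apply: (dihedral_first (canonical_pair_sym cp) (dihedral_increasing_rev Tr Tr' inc)) => //.
by rewrite dih_sym.
Qed.

Lemma conjT_neq i t : t <> s i -> s i * t * s i <> s i.
Proof.
move=> ne e; apply: ne; apply: (mulgI (s i)); apply: (mulIg (s i)).
by rewrite e (simple_invol cox) mul1g.
Qed.

Lemma conjSK i t : s i * (s i * t * s i) * s i = t.
Proof. by rewrite !gmulA (simple_invol cox) mul1g (mulgSK cox). Qed.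

Lemma conjS_inj i : injective (fun t => s i * t * s i).
Proof. by move=> a b /= e; rewrite -(conjSK i a) e conjSK. Qed.

(* A simple reflection is extremal in every dihedral subgroup containing it. *)
Lemma ro_side lt i t : refl_order lt -> T t -> lt (s i * t * s i) (s i) = lt t (s i).
Proof.
move=> ro Tt; case: (pselect (t = s i)) => [->|tne].
  by rewrite (simple_invol cox) mul1g.
have Di : dih (s i) t (s i) by apply: dih_l.
have [c [cp sub]] := exists_canonical_pair cox (Ts i) Tt (nesym tne) Di.
have Dt : dih (s i) c t by apply: sub; apply: dih_r.
have D' : dih (s i) c (s i * t * s i) by apply: dih_conj => //; apply: dih_l.
have T' := refl_conjT cox Tt (Ts i).
have n' := conjT_neq tne.
case: (ro_dih ro cp) => inc.
  have h1 := dihedral_first cp inc Tt Dt tne.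
  have h2 := dihedral_first cp inc T' D' n'.
  by apply/idP/idP => h3; [case: (ro_asym ro h2 h3)|case: (ro_asym ro h1 h3)].
have cp' := canonical_pair_sym cp; rewrite dih_sym in Dt D'.
by rewrite (dihedral_last cp' inc Tt Dt tne) (dihedral_last cp' inc T' D' n').
Qed.

Lemma ro_side_gt lt i t : refl_order lt -> T t -> lt (s i) (s i * t * s i) = lt (s i) t.
Proof. by move=> /refl_order_rev ro; apply: (ro_side i ro). Qed.

(* Dyer's upper [s i]-conjugate: the reflections below [s i] keep their order,
   those above it are conjugated by [s i], and [s i] becomes the last one. *)
Definition upper_key lt i t : nat := (if t == s i then 2 else if lt t (s i) then 0 else 1)%N.
Definition upper_conj lt i : rel W := fun a b =>
  let f t := if lt t (s i) then t else s i * t * s i in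
  [&& `[< T a >], `[< T b >] & (upper_key lt i a < upper_key lt i b)%N ||
    (upper_key lt i a == upper_key lt i b) && lt (f a) (f b)].

(** The dual of [upper_conj], through the reversed order: reflections above [s i] keep their order,
    those below are conjugated, and [s i] becomes the first. *)
Definition lower_conj lt i : rel W := fun a b => upper_conj (fun a b => lt b a) i b a.

Lemma upper_mixed lt i a b : refl_order lt -> lt a (s i) -> lt (s i) b -> upper_conj lt i a b.
Proof.
move=> ro ha hb; have [Ta _] := ro_refl ro ha; have [_ Tb] := ro_refl ro hb.
rewrite /upper_conj !asboolT // /upper_key ha.
have /eqP/negbTE -> := ro_neq ro ha; have /nesym/eqP/negbTE -> := ro_neq ro hb.
by case: ifP => // /(ro_asym ro hb).
Qed.

Lemma upper_last lt i a : refl_order lt -> T a -> a <> s i -> upper_conj lt i a (s i).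
Proof.
move=> ro Ta ne; rewrite /upper_conj !asboolT //; last exact: Ts.
by rewrite /upper_key eqxx; move/eqP/negbTE: ne => ->; case: ifP.
Qed.

Lemma upper_below lt i a b : refl_order lt -> lt a (s i) -> lt b (s i) ->
  upper_conj lt i a b = lt a b.
Proof.
move=> ro ha hb; have [Ta _] := ro_refl ro ha; have [Tb _] := ro_refl ro hb.
rewrite /upper_conj !asboolT // /upper_key ha hb.
by have /eqP/negbTE -> := ro_neq ro ha; have /eqP/negbTE -> := ro_neq ro hb.
Qed.

Lemma upper_above lt i a b : refl_order lt -> lt (s i) a -> lt (s i) b ->
  upper_conj lt i a b = lt (s i * a * s i) (s i * b * s i).
Proof.
move=> ro ha hb; have [_ Ta] := ro_refl ro ha; have [_ Tb] := ro_refl ro hb.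
rewrite /upper_conj !asboolT // /upper_key.
have /nesym/eqP/negbTE -> := ro_neq ro ha; have /nesym/eqP/negbTE -> := ro_neq ro hb.
by case: ifP => [/(ro_asym ro ha)//|_]; case: ifP => [/(ro_asym ro hb)//|_].
Qed.

Lemma upper_conj_of lt i a b : refl_order lt -> a <> s i -> b <> s i ->
  lt a b -> lt (s i * a * s i) (s i * b * s i) -> upper_conj lt i a b.
Proof.
move=> ro na nb ab sab; have [Ta Tb] := ro_refl ro ab.
have [ha|ha] := ro_total ro Ta (Ts i) na; have [hb|hb] := ro_total ro Tb (Ts i) nb.
- by rewrite upper_below.
- exact: upper_mixed.
- by case: (ro_asym ro ha (ro_trans ro ab hb)).
- by rewrite upper_above.
Qed.

(** Conjugation by [s i] changes whether [u] is an inversion of [a] only if [u] or [a * u * a]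
    equals [s i], and both lie in a subgroup that omits [s i]. *)
Lemma canonical_pair_conj i r r' : canonical_pair s r r' -> ~ dih r r' (s i) ->
  canonical_pair s (s i * r * s i) (s i * r' * s i).
Proof.
move=> [Tr Tr' ne ir ir'] nD.
have Dc x : dih (s i * r * s i) (s i * r' * s i) x -> dih r r' (s i * x * s i).
  apply: (generated_min (B := fun x => dih r r' (s i * x * s i))).
    split; first by rewrite mulg1 (simple_invol cox); apply: generated1.
      move=> y z hy hz; rewrite (_ : s i * (y * z) * s i = (s i * y * s i) * (s i * z * s i)).
        exact: dihM.
      by rewrite !gmulA (mulgSK cox).
    move=> y hy; rewrite (_ : s i * y^-1 * s i = (s i * y * s i)^-1); first exact: generatedV.
    by rewrite !invgM !(simpleV cox) gmulA.
  by move=> y [->|->]; rewrite conjSK; [apply: dih_l|apply: dih_r].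
have iso a : T a -> dih r r' a -> isolated s a (dih r r') ->
    isolated s (s i * a * s i) (dih (s i * r * s i) (s i * r' * s i)).
  move=> Ta Da ia t Tt /Dc; set u := s i * t * s i => Du.
  have Tu : T u by apply: (refl_conjT cox) => //; apply: Ts.
  have -> : t = s i * u * s i by rewrite conjSK.
  have une : u <> s i by move=> e; apply: nD; rewrite -e.
  rewrite (rdn_mulS cox) // => h; congr (_ * _ * _); apply: ia => //.
  move: h; rewrite (rdn_mul cox) // (rdn_simple cox) ?(reflV cox Ta); last exact: (refl_conjT cox).
  suff -> : (a * u * a == s i) = false by rewrite addbF.
  by apply/eqP => e; apply: nD; rewrite -e; apply: dih_conj.
split; try by apply: (refl_conjT cox) => //; apply: Ts.
- by move/conjS_inj.
- by apply: iso => //; apply: dih_l.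
- by apply: iso => //; apply: dih_r.
Qed.

Lemma alternating_conj i r r' k :
  alternating (s i * r * s i) (s i * r' * s i) k = s i * alternating r r' k * s i.
Proof.
elim: k => [|k IH]; first by rewrite /alternating !expg0 !mulg1.
have aS a b : alternating a b k.+1 = alternating a b k * (b * a).
  by rewrite /alternating expgSr [LHS]gmulA.
by rewrite !aS IH !gmulA !(mulgSK cox).
Qed.

Lemma dihedral_range lt r r' t : refl_order lt -> canonical_pair s r r' ->
  dihedral_increasing lt r r' -> T t -> dih r r' t ->
  (t = r \/ lt r t) /\ (t = r' \/ lt t r').
Proof.
move=> ro cp inc Tt Dt; split.
  by case: (pselect (t = r)) => [|ne]; [left|right; apply: (dihedral_first cp)].
by case: (pselect (t = r')) => [|ne]; [left|right; apply: (dihedral_last cp)].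
Qed.

Lemma dihedral_increasing_sub (lt lt' : rel W) r r' : T r -> T r' ->
  (forall a b, T a -> T b -> dih r r' a -> dih r r' b -> lt a b -> lt' a b) ->
  dihedral_increasing lt r r' -> dihedral_increasing lt' r r'.
Proof.
move=> Tr Tr' h [h1 h2]; split=> k k'.
  move=> kk' /(h1 _ _ kk')[h3 h4]; split; apply: h => //;
  by [apply: refl_alternating|apply: dih_alternating|apply: dih_alternating'].
by move=> /h2 h3; apply: h => //; [apply: refl_alternating|apply: refl_alternating|
  apply: dih_alternating|apply: dih_alternating'].
Qed.

Lemma order_gt_conj i r r' n : order_gt (r * r') n -> order_gt (s i * r * s i * (s i * r' * s i)) n.
Proof.
move=> h j hj; rewrite (_ : _ * _ = s i * (r * r') * s i); last by rewrite !gmulA (mulgSK cox).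
have -> : (s i * (r * r') * s i) ^+ j = s i * (r * r') ^+ j * s i.
  elim: j {hj} => [|j IH]; first by rewrite !expg0 mulg1 (simple_invol cox).
  by rewrite !expgSr IH !gmulA (mulgSK cox).
move=> e; apply: (h j hj); apply: (mulgI (s i)); apply: (mulIg (s i)).
by rewrite e mulg1 (simple_invol cox).
Qed.

(** Compare the order on the subgroup with the one on its conjugate by [s i]. If they run in the
    same direction, [upper_conj_of] settles each pair. If they run in opposite directions, [ro_side]
    forces the whole subgroup onto one side of [s i], where [upper_conj] is one of the two. *)
Lemma upper_dih_notin lt i r r' : refl_order lt -> canonical_pair s r r' ->
  ~ dih r r' (s i) -> dihedral_increasing lt r r' ->
  dihedral_increasing (upper_conj lt i) r r' \/ dihedral_increasing (upper_conj lt i) r' r.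
Proof.
move=> ro cp nD inc; have [Tr Tr' ne _ _] := cp.
have cp' := canonical_pair_conj cp nD.
have Dr : dih r r' r by apply: dih_l.
have Dr' : dih r r' r' by apply: dih_r.
have nes t : dih r r' t -> t <> s i by move=> Dt e; apply: nD; rewrite -e.
have dinc a b : T a -> T b -> dihedral_increasing lt (s i * a * s i) (s i * b * s i) ->
    dihedral_increasing (fun x y => lt (s i * x * s i) (s i * y * s i)) a b.
  move=> Ta Tb [h1 h2]; split=> k k'.
    move=> kk' /order_gt_conj-/(_ i) og; rewrite -!alternating_conj; exact: h1.
  by move=> /order_gt_conj-/(_ i) og; rewrite -!alternating_conj; apply: h2.
have [inc'|inc'] := ro_dih ro cp'; have {}inc' := dinc _ _ _ _ inc'.
  left; have [h1 h2] := inc; have [h3 h4] := inc' Tr Tr'; split=> k k'.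
    move=> kk' og; have [g1 g2] := h1 _ _ kk' og; have [g3 g4] := h3 _ _ kk' og.
    have na (n : nat) : alternating r r' n <> s i by apply: nes; apply: dih_alternating.
    have nb (n : nat) : alternating r' r n <> s i by apply: nes; apply: dih_alternating'.
    by split; apply: upper_conj_of.
  move=> og; apply: upper_conj_of; [exact: ro| | |exact: h2|exact: h4]; apply: nes;
    by [apply: dih_alternating|apply: dih_alternating'].
have {}inc' := inc' Tr' Tr.
have rr' : lt r r'.
  by apply: (dihedral_first cp inc) => //; apply/nesym.
have sr'r : lt (s i * r' * s i) (s i * r * s i).
  case: inc' => _ /(_ 0 0)%N; rewrite /alternating !expg0 !mulg1; apply.
  by apply: order_gt1 => //; apply/nesym.
case: (ro_total ro Tr (Ts i) (nes _ Dr)) => hr.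
  have hr' : lt r' (s i).
    apply: contrapT => /negP h; have := ro_nlt ro Tr' (Ts i) (nes _ Dr') h => h'.
    by rewrite -(ro_side_gt i ro) // in h'; rewrite -(ro_side i ro) // in hr;
      apply: (ro_asym ro sr'r (ro_trans ro hr h')).
  left; apply: (dihedral_increasing_sub (lt := lt)) => // a b Ta Tb Da Db ab.
  have below t : T t -> dih r r' t -> lt t (s i).
    move=> Tt Dt; have [_ [->//|h]] := dihedral_range ro cp inc Tt Dt.
    exact: ro_trans h hr'.
  by rewrite upper_below //; apply: below.
right; apply: (dihedral_increasing_sub (lt := fun x y => lt (s i * x * s i) (s i * y * s i))) => //.
rewrite dih_sym => a b Ta Tb Da Db ab.
have above t : T t -> dih r r' t -> lt (s i) t.
  move=> Tt Dt; have [[->//|h] _] := dihedral_range ro cp inc Tt Dt.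
  exact: ro_trans hr h.
by rewrite upper_above //; apply: above.
Qed.

(** If [s i] is last in the subgroup, nothing moves. If it is first, conjugation takes
    [alternating c (s i) k] to [alternating (s i) c k.+1]; this reverses the other reflections, and
    [s i] goes to the end. *)
Lemma upper_dih_in lt i c : refl_order lt -> canonical_pair s (s i) c ->
  dihedral_increasing (upper_conj lt i) c (s i).
Proof.
move=> ro cp; have [Ti Tc ne _ _] := cp.
have cp' := canonical_pair_sym cp.
case: (ro_dih ro cp) => inc; last first.
  have below t : T t -> dih c (s i) t -> t <> s i -> lt t (s i).
    by move=> Tt Dt; apply: (dihedral_last cp' inc).
  apply: (dihedral_increasing_sub (lt := lt)) inc => // a b Ta Tb Da Db ab.
  have na : a <> s i.
    move=> e; move: ab; rewrite e => ab; have nb := nesym (ro_neq ro ab).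
    exact: ro_asym ro ab (below _ Tb Db nb).
  case: (pselect (b = s i)) => [->|nb]; first exact: upper_last.
  by rewrite upper_below //; apply: below.
have above t : T t -> dih (s i) c t -> t <> s i -> lt (s i) t.
  by move=> Tt Dt; apply: (dihedral_first cp inc).
have conj1 k : s i * alternating c (s i) k * s i = alternating (s i) c k.+1.
  by rewrite alternatingS.
have conj2 k : s i * alternating (s i) c k.+1 * s i = alternating c (s i) k.
  by rewrite alternatingS conjSK.
have eq1 n k : order_gt (c * s i) n -> (k < n)%N -> alternating c (s i) k <> s i.
  move=> og kn e; have /(_ k.+1) := og; rewrite kn; apply=> //.
  by rewrite expgSr gmulA -alternatingE e (simple_invol cox).
have eq2 n k : order_gt (c * s i) n -> (0 < k <= n)%N -> alternating (s i) c k <> s i.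
  move=> og /og + e; apply; apply: (mulgI (s i)); by rewrite mulg1 -[RHS]e.
have Ta k : T (alternating c (s i) k) by apply: refl_alternating.
have Tb k : T (alternating (s i) c k) by apply: refl_alternating.
have Da k : dih (s i) c (alternating c (s i) k) by apply: dih_alternating'.
have Db k : dih (s i) c (alternating (s i) c k) by apply: dih_alternating.
have [h1 h2] := inc.
split=> k k'.
  move=> kk' og; have nk : alternating c (s i) k <> s i by apply: eq1 og _.
  have nk' : alternating (s i) c k' <> s i.
    by apply: (eq2 k') => //; rewrite leqnn andbT (leq_ltn_trans _ kk').
  split.
    case: (pselect (alternating c (s i) k' = s i)) => [->|nk2]; first exact: upper_last.
    rewrite upper_above //; try by apply: above.
    rewrite !conj1; apply: (proj1 (h1 _ _ _ _)); first by rewrite ltnS.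
    move=> j /andP[j0]; rewrite leq_eqVlt => /orP[/eqP->|jk]; last first.
      by apply: (order_gt_sym cox Tc Ti og); rewrite j0.
    move=> e; apply: nk2; apply: (mulIg (s i)).
    by rewrite (simple_invol cox) alternatingE -gmulA -expgSr -(expgV_swap cox _ Ti Tc) e invg1.
  case: k kk' nk => [|k] kk' nk.
    have -> : alternating (s i) c 0 = s i by rewrite /alternating expg0 mulg1.
    exact: upper_last.
  rewrite upper_above //; try by apply: above => //; apply: (eq2 k') => //=; rewrite ltnW.
  case: k' kk' og nk' => // k' kk' og nk'; rewrite !conj2.
  apply: (proj2 (h1 _ _ _ _)) => //; apply: (order_gt_sym cox Tc Ti); exact: order_gtW og.
move=> og; have nk : alternating c (s i) k <> s i by apply: (eq1 _ _ og); rewrite ltnS leq_addr.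
case: k' og => [|k'] og.
  have -> : alternating (s i) c 0 = s i by rewrite /alternating expg0 mulg1.
  exact: upper_last.
have nk' : alternating (s i) c k'.+1 <> s i.
  by apply: (eq2 _ _ og); rewrite /=; lia.
rewrite upper_above //; try by apply: above.
rewrite conj1 conj2; apply: h2; apply: (order_gt_sym cox Tc Ti).
by rewrite addSnnS.
Qed.

Lemma refl_order_upper lt i : refl_order lt -> refl_order (upper_conj lt i).
Proof.
move=> ro; split.
- by move=> a b /and3P[/asboolP Ta /asboolP Tb _].
- by move=> a; rewrite /upper_conj ltnn (ro_irr ro) !andbF.
- move=> b a c /and3P[Ta Tb hab] /and3P[_ Tc hbc]; apply/and3P; split=> //.
  move: hab hbc => /orP[h1|/andP[/eqP h1 h1']] /orP[h2|/andP[/eqP h2 h2']].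
  + by rewrite (ltn_trans h1 h2).
  + by rewrite -h2 h1.
  + by rewrite h1 h2.
  + by rewrite h1 h2 eqxx (ro_trans ro h1' h2') orbT.
- move=> a b Ta Tb ne.
  case: (pselect (a = s i)) => [e|na].
    by rewrite e in ne *; right; apply: upper_last => //; apply/nesym.
  case: (pselect (b = s i)) => [->|nb]; first by left; apply: upper_last.
  have [ha|ha] := ro_total ro Ta (Ts i) na; have [hb|hb] := ro_total ro Tb (Ts i) nb.
  + by rewrite !upper_below //; apply: ro_total.
  + by left; apply: upper_mixed.
  + by right; apply: upper_mixed.
  + rewrite !upper_above //; apply: (ro_total ro); try by apply: (refl_conjT cox) => //; apply: Ts.
    by move/conjS_inj.
- move=> r r' cp; have [Tr Tr' ne ir ir'] := cp.
  case: (pselect (dih r r' (s i))) => [D|nD].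
    have [e|e] := canonical_pair_uniq cox cp (Ts i) D (@simple_isolated _ _ _ cox i _).
      by right; rewrite -e; apply: upper_dih_in; rewrite // e.
    by left; rewrite -e; apply: upper_dih_in; rewrite // e; apply: canonical_pair_sym.
  case: (ro_dih ro cp) => inc; first exact: upper_dih_notin.
  apply/or_comm; apply: upper_dih_notin => //; first exact: canonical_pair_sym.
  by rewrite dih_sym.
Qed.

Lemma refl_order_lower lt i : refl_order lt -> refl_order (lower_conj lt i).
Proof. by move=> /refl_order_rev/(refl_order_upper i)/refl_order_rev. Qed.

End ReflectionOrders.

(** * Bruhat intervals of length two *)

Section RankTwo.
Variables (I : Type) (W : groupType) (s : I -> W).
Hypothesis cox : coxeter_system s.

Local Notation T := (reflections s).
Local Notation l := (ell s).
Local Notation le := (bruhat_le s).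
Local Notation rdn := (right_inversion s).
Local Notation Ts := (refl_simple s).
Local Notation ro := (refl_order s).
Implicit Types (r t u c x y z g a b p : W) (lt : rel W).

Lemma order_gtS (x : W) n : order_gt x n -> x ^+ n.+1 <> 1 -> order_gt x n.+1.
Proof. by move=> h ne j /andP[j0]; rewrite leq_eqVlt => /orP[/eqP-> //|jn]; apply: h; rewrite j0. Qed.

Lemma expg_flip (x y : W) n : x * y * x = y -> x ^+ n * y * x ^+ n = y.
Proof.
move=> e; elim: n => [|n IH]; first by rewrite expg0 mulg1 mul1g.
by rewrite {1}expgSr expgS -[in RHS]IH -{2}e !gmulA.
Qed.

(* In the list [s i, s i * c * s i, .., c * s i * c, c] of the reflections, say
   [n] of them, the pairs with product [r * s i] lie at the positions [j] and
   [j - d] modulo [n], where [d] is the position of [r]; such a pair is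
   increasing exactly when [j < d]. *)
Lemma dihedral_pair_lt lt i c r p1 p2 : ro lt -> canonical_pair s (s i) c ->
  dihedral_increasing lt (s i) c ->
  T p1 -> dih (s i) c p1 -> T p2 -> dih (s i) c p2 ->
  r <> s i -> r * s i = p1 * p2 -> lt p1 p2 -> lt p1 r.
Proof.
move=> rolt [Ti Tc ne _ _] [h1 h2] T1 D1 T2 D2 rne e p12.
have re : r = p1 * p2 * s i by rewrite -e (mulgSK cox).
have [j [ogj ej]] := dih_reflP cox Ti Tc T1 D1.
have [k [ogk ek]] := dih_reflP cox Ti Tc T2 D2.
have ogj' : order_gt (s i * c) j by apply: order_gtW ogj; rewrite -addnn leq_addr.
have ogk' : order_gt (s i * c) k by apply: order_gtW ogk; rewrite -addnn leq_addr.
have ogjk : order_gt (s i * c) (j + k)%N.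
  by case: (leqP j k) => h; [apply: order_gtW ogk|apply: order_gtW ogj]; rewrite -addnn ?leq_add2r ?leq_add2l // ltnW.
have flip n : (s i * c) ^+ n * s i * (s i * c) ^+ n = s i.
  by apply: expg_flip; rewrite !gmulA (mulgSK cox) (mulgTK cox).
have cE n : c * (s i * c) ^+ n = s i * (s i * c) ^+ n.+1.
  by rewrite expgS !gmulA (simple_invol cox) mul1g.
have [ej'|ej'] := ej; have [ek'|ek'] := ek.
- have jk : (j < k)%N.
    rewrite ltnNge leq_eqVlt; apply/negP => /orP[/eqP kj|kj].
      by move: p12; rewrite ej' ek' kj (ro_irr rolt).
    by apply: (ro_asym rolt p12); rewrite ej' ek'; case: (h1 _ _ kj ogj').
  have -> : r = alternating c (s i) (k - j.+1).
    rewrite re ej' ek' !(alternatingE (s i)) gmulA (mulgSK cox).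
    by rewrite -{1}(subnKC jk) addSnnS expgnDr gmulA flip /alternating cE.
  rewrite ej'; apply: h2; rewrite (_ : (j + _).+1 = k) //; lia.
- have er : r = alternating (s i) c (j + k).+1.
    rewrite re ej' ek' !(alternatingE (s i)) -addnS expgnDr expgS /alternating.
    by rewrite !gmulA.
  rewrite ej' er; apply: (proj1 (h1 _ _ _ _)); first by rewrite ltnS leq_addr.
  apply: order_gtS => // e1; apply: rne.
  by rewrite er alternatingE e1 mul1g.
- case: (pselect ((s i * c) ^+ (k + j).+1 = 1)) => e1.
    have ep : p1 = p2.
      apply: (mulgI ((s i * c) ^+ j.+1)); rewrite ej' ek' (alternatingE (s i)) /alternating.
      by rewrite cE !gmulA flip -expgnDr addSnnS addnC addSn e1 mul1g.
    by move: p12; rewrite ep (ro_irr rolt).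
  case: (ro_asym rolt p12); rewrite ej' ek'; apply: h2; apply: order_gtS => //.
  by rewrite addnC.
- have kj : (k < j)%N.
    rewrite ltnNge leq_eqVlt; apply/negP => /orP[/eqP kj|kj].
      by move: p12; rewrite ej' ek' kj (ro_irr rolt).
    by apply: (ro_asym rolt p12); rewrite ej' ek'; case: (h1 _ _ kj ogk').
  have -> : r = alternating c (s i) (j - k.+1).
    rewrite re ej' ek' /alternating -{1}(subnK kj) expgnDr [c * _ ^+ k]cE.
    have := mulgSK cox i (c * (s i * c) ^+ (j - k.+1)).
    by rewrite -[X in c * _ * X * _](flip k.+1) !gmulA.
  by rewrite ej'; apply: (proj2 (h1 _ _ _ _)) => //; lia.
Qed.



(* [t1, t2] and [t3, t4] are to be the labels of the two maximal chains of a Bruhat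
   interval of length two. *)
Definition opposite_chains lt t1 t2 t3 t4 : Prop :=
  [/\ lt t1 t2, lt t4 t3, lt t1 t3 & lt t4 t2] \/
  [/\ lt t2 t1, lt t3 t4, lt t3 t1 & lt t2 t4].

Lemma opposite_chains_sym lt t1 t2 t3 t4 :
  opposite_chains lt t1 t2 t3 t4 -> opposite_chains lt t3 t4 t1 t2.
Proof. by case=> -[h1 h2 h3 h4]; [right|left]. Qed.

(** The hypothesis is applied to both conjugated orders. If they give the same pattern, [lt] has it
    on the conjugates. Otherwise they disagree on every compared pair, which happens only when all
    four labels lie on one side of [s i]; on that side one of the two is [lt] after conjugation. *)
Lemma opposite_chains_conj i t1 t2 t3 t4 :
  T t1 -> T t2 -> T t3 -> T t4 -> t1 <> s i -> t2 <> s i -> t3 <> s i -> t4 <> s i ->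
  (forall lt, ro lt -> opposite_chains lt t1 t2 t3 t4) ->
  forall lt, ro lt -> opposite_chains lt (s i * t1 * s i) (s i * t2 * s i)
                                         (s i * t3 * s i) (s i * t4 * s i).
Proof.
move=> T1 T2 T3 T4 n1 n2 n3 n4 h lt rolt.
have sgt a : T a -> lt (s i) (s i * a * s i) = lt (s i) a by apply: ro_side_gt.
have slt a : T a -> lt (s i * a * s i) (s i) = lt a (s i) by apply: ro_side.
have lowbelow a b : lt a (s i) -> lt b (s i) -> lower_conj s lt i a b = lt (s i * a * s i) (s i * b * s i).
  by move=> ha hb; rewrite /lower_conj upper_above //; apply: refl_order_rev.
have lowabove a b : lt (s i) a -> lt (s i) b -> lower_conj s lt i a b = lt a b.
  by move=> ha hb; rewrite /lower_conj upper_below //; apply: refl_order_rev.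
have rol := refl_order_lower cox i rolt; have rou := refl_order_upper cox i rolt.
have lowmixed a b : lt a (s i) -> lt (s i) b -> lower_conj s lt i a b.
  by move=> ha hb; rewrite /lower_conj; apply: upper_mixed => //; apply: refl_order_rev.
have side a : T a -> a <> s i -> lt a (s i) \/ lt (s i) a.
  by move=> Ta na; apply: (ro_total rolt Ta _ na); apply: Ts.
have cmp a b : T a -> T b -> a <> s i -> b <> s i -> upper_conj s lt i a b ->
    lower_conj s lt i a b -> lt (s i * a * s i) (s i * b * s i).
  move=> Ta Tb na nb hu hl; have [ha|ha] := side a Ta na; have [hb|hb] := side b Tb nb.
  - by rewrite -lowbelow.
  - by apply: (ro_trans rolt (b := s i)); rewrite ?slt ?sgt.
  - by case: (ro_asym rou hu); apply: upper_mixed.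
  - by rewrite -upper_above.
have mix a b : T a -> T b -> a <> s i -> b <> s i -> upper_conj s lt i a b ->
    lower_conj s lt i b a -> lt a (s i) /\ lt b (s i) \/ lt (s i) a /\ lt (s i) b.
  move=> Ta Tb na nb hu hl; have [ha|ha] := side a Ta na; have [hb|hb] := side b Tb nb.
  - by left.
  - by case: (ro_asym rol hl); apply: lowmixed.
  - by case: (ro_asym rou hu); apply: upper_mixed.
  - by right.
have no a : lt a (s i) -> lt (s i) a -> False by move=> h1 /(ro_asym rolt h1).
have := h _ rou; have := h _ rol.
case=> -[l1 l2 l3 l4]; case=> -[u1 u2 u3 u4].
- by left; split; apply: cmp.
- have := mix _ _ T2 T1 n2 n1 u1 l1; have := mix _ _ T3 T4 n3 n4 u2 l2; have := mix _ _ T3 T1 n3 n1 u3 l3.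
  case=> [[a3 a1]|[a3 a1]] [[a3' a4]|[a3' a4]] [[a2 a1']|[a2 a1']];
   first [case: (no _ a3 a3') | case: (no _ a3' a3) | case: (no _ a1 a1') | case: (no _ a1' a1) | idtac].
  + by left; split; rewrite -lowbelow.
  + by right; split; rewrite -(upper_above rolt).
- have := mix _ _ T1 T2 n1 n2 u1 l1; have := mix _ _ T4 T3 n4 n3 u2 l2; have := mix _ _ T1 T3 n1 n3 u3 l3.
  case=> [[a1 a3]|[a1 a3]] [[a4 a3']|[a4 a3']] [[a1' a2]|[a1' a2]];
   first [case: (no _ a3 a3') | case: (no _ a3' a3) | case: (no _ a1 a1') | case: (no _ a1' a1) | idtac].
  + by right; split; rewrite -lowbelow.
  + by left; split; rewrite -(upper_above rolt).
- by right; split; apply: cmp.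
Qed.

(** Here [s i] is itself a label, and it is first or last in the dihedral subgroup of the labels.
    The conjugated order that sends it to the other end tells how the conjugates of [r1] and [r2]
    compare, and [dihedral_pair_lt] supplies the one comparison that does not involve [s i]. *)
Lemma opposite_chains_shift i r r1 r2 a b :
  T a -> T b -> a <> b -> dih a b (s i) -> dih a b r -> dih a b r1 -> dih a b r2 ->
  T r -> T r1 -> T r2 -> r <> s i -> r1 <> s i -> r2 <> s i -> s i * r = r1 * r2 ->
  (forall lt, ro lt -> opposite_chains lt (s i) r r1 r2) ->
  forall lt, ro lt -> opposite_chains lt r (s i) (s i * r1 * s i) (s i * r2 * s i).
Proof.
move=> Ta Tb ab Di Dr D1 D2 Tr T1 T2 nr n1 n2 e h lt rolt.
have [c [cp sub]] := exists_canonical_pair cox Ta Tb ab Di.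
move: Dr D1 D2 => /sub Dr /sub D1 /sub D2.
have Tp1 := refl_conjT cox T1 (Ts i); have Tp2 := refl_conjT cox T2 (Ts i).
have Dp t : dih (s i) c t -> dih (s i) c (s i * t * s i).
  by move=> Dt; apply: dih_conj => //; apply: dih_l.
have Dp1 := Dp _ D1; have Dp2 := Dp _ D2.
have np1 := conjT_neq cox n1; have np2 := conjT_neq cox n2.
have ep : r * s i = (s i * r1 * s i) * (s i * r2 * s i).
  by rewrite !gmulA (mulgSK cox) -(gmulA _ r1) -e !gmulA (simple_invol cox) mul1g.
have rou := refl_order_upper cox i rolt; have rol := refl_order_lower cox i rolt.
have rorev := refl_order_rev cox rolt.
case: (ro_dih rolt cp) => inc.
  have first t : T t -> dih (s i) c t -> t <> s i -> lt (s i) t by apply: dihedral_first.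
  have p12 : lt (s i * r1 * s i) (s i * r2 * s i).
    case: (h _ rou) => -[h1 h2 h3 h4]; first by case: (ro_asym rou h1); apply: upper_last.
    by rewrite -upper_above //; apply: first.
  right; split=> //; try by apply: first.
  exact: (dihedral_pair_lt rolt cp inc Tp1 Dp1 Tp2 Dp2 nr ep p12).
have last t : T t -> dih (s i) c t -> t <> s i -> lt t (s i).
  move=> Tt Dt nt; apply: (dihedral_last cox (canonical_pair_sym cp) inc) => //; by rewrite dih_sym.
have p21 : lt (s i * r2 * s i) (s i * r1 * s i).
  case: (h _ rol) => -[h1 h2 h3 h4]; last first.
    by case: (ro_asym rol h1); rewrite /lower_conj; apply: upper_last.
  move: h2; rewrite /lower_conj upper_above //; exact: last.
left; split=> //; try by apply: last.
have [Ti Tc _ _ _] := cp.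
have inc' := dihedral_increasing_rev cox Tc Ti inc.
exact: (dihedral_pair_lt rorev cp inc' Tp1 Dp1 Tp2 Dp2 nr ep p21).
Qed.

Lemma opposite_chains_simple lt i t : ro lt -> T t -> t <> s i ->
  opposite_chains lt (s i) t (s i * t * s i) (s i).
Proof.
move=> rolt Tt nt; have [h|h] := ro_total rolt Tt (Ts i) nt.
  by right; split; rewrite ?ro_side.
by left; split; rewrite ?ro_side_gt.
Qed.

(** Induction through a right descent [s i] of the top. If [s i] raises [x], one of the labels is
    [s i] and the other chain is explicit. If it lowers [x], the interval is replaced by one
    starting at [x * s i]. All orders are treated at once because conjugation changes the order, and
    the dihedral subgroup is carried along for the case where [s i] becomes or stops being a
    label. *)
Lemma rank_two x t1 t2 : T t1 -> T t2 ->
  l (x * t1) = (l x).+1 -> l (x * t1 * t2) = (l x).+2 ->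
  exists t3 t4, [/\ T t3 /\ T t4, t3 <> t1, t1 * t2 = t3 * t4, l (x * t3) = (l x).+1
    & (forall lt, ro lt -> opposite_chains lt t1 t2 t3 t4) /\
      exists a b, [/\ T a, T b, a <> b & [/\ dih a b t1, dih a b t2, dih a b t3 & dih a b t4]]].
Proof.
have [n] := ubnP (l (x * t1 * t2)); elim: n x t1 t2 => // n IH x t1 t2.
set z := x * t1 * t2; rewrite ltnS => hn T1 T2 e1 e2.
have [i hi] : exists i, rdn z (s i).
  by apply: (right_descent cox) => z1; move: e2; rewrite z1 (ell1 cox).
have Ti := Ts i.
have lzs : l (z * s i) = (l x).+1 by apply: succn_inj; rewrite -(ell_dn cox hi).
have zx : z <> x by move=> e; move: e2; rewrite e; lia.
have xz1 : le x (x * t1) by apply: bruhat_edge; rewrite // e1.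
have z1z : le (x * t1) z by apply: bruhat_edge; rewrite // -/z e1 e2.
have a_up : ~~ rdn (x * t1) (s i) -> t2 = s i.
  move=> h; have := lift_le_mulS cox z1z h => h1.
  apply: (mulgI (x * t1)); rewrite -/z -{1}(mulgSK cox i z); congr (_ * _).
  by apply/esym; apply: bruhat_eq h1 _; rewrite lzs e1.
case hx: (rdn x (s i)); last first.
  have hx' : ~~ rdn x (s i) by rewrite hx.
  case: (pselect (t1 = s i)) => [t1i|n1].
    have n2 : t2 <> s i by move=> e; apply: zx; rewrite /z t1i e (mulgSK cox).
    exists (s i * t2 * s i), (s i); rewrite t1i; split=> //.
    - by split=> //; apply: (refl_conjT cox).
    - exact: (conjT_neq cox).
    - by rewrite (mulgSK cox).
    - by rewrite !gmulA -t1i -/z t1i lzs.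
    - split; first by move=> lt rolt; apply: opposite_chains_simple.
      exists (s i), t2; split=> //; first exact/nesym.
      have ? : dih (s i) t2 (s i) by apply: dih_l.
      have ? : dih (s i) t2 t2 by apply: dih_r.
      by split=> //; apply: dih_conj.
  case: (pselect (t2 = s i)) => [t2i|n2].
    exists (s i), (s i * t1 * s i); rewrite t2i; split=> //.
    - by split=> //; apply: (refl_conjT cox).
    - exact: nesym.
    - by rewrite !gmulA (simple_invol cox) mul1g.
    - by rewrite (ell_up cox).
    - split.
        move=> lt rolt; have [h|h] := ro_total rolt T1 Ti n1.
          by left; split; rewrite ?ro_side.
        by right; split; rewrite ?ro_side_gt.
      exists (s i), t1; split=> //; first exact/nesym.
      have ? : dih (s i) t1 (s i) by apply: dih_l.
      have ? : dih (s i) t1 t1 by apply: dih_r.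
      by split=> //; apply: dih_conj.
  case ha: (rdn (x * t1) (s i)); last by case: n2; apply: a_up; rewrite ha.
  case: n1; apply: (mulgI x); rewrite -[LHS](mulgSK cox i); congr (_ * _).
  have h := lift_le_mulS cox xz1 hx'.
  by apply/esym; apply: bruhat_eq h _; rewrite -ltnS -(ell_dn cox ha) e1.
set x' := x * s i.
have lx : l x = (l x').+1 by apply: (ell_dn cox).
have x'i : ~~ rdn x' (s i) by rewrite (rdn_S cox) hx.
have x's : x' * s i = x by apply: (mulgSK cox).
(* The atom [x' * u] of the shifted interval is moved back by [s i]. *)
have back u v : T u -> T v -> u <> s i -> l (x' * u) = (l x').+1 -> x' * u * v = z * s i ->
    l (x * (s i * u * s i)) = (l x).+1 /\ v <> s i.
  move=> Tu Tv nu lu euv.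
  have xu : le x' (x' * u) by apply: bruhat_edge; rewrite // lu.
  have E : x * (s i * u * s i) = x' * u * s i by rewrite !gmulA.
  have hu : ~~ rdn (x' * u) (s i).
    apply/negP => hu; apply: nu; apply: (mulgI x').
    rewrite -[LHS](mulgSK cox i); congr (_ * _).
    have h := lift_le_mulS cox xu x'i.
    by apply/esym; apply: bruhat_eq h _; rewrite -ltnS -(ell_dn cox hu) lu.
  split; first by rewrite E (ell_up cox) // lu lx.
  move=> ev; have uz : x' * u = z by apply: (mulIg (s i)); rewrite -euv ev.
  by move: lu; rewrite uz e2 -lx; lia.
have hn' : (l (z * s i) < n)%N by apply: leq_trans hi hn.
have cj t : T t -> T (s i * t * s i) by move=> Tt; apply: (refl_conjT cox).
(* In this case the shifted interval, from [x'] to [z * s i], contains [x], and its chain through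
   [x] has the labels [s i] and [t1]. *)
case: (pselect (t2 = s i)) => [t2i|n2].
  have zsE : x' * s i * t1 = z * s i by rewrite x's /z t2i (mulgSK cox).
  have [|||||u3 [u4 [[T3 T4] n3 e3 l3 [q [a [b [Ta Tb ab [Ds Dt D3 D4]]]]]]]] := IH x' (s i) t1 => //.
  - by rewrite zsE.
  - by rewrite x's.
  - by rewrite zsE lzs lx.
  have e34 : x' * u3 * u4 = z * s i by rewrite -gmulA -e3 gmulA.
  have [lb n4] := back _ _ T3 T4 n3 l3 e34.
  have nt1 : t1 <> s i by move=> e; apply: zx; rewrite /z t2i e (mulgSK cox).
  exists (s i * u3 * s i), (s i * u4 * s i); split=> //.
  - by split; apply: cj.
  - move=> e; move: lb; rewrite e.
    have : x * t1 = x' * u3 * s i by rewrite -e !gmulA.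
    have := ell_dn cox hi; have -> : z * s i = x * t1 by rewrite /z t2i (mulgSK cox).
    move=> h1 h2; have : z = x' * u3 by rewrite -[LHS](mulgSK cox i) /z t2i (mulgSK cox) h2 (mulgSK cox).
    by move=> h3; move: l3; rewrite -h3 e2 lx; lia.
  - by rewrite t2i !gmulA (mulgSK cox) -(gmulA (s i)) -e3 !gmulA (simple_invol cox) mul1g.
  - split; first by rewrite t2i; apply: (opposite_chains_shift Ta Tb ab).
    exists a, b; split=> //; rewrite t2i; split=> //; by apply: dih_conj.
have ha : rdn (x * t1) (s i) by apply: contraPT a_up => h /(_ h).
have n1 : t1 <> s i.
  by move=> e; have := ell_dn cox hx; rewrite -e e1; lia.
have E1 : x' * (s i * t1 * s i) = x * t1 * s i by rewrite !gmulA x's.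
have E2 : x' * (s i * t1 * s i) * (s i * t2 * s i) = z * s i by rewrite E1 !gmulA (mulgSK cox).
have l1 : l (x' * (s i * t1 * s i)) = (l x').+1.
  by apply: succn_inj; rewrite E1 -(ell_dn cox ha) e1 lx.
have [|||||u3 [u4 [[T3 T4] n3 e3 l3 [q [a [b [Ta Tb ab [Da Db D3 D4]]]]]]]] :=
  IH x' (s i * t1 * s i) (s i * t2 * s i) => //; try exact: cj.
- by rewrite E2.
- by rewrite E2 lzs lx.
have e34 : x' * u3 * u4 = z * s i by rewrite -E2 -!(gmulA x') -e3.
have m1 := conjT_neq cox n1; have m2 := conjT_neq cox n2.
case: (pselect (u3 = s i)) => [u3i|nu3].
  have n4 : u4 <> s i.
    move=> e; move: e34; rewrite u3i e (mulgSK cox) => h.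
    by have := congr1 l h; rewrite lzs lx; lia.
  exists u4, (s i); split=> //.
  - move=> e; have h : x * t1 = z * s i by rewrite -e -e34 u3i x's.
    by move: ha; rewrite h (rdn_S cox) hi.
  - have := congr1 (fun y => s i * y * s i) e3; rewrite u3i !gmulA (simple_invol cox) !mul1g => <-.
    by rewrite !(mulgSK cox).
  - by rewrite -lzs -e34 u3i x's.
  - have q' lt : ro lt -> opposite_chains lt (s i) u4 (s i * t1 * s i) (s i * t2 * s i).
      by move=> rolt; have := q lt rolt; rewrite u3i => /opposite_chains_sym.
    rewrite u3i in D3; split.
      move=> lt rolt; apply: opposite_chains_sym.
      rewrite -{1}(conjSK cox i t1) -{1}(conjSK cox i t2).
      apply: (opposite_chains_shift Ta Tb ab) => //; try exact: cj.
      by rewrite e3 u3i.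
    exists a, b; split=> //; split=> //.
      by rewrite -(conjSK cox i t1); apply: dih_conj.
    by rewrite -(conjSK cox i t2); apply: dih_conj.
have [lb n4] := back _ _ T3 T4 nu3 l3 e34.
exists (s i * u3 * s i), (s i * u4 * s i); split=> //.
- by split; apply: cj.
- by rewrite -(conjSK cox i t1) => /(conjS_inj cox).
- have := congr1 (fun y => s i * y * s i) e3.
  by rewrite !gmulA !(mulgSK cox) (simple_invol cox) mul1g => ->.
- split.
    move=> lt rolt; rewrite -{1}(conjSK cox i t1) -{1}(conjSK cox i t2).
    by apply: opposite_chains_conj => //; try exact: cj.
  exists (s i * a * s i), (s i * b * s i); split; try exact: cj.
    by move/(conjS_inj cox).
  have dc t : dih a b t -> dih (s i * a * s i) (s i * b * s i) (s i * t * s i).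
    apply: (generated_min (B := fun t => dih (s i * a * s i) (s i * b * s i) (s i * t * s i))).
      split; first by rewrite mulg1 (simple_invol cox); apply: generated1.
        move=> y w hy hw; rewrite (_ : s i * (y * w) * s i = (s i * y * s i) * (s i * w * s i)).
          exact: dihM.
        by rewrite !gmulA (mulgSK cox).
      move=> y hy; rewrite (_ : s i * y^-1 * s i = (s i * y * s i)^-1); first exact: generatedV.
      by rewrite !invgM !(simpleV cox) gmulA.
    by move=> y [->|->]; [apply: dih_l|apply: dih_r].
  rewrite -(conjSK cox i t1) -(conjSK cox i t2); split; exact: dc.
Qed.

End RankTwo.

(** * Dyer's theorem on increasing chains *)

Section IncreasingChains.
Variables (I : Type) (W : groupType) (s : I -> W).
Hypothesis cox : coxeter_system s.

Local Notation T := (reflections s).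
Local Notation l := (ell s).
Local Notation le := (bruhat_le s).
Local Notation ro := (refl_order s).
Implicit Types (t x y z : W) (lt : rel W) (ts : seq W).

Fixpoint upchain x ts y : Prop :=
  if ts is t :: ts' then [/\ T t, l (x * t) = (l x).+1 & upchain (x * t) ts' y]
  else x = y.

Lemma upchain_cat x ts ts' y :
  upchain x (ts ++ ts') y <-> exists z, upchain x ts z /\ upchain z ts' y.
Proof.
elim: ts x => [|t ts IH] x /=; first by split=> [h|[z [-> h]]//]; exists x.
split=> [[h1 h2 /IH[z [h3 h4]]]|[z [[h1 h2 h3] h4]]]; first by exists z.
by split=> //; apply/IH; exists z.
Qed.

Lemma upchain_rcons x ts t y : upchain x (rcons ts t) y <->
  exists z, [/\ upchain x ts z, T t, l y = (l z).+1 & z * t = y].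
Proof.
rewrite -cats1 upchain_cat; split=> [[z [h1 [h2 h3 h4]]]|[z [h1 h2 h3 h4]]]; exists z.
  by split=> //; rewrite -h4.
by split=> //=; split=> //; rewrite h4.
Qed.

Lemma upchain_le x ts y : upchain x ts y -> le x y.
Proof.
elim: ts x => [|t ts IH] x /=; first by move=> ->; apply: bruhat_refl.
by move=> [Tt e /IH]; apply: bruhat_trans; apply: bruhat_edge; rewrite // e.
Qed.

Lemma upchain_ell x ts y : upchain x ts y -> l y = (l x + size ts)%N.
Proof.
elim: ts x => [|t ts IH] x /=; first by move=> ->; rewrite addn0.
by move=> [Tt e /IH ->]; rewrite e addSnnS.
Qed.

Lemma ex_maximal lt (L : seq W) (P : W -> Prop) : ro lt ->
  (forall t, P t -> T t) -> (exists2 t, t \in L & P t) ->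
  exists t, [/\ t \in L, P t & forall t', t' \in L -> P t' -> t' = t \/ lt t' t].
Proof.
move=> rolt PT; elim: L => [|a L IH]; first by case.
case: (pselect (exists2 t, t \in L & P t)) => [/IH[t [tL Pt tmax]] _|no].
  case: (pselect (P a /\ lt t a)) => [[Pa ta]|h].
    exists a; split; rewrite ?inE ?eqxx // => t'; rewrite inE => /orP[/eqP-> _|]; first by left.
    by move=> /tmax h /h[->|h']; right => //; apply: (ro_trans rolt h' ta).
  exists t; split; rewrite ?inE ?tL ?orbT // => t'; rewrite inE => /orP[/eqP-> Pa|]; last exact: tmax.
  case: (pselect (a = t)) => [|ne]; [by left|right].
  by case: (ro_total rolt (PT _ Pa) (PT _ Pt) ne) => // ta; case: h.
case=> t; rewrite inE => /orP[/eqP-> Pa|tL Pt]; last by case: no; exists t.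
exists a; split; rewrite ?inE ?eqxx // => t'; rewrite inE => /orP[/eqP-> _|t'L Pt']; first by left.
by case: no; exists t'.
Qed.

Lemma sorted_rcons_lt (lt : rel W) ts t :
  sorted lt ts -> (forall ts' t', ts = rcons ts' t' -> lt t' t) -> sorted lt (rcons ts t).
Proof.
case: ts => [|a ts] //= h1 h2; rewrite rcons_path h1 /=.
by apply: (h2 (belast a ts)); rewrite lastI.
Qed.

(** Greedy choice of the largest label at [y]. If the label before it were larger, the other chain
    of their length-two interval would offer a still larger label at [y]. *)
Lemma inc_chain_last lt x y : ro lt -> le x y ->
  exists ts, [/\ upchain x ts y, sorted lt ts
    & forall t, T t -> le x (y * t) -> l y = (l (y * t)).+1 ->
        exists ts' t', ts = rcons ts' t' /\ (t = t' \/ lt t t')].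
Proof.
move=> rolt; have [n] := ubnP (l y); elim: n y => // n IH y; rewrite ltnS => hn xy.
case: (pselect (x = y)) => [<-|ne].
  by exists [::]; split=> // t Tt /(bruhat_ell) h e; move: h; rewrite e ltnn.
pose P t := [/\ T t, le x (y * t) & l y = (l (y * t)).+1].
have [L hL] := lower_finite cox y.
have inL t : P t -> t \in [seq y^-1 * z | z <- L].
  move=> [Tt h1 h2]; apply/mapP; exists (y * t); last by rewrite gmulA mulVg mul1g.
  apply: hL; rewrite -{2}(mulgTK cox y Tt); apply: bruhat_edge => //.
  by rewrite (mulgTK cox) // h2.
have [t [_ [Tt xz e] tmax]] : exists t, [/\ t \in [seq y^-1 * z | z <- L], P t &
    forall t', t' \in [seq y^-1 * z | z <- L] -> P t' -> t' = t \/ lt t' t].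
  apply: (ex_maximal rolt) => [t []//|].
  have [z [t [xz Tt yzt e]]] := bruhat_coatom cox xy ne.
  have Pt : P t by split; rewrite // yzt (mulgTK cox) // -yzt.
  by exists t => //; apply: inL.
have [|ts [ch so _]] := IH (y * t) _ xz; first by rewrite -e.
exists (rcons ts t); split.
- by apply/upchain_rcons; exists (y * t); rewrite (mulgTK cox).
- apply: sorted_rcons_lt => // ts' t' ets; move: ch; rewrite ets => /upchain_rcons [w [cw Tt' ew zw]].
  have xw := upchain_le cw.
  have ne' : t' <> t.
    move=> e'; have wy : w = y by apply: (mulIg t); rewrite -zw e'.
    by move: ew e; rewrite wy; lia.
  have h1 : l (w * t' * t) = (l w).+2 by rewrite zw (mulgTK cox) // e ew.
  have h2 : l (w * t') = (l w).+1 by rewrite zw.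
  have [t3 [t4 [[T3 T4] _ e34 l3 [q _]]]] := rank_two cox Tt' Tt h2 h1.
  case: (q lt rolt) => -[q1 q2 q3 q4] //.
  have ey : y = w * t3 * t4 by rewrite -gmulA -e34 gmulA zw (mulgTK cox).
  have Pt4 : P t4.
    have E : y * t4 = w * t3 by rewrite ey (mulgTK cox).
    split=> //; rewrite E; last by rewrite l3 e ew.
    by apply: bruhat_trans xw _; apply: bruhat_edge; rewrite // l3.
  case: (tmax t4 (inL _ Pt4) Pt4) => [e4|h]; first by move: q4; rewrite e4 (ro_irr rolt).
  by case: (ro_asym rolt h q4).
- move=> t' Tt' xt' et'; exists ts, t; split=> //.
  by apply: tmax => //; apply: inL.
Qed.

(** The greedy argument from below, with the smallest label. That both constructions give the same
    chain is known only through [inc_chain_uniq]. *)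
Lemma inc_chain_first lt x y : ro lt -> le x y ->
  exists ts, [/\ upchain x ts y, sorted lt ts
    & forall t, T t -> le (x * t) y -> l (x * t) = (l x).+1 ->
        exists t' ts', ts = t' :: ts' /\ (t = t' \/ lt t' t)].
Proof.
move=> rolt; have [n] := ubnP (l y - l x)%N; elim: n x => // n IH x; rewrite ltnS => hn xy.
case: (pselect (x = y)) => [<-|ne].
  by exists [::]; split=> // t Tt /(bruhat_ell) h e; move: h; rewrite e ltnn.
pose P t := [/\ T t, le (x * t) y & l (x * t) = (l x).+1].
have [L hL] := lower_finite cox y.
have inL t : P t -> t \in [seq x^-1 * z | z <- L].
  move=> [Tt h1 h2]; apply/mapP; exists (x * t); last by rewrite gmulA mulVg mul1g.
  exact: hL.
have [t [_ [Tt xz e] tmin]] : exists t, [/\ t \in [seq x^-1 * z | z <- L], P t &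
    forall t', t' \in [seq x^-1 * z | z <- L] -> P t' -> t' = t \/ lt t t'].
  apply: (ex_maximal (refl_order_rev cox rolt)) => [t []//|].
  have [t [Tt h e]] := bruhat_atom cox xy ne.
  have Pt : P t by split.
  by exists t => //; apply: inL.
have [|ts [ch so _]] := IH (x * t) _ xz.
  by have := bruhat_lt xy ne; rewrite e; lia.
exists (t :: ts); split=> //; last first.
  by move=> t' Tt' h1 h2; exists t, ts; split=> //; apply: tmin => //; apply: inL.
case: ts ch so => [|t' ts] //= [Tt' ew ch] ->; rewrite andbT.
have h1 : l (x * t * t') = (l x).+2 by rewrite ew e.
have [t3 [t4 [[T3 T4] _ e34 l3 [q _]]]] := rank_two cox Tt Tt' e h1.
case: (q lt rolt) => -[q1 q2 q3 q4] //.
have ey : x * t * t' = x * t3 * t4 by rewrite -gmulA e34 gmulA.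
have Pt3 : P t3.
  split=> //; apply: bruhat_trans (upchain_le ch); rewrite ey.
  by apply: bruhat_edge; rewrite // -ey h1 l3.
case: (tmin t3 (inL _ Pt3) Pt3) => [e3|h]; first by move: q3; rewrite e3 (ro_irr rolt).
by case: (ro_asym rolt h q3).
Qed.

End IncreasingChains.

Lemma sub_pairwise_mem (E : eqType) (r r' : rel E) xs :
  (forall a b, a \in xs -> b \in xs -> r a b -> r' a b) ->
  pairwise r xs -> pairwise r' xs.
Proof. by move=> h; apply: (sub_in_pairwise (P := [in xs])); [exact: h|apply/allP]. Qed.

(** * Path counts in the Bruhat graph and uniqueness of increasing chains *)

Section PathCounting.
Variables (I : Type) (W : groupType) (s : I -> W).
Hypothesis cox : coxeter_system s.

Local Notation T := (reflections s).
Local Notation l := (ell s).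
Local Notation le := (bruhat_le s).
Local Notation rdn := (right_inversion s).
Local Notation Ts := (refl_simple s).
Local Notation ro := (refl_order s).
Implicit Types (t x y z w : W) (lt : rel W) (ts : seq W) (f g : W -> nat -> nat).

(** A sequence [f x] stands for its generating function in the path length, and [shift] is
    multiplication by the variable. *)
Definition shift f x n : nat := if n is n'.+1 then f x n' else 0%N.

Definition add_fun_nat f g : W -> nat -> nat := fun x n => (f x n + g x n)%N.

Definition step t f : W -> nat -> nat :=
  fun x n => (f x n + (if (l x < l (x * t))%N then shift f (x * t) n else 0))%N.

(* [paths ts (delta y) x n] counts the paths of length [n] from [x] up to [y] in
   the Bruhat graph whose label sequence is a subsequence of [ts]. *)
Definition paths ts f := foldr step f ts.

Definition delta y : W -> nat -> nat := fun x n => ((x == y) && (n == 0%N) : nat).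

Lemma paths_cat ts ts' f : paths (ts ++ ts') f = paths ts (paths ts' f).
Proof. exact: foldr_cat. Qed.

(** Where [t] lowers [x], [step t] leaves [f x] unchanged; elsewhere it adds a value taken at such a
    place, so [f] can be recovered. This allows a common initial part of two lists to be
    cancelled. *)
Lemma step_inj t f g : T t -> step t f = step t g -> f = g.
Proof.
move=> Tt e; have E x n : step t f x n = step t g x n by rewrite e.
have dn x n : ~~ (l x < l (x * t))%N -> f x n = g x n.
  by move=> /negbTE h; have := E x n; rewrite /step h !addn0.
apply/funext => x; apply/funext => n.
case: (boolP (l x < l (x * t))%N) => [h|]; last exact: dn.
have := E x n; rewrite /step h /shift; case: n => [|n]; first by rewrite !addn0.
rewrite (dn (x * t)) => [/addIn //|].
by rewrite (mulgTK cox) // -leqNgt ltnW.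
Qed.

Lemma paths_inj ts f g : (forall t, t \in ts -> T t) -> paths ts f = paths ts g -> f = g.
Proof.
elim: ts => // t ts IH h /= /step_inj e; apply: IH.
  by move=> u uts; apply: h; rewrite inE uts orbT.
by apply: e; apply: h; rewrite inE eqxx.
Qed.

Lemma step_add t f g : step t (add_fun_nat f g) = add_fun_nat (step t f) (step t g).
Proof.
apply/funext => x; apply/funext => -[|n]; rewrite /step /add_fun_nat /shift; case: ifP; lia.
Qed.

Lemma step_shift t f : step t (shift f) = shift (step t f).
Proof.
by apply/funext => x; apply/funext => -[|n]; rewrite /step /shift //; case: ifP.
Qed.

Lemma paths_add ts f g : paths ts (add_fun_nat f g) = add_fun_nat (paths ts f) (paths ts g).
Proof. by elim: ts => //= t ts ->; rewrite step_add. Qed.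

Lemma paths_shift ts f : paths ts (shift f) = shift (paths ts f).
Proof. by elim: ts => //= t ts ->; rewrite step_shift. Qed.

Definition relevant y t : bool := `[< exists x, (l x < l (x * t))%N /\ le (x * t) y >].

Lemma paths_support ts y x n : (forall t, t \in ts -> T t) ->
  paths ts (delta y) x n <> 0%N -> le x y.
Proof.
elim: ts x n => [|t ts IH] x n hT /=.
  by rewrite /delta; case: eqP => [-> _|//]; apply: bruhat_refl.
have hT' u : u \in ts -> T u by move=> uts; apply: hT; rewrite inE uts orbT.
have Tt : T t by apply: hT; rewrite inE eqxx.
rewrite /step; case: (pselect (paths ts (delta y) x n = 0%N)) => [->|/(IH _ _ hT') //].
rewrite add0n; case: ifP => // h; case: n => // n /(IH _ _ hT').
by apply: bruhat_trans; apply: bruhat_edge.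
Qed.

Lemma paths_filter ts y : (forall t, t \in ts -> T t) ->
  paths ts (delta y) = paths [seq t <- ts | relevant y t] (delta y).
Proof.
elim: ts => // t ts IH hT.
have hT' u : u \in ts -> T u by move=> uts; apply: hT; rewrite inE uts orbT.
rewrite /= IH //; case: ifP => // /negbT/asboolP h; rewrite -IH //.
apply/funext => x; apply/funext => n; rewrite /step; case: ifP => hx; last by rewrite addn0.
case: n => [|n]; first by rewrite addn0.
case: (pselect (paths ts (delta y) (x * t) n = 0%N)) => [/= ->|]; first by rewrite addn0.
by move=> /(paths_support hT') h'; case: h; exists x.
Qed.

Lemma paths_conj i ts f x n : (forall t, t \in ts -> T t) -> s i \notin ts ->
  paths [seq s i * t * s i | t <- ts] f x n =
  paths ts (fun w => f (w * s i)) (x * s i) n.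
Proof.
elim: ts x n => [|t ts IH] x n hT /=; first by rewrite (mulgSK cox).
rewrite inE negb_or => /andP[nt nts].
have hT' u : u \in ts -> T u by move=> uts; apply: hT; rewrite inE uts orbT.
have Tt : T t by apply: hT; rewrite inE eqxx.
have Tst := refl_conjT cox Tt (Ts i).
have n' : t <> s i by move=> e; move: nt; rewrite e eqxx.
have E : (l x < l (x * (s i * t * s i)))%N = (l (x * s i) < l (x * s i * t))%N.
  have := rdn_mulS cox (x * s i) Tt n'; rewrite (mulgSK cox) => h.
  by rewrite -!(rdnPn cox) // h.
rewrite /step E IH //; congr addn; case: ifP => // _; case: n => // n.
by rewrite /shift IH // !gmulA (mulgSK cox).
Qed.

Lemma delta_mulS i y : (fun w => delta y (w * s i)) = delta (y * s i).
Proof.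
apply/funext => w; apply/funext => n; rewrite /delta.
by rewrite -(inj_eq (mulIg (s i))) (mulgSK cox).
Qed.

Lemma step_delta_up i y : ~~ rdn y (s i) -> step (s i) (delta y) = delta y.
Proof.
move=> h; apply/funext => x; apply/funext => n; rewrite /step.
case: ifP => hx; last by rewrite addn0.
case: n => [|n]; first by rewrite addn0.
rewrite /shift /delta; case: (x * s i =P y) => [e|]; last by rewrite addn0.
move: h hx; rewrite -e (rdn_S cox) negbK /right_inversion => h1 h2.
by have := ltn_trans h1 h2; rewrite ltnn.
Qed.

Lemma step_delta_down i y : rdn y (s i) ->
  step (s i) (delta y) = add_fun_nat (delta y) (shift (delta (y * s i))).
Proof.
move=> h; apply/funext => x; apply/funext => n; rewrite /step /add_fun_nat; congr addn.
rewrite -delta_mulS; case: ifP => [|hx]; first by case: n.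
case: n => // n; rewrite /shift /delta; case: eqP => // e.
by move: h hx; rewrite -e /right_inversion (mulgSK cox) => ->.
Qed.

(** A finite substitute for the ordered set of all reflections: only labels of edges that end below
    [y] can occur on a path to [y]. *)
Definition admissible lt y ts : Prop :=
  [/\ sorted lt ts, forall t, t \in ts -> T t
    & forall t, T t -> relevant y t -> t \in ts].

Lemma admissible_uniq lt y ts ts' : ro lt -> admissible lt y ts -> admissible lt y ts' ->
  paths ts (delta y) = paths ts' (delta y).
Proof.
move=> rolt [so hT hr] [so' hT' hr'].
rewrite (paths_filter _ hT) (paths_filter _ hT'); congr paths.
have tr : transitive lt by move=> b a c; apply: (ro_trans rolt).
apply: (irr_sorted_eq tr (ro_irr rolt)); try exact: sorted_filter.
move=> t; rewrite !mem_filter; case: (boolP (relevant y t)) => //= h.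
by apply/idP/idP => [/hT|/hT'] Tt; [apply: hr'|apply: hr].
Qed.

Lemma relevant_finite y : exists L : seq W,
  (forall t, t \in L -> T t) /\ forall t, T t -> relevant y t -> t \in L.
Proof.
have [L hL] := lower_finite cox y.
exists [seq t <- [seq a^-1 * b | a <- L, b <- L] | `[< T t >]]; split.
  by move=> t; rewrite mem_filter => /andP[/asboolP].
move=> t Tt /asboolP [x [h1 h2]]; rewrite mem_filter asboolT //=.
apply/allpairsP; exists (x, x * t); split => /=; last by rewrite gmulA mulVg mul1g.
  by apply: hL; apply: bruhat_trans h2; apply: bruhat_edge.
exact: hL.
Qed.

Lemma sort_refls lt (L : seq W) : ro lt -> (forall t, t \in L -> T t) ->
  exists ts, sorted lt ts /\ ts =i L.
Proof.
move=> rolt; have tr : transitive lt by move=> b a c; apply: (ro_trans rolt).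
elim: L => [|a L IH] hT; first by exists [::].
have [|ts [so e]] := IH; first by move=> t tL; apply: hT; rewrite inE tL orbT.
have Ta : T a by apply: hT; rewrite inE eqxx.
exists ([seq t <- ts | lt t a] ++ a :: [seq t <- ts | lt a t]); split.
  rewrite sorted_pairwise // pairwise_cat /= -!sorted_pairwise //.
  rewrite !sorted_filter // andbT; apply/and3P; split=> //.
    apply/allrelP => u v; rewrite mem_filter => /andP[ua _]; rewrite inE => /orP[/eqP-> //|].
    by rewrite mem_filter => /andP[av _]; apply: (ro_trans rolt ua av).
  by apply/allP => u; rewrite mem_filter => /andP[].
move=> t; rewrite mem_cat !inE !mem_filter e.
case: (boolP (t == a)) => [|/eqP ne] /=; first by rewrite orbT.
case: (boolP (t \in L)) => tL; last by rewrite !andbF.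
have Tt : T t by apply: hT; rewrite inE tL orbT.
by rewrite !andbT; case: (ro_total rolt Tt Ta ne) => ->; rewrite ?orbT.
Qed.

(* Dyer's theorem that the count does not depend on the reflection order; the
   recursion for the answer is that of the R-polynomials.  If [y * s i < y], the
   part of the list above [s i] may be conjugated by [s i], moving [s i] to the
   end: for the target [y * s i] this is the induction hypothesis, and cancelling
   the (injective) part below [s i] it carries over to the target [y]. *)
Section Descent.
Variables (y : W) (i : I) (R : W -> nat -> nat).
Hypothesis yi : rdn y (s i).
Hypothesis IH : forall lt ts, ro lt -> admissible lt (y * s i) ts ->
  paths ts (delta (y * s i)) = R.

Let ysi : ~~ rdn (y * s i) (s i). Proof. by rewrite (rdn_S cox) yi. Qed.

Let relevantS t : relevant (y * s i) t -> relevant y t.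
Proof.
move=> /asboolP[x [h1 h2]]; apply/asboolP; exists x; split=> //.
exact/(bruhat_trans h2)/bruhat_S_down.
Qed.

Let upE x : (l x < l (x * s i))%N = ~~ rdn x (s i).
Proof. by rewrite (rdnPn cox) //; apply: Ts. Qed.

(** When [s i] is last, two admissible lists for [y * s i] are available: the given one, and the one
    for [lower_conj], which puts [s i] first and conjugates the rest. By [paths_conj] the conjugated
    part counts paths to [y], so equating both with [R] determines [paths c (delta y)]. *)
Lemma paths_last_simple lt c : ro lt ->
  (forall t, t \in c -> T t) -> sorted lt c ->
  (forall t, t \in c -> lt t (s i)) ->
  (forall t, T t -> relevant y t -> t \in s i :: c) ->
  (forall t, t \in c -> s i * t * s i \in c) ->
  forall x n, paths (c ++ [:: s i]) (delta y) x n =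
    (if rdn x (s i) then R (x * s i) n else R (x * s i) n + shift R x n)%N.
Proof.
move=> rolt hT so below hr clos x n.
have tr : transitive lt by move=> b a d; apply: (ro_trans rolt).
have nc : s i \notin c by apply/negP => /below; rewrite (ro_irr rolt).
rewrite paths_cat /= step_delta_down // paths_add paths_shift.
have Rc : paths c (delta (y * s i)) = R.
  rewrite -(IH (ts := c ++ [:: s i]) rolt) ?paths_cat /= ?step_delta_up //; split.
  - rewrite sorted_pairwise // pairwise_cat -sorted_pairwise // so /= andbT.
    by apply/allrelP => u v /below h; rewrite inE => /eqP->.
  - by move=> t; rewrite mem_cat inE => /orP[/hT//|/eqP->]; apply: Ts.
  - by move=> t Tt /relevantS /(hr _ Tt); rewrite mem_cat !inE orbC.
have rol := refl_order_lower cox i rolt.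
have rorev := refl_order_rev cox rolt.
have Rl : paths (s i :: [seq s i * t * s i | t <- c]) (delta (y * s i)) = R.
  apply: (IH rol); split.
  - rewrite sorted_pairwise; last by move=> b a d; apply: (ro_trans rol).
    rewrite /= pairwise_map; apply/andP; split.
      apply/allP => _ /mapP[t tc ->]; rewrite /lower_conj; apply: upper_last => //.
        by apply: (refl_conjT cox); [apply: hT|apply: Ts].
      by apply: (conjT_neq cox) => e; move: nc; rewrite -e tc.
    move: so; rewrite sorted_pairwise //; apply: sub_pairwise_mem => a b ac bc ab.
    rewrite /lower_conj /= upper_above ?(conjSK cox) // (ro_side cox) //; by [apply: below|apply: hT].
  - move=> t; rewrite inE => /orP[/eqP->|/mapP[u uc ->]]; first exact: Ts.
    by apply: (refl_conjT cox); [apply: hT|apply: Ts].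
  - move=> t Tt /relevantS /(hr _ Tt); rewrite !inE => /orP[-> //|tc].
    apply/orP; right; apply/mapP; exists (s i * t * s i); first exact: clos.
    by rewrite (conjSK cox).
have E z m : R z m = (paths c (delta y) (z * s i) m +
    (if rdn z (s i) then 0 else shift (paths c (delta y)) z m))%N.
  have C u k : paths [seq s i * t * s i | t <- c] (delta (y * s i)) u k = paths c (delta y) (u * s i) k.
    by rewrite paths_conj // delta_mulS (mulgSK cox).
  rewrite -Rl /= /step upE C; congr addn; case: (rdn z (s i)) => //=.
  by case: m => // m; rewrite /shift C (mulgSK cox).
rewrite /add_fun_nat Rc; case: ifP => hx.
  have := E (x * s i) n; rewrite (rdn_S cox) hx (mulgSK cox) => ->; congr addn.
  by case: n => // n; rewrite /shift E hx addn0.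
by have := E (x * s i) n; rewrite (rdn_S cox) hx (mulgSK cox) addn0 => ->.
Qed.

Lemma paths_descent lt ts : ro lt -> admissible lt y ts ->
  forall x n, paths ts (delta y) x n =
    (if rdn x (s i) then R (x * s i) n else R (x * s i) n + shift R x n)%N.
Proof.
move=> rolt adm x n.
have tr : transitive lt by move=> b a d; apply: (ro_trans rolt).
have [L [LT Lr]] := relevant_finite y.
(* The list is closed under conjugation by [s i]. By [ro_side] each of its two parts around [s i] is
   then stable, so conjugating the upper part only reorders it. *)
pose L0 := s i :: L; pose L1 := L0 ++ [seq s i * t * s i | t <- L0].
have cT t : T t -> T (s i * t * s i) by move=> Tt; apply: (refl_conjT cox) => //; apply: Ts.
have L0T t : t \in L0 -> T t by rewrite inE => /orP[/eqP->|/LT//]; apply: Ts.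
have L1T t : t \in L1 -> T t.
  by rewrite mem_cat => /orP[/L0T//|/mapP[u /L0T Tu ->]]; apply: cT.
have L1c t : t \in L1 -> s i * t * s i \in L1.
  rewrite !mem_cat => /orP[h|/mapP[u h ->]]; first by apply/orP; right; apply/mapP; exists t.
  by rewrite (conjSK cox) // h.
have [ts0 [so0 e0]] := sort_refls rolt L1T.
have ts0r t : T t -> relevant y t -> t \in ts0.
  by move=> Tt /(Lr _ Tt) h; rewrite e0 mem_cat inE h orbT.
have ts0T t : t \in ts0 -> T t by rewrite e0; apply: L1T.
have adm0 : admissible lt y ts0 by split.
rewrite (admissible_uniq rolt adm adm0).
have sin : s i \in ts0 by rewrite e0 mem_cat inE eqxx.
have ts0c t : t \in ts0 -> s i * t * s i \in ts0 by rewrite !e0; apply: L1c.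
move: so0 ts0r ts0T ts0c {adm0 e0}; case/splitPr: sin => a b so0 ts0r ts0T ts0c.
move: (so0); rewrite sorted_pairwise // pairwise_cat /= => /and3P[hab pa /andP[hb pb]].
have lta t : t \in a -> lt t (s i).
  by move=> ta; move/allrelP: hab; apply; rewrite ?inE ?eqxx.
have ltb t : t \in b -> lt (s i) t by move/allP: hb; apply.
have Ta t : t \in a -> T t by move=> ta; apply: ts0T; rewrite mem_cat ta.
have Tb t : t \in b -> T t by move=> tb; apply: ts0T; rewrite mem_cat inE tb !orbT.
have ca t : t \in a -> s i * t * s i \in a.
  move=> ta; have := ts0c t; rewrite mem_cat ta => /(_ isT); rewrite mem_cat inE.
  have h := lta _ ta; rewrite -(ro_side cox i rolt (Ta _ ta)) in h.
  case/or3P => [//|/eqP e|/ltb h']; first by rewrite e (ro_irr rolt) in h.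
  by case: (ro_asym rolt h h').
have cb t : t \in b -> s i * t * s i \in b.
  move=> tb; have := ts0c t; rewrite mem_cat inE tb !orbT => /(_ isT); rewrite mem_cat inE.
  have h := ltb _ tb; rewrite -(ro_side_gt cox i rolt (Tb _ tb)) in h.
  case/or3P => [/lta h'|/eqP e|//]; last by rewrite e (ro_irr rolt) in h.
  by case: (ro_asym rolt h h').
have nb : s i \notin b by apply/negP => /ltb; rewrite (ro_irr rolt).
pose b' := [seq s i * t * s i | t <- b].
have b'P t : (t \in b') = (t \in b).
  apply/mapP/idP => [[u ub ->]|tb]; first exact: cb.
  by exists (s i * t * s i); rewrite ?(conjSK cox) //; apply: cb.
have rou := refl_order_upper cox i rolt.
have tru : transitive (upper_conj s lt i) by move=> u v w; apply: (ro_trans rou).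
have pab : sorted (upper_conj s lt i) (a ++ b').
  rewrite sorted_pairwise // pairwise_cat pairwise_map; apply/and3P; split.
  - by apply/allrelP => u v ua; rewrite b'P => vb; apply: upper_mixed; [|apply: lta|apply: ltb].
  - apply: sub_pairwise_mem pa => u v ua va uv.
    by rewrite upper_below //; apply: lta.
  - apply: sub_pairwise_mem pb => u v ub vb uv.
    by rewrite /= upper_above ?(conjSK cox) // (ro_side_gt cox) //; [apply: ltb|apply: Tb|apply: ltb|apply: Tb].
have belowab t : t \in a ++ b' -> upper_conj s lt i t (s i).
  rewrite mem_cat b'P => /orP[ta|tb]; apply: upper_last => //.
  - exact: Ta.
  - by move=> e; have := lta _ ta; rewrite e (ro_irr rolt).
  - exact: Tb.
  - by move=> e; have := ltb _ tb; rewrite e (ro_irr rolt).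
have Tab t : t \in a ++ b' -> T t by rewrite mem_cat b'P => /orP[/Ta|/Tb].
have rab t : T t -> relevant y t -> t \in s i :: a ++ b'.
  by move=> Tt /(ts0r _ Tt); rewrite inE !mem_cat inE b'P orbCA.
rewrite -(paths_last_simple rou Tab pab belowab rab); last first.
  by move=> t; rewrite !mem_cat !b'P => /orP[/ca|/cb] ->; rewrite ?orbT.
congr (_ x n); rewrite -catA !paths_cat; congr paths; rewrite /=.
have conjb w : paths b' (delta w) = fun z m => paths b (delta (w * s i)) (z * s i) m.
  by apply/funext => z; apply/funext => m; rewrite paths_conj // delta_mulS.
(* Preceded by [a], both sides count paths to [y * s i], for [lt] and for its upper conjugate; the
   hypothesis on [y * s i] equates them and the injectivity of [paths a] removes [a]. *)
have star : step (s i) (paths b (delta (y * s i))) = paths b' (delta (y * s i)).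
  apply: (paths_inj Ta).
  transitivity R.
    rewrite -(IH (ts := a ++ s i :: b) rolt) ?paths_cat //; split=> //.
    by move=> t Tt /relevantS; apply: ts0r.
  rewrite -(IH (ts := (a ++ b') ++ [:: s i]) rou).
    by rewrite -catA !paths_cat /= step_delta_up.
  split.
  - rewrite sorted_pairwise // pairwise_cat -sorted_pairwise // pab /= andbT.
    by apply/allrelP => u v /belowab h; rewrite inE => /eqP->.
  - by move=> t; rewrite mem_cat inE => /orP[/Tab//|/eqP->]; apply: Ts.
  - by move=> t Tt /relevantS /(rab _ Tt); rewrite mem_cat !inE orbC.
have starE z m : (paths b (delta (y * s i)) z m +
    (if rdn z (s i) then 0 else shift (paths b (delta (y * s i))) (z * s i) m))%N =
    paths b (delta y) (z * s i) m.
  have := congr1 (fun f => f z m) star; rewrite conjb (mulgSK cox) => <-.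
  by rewrite /step upE; case: (rdn z (s i)).
rewrite step_delta_down // paths_add paths_shift !conjb (mulgSK cox).
apply/funext => z; apply/funext => m; rewrite /step /add_fun_nat upE.
case: (boolP (rdn z (s i))) => hz /=.
  have := starE (z * s i) m; rewrite (rdn_S cox) hz (mulgSK cox) addn0 /= => <-.
  congr addn; case: m => // m; rewrite /shift.
  by have := starE z m; rewrite hz addn0.
have := starE (z * s i) m; rewrite (rdn_S cox) (negbTE hz) (mulgSK cox) addn0 => <-.
by congr addn; case: m.
Qed.

End Descent.

(** [R x] lists the coefficients of Dyer's variant of the R-polynomial of [x] and [y]. When the
    recursion has two terms, only the shifted one can reach degree [l y - l x], so the top
    coefficient never grows. *)
Lemma dyer_path_count y : exists R : W -> nat -> nat,
  [/\ forall lt ts, ro lt -> admissible lt y ts -> paths ts (delta y) = R,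
      forall x n, R x n <> 0%N -> (n + l x <= l y)%N
    & forall x n, (n + l x = l y)%N -> (R x n <= 1)%N].
Proof.
have [n] := ubnP (l y); elim: n y => // n IHn y; rewrite ltnS => hn.
case: (pselect (y = 1)) => [->|/(right_descent cox)[i hi]].
  exists (delta 1); split.
  - move=> lt ts rolt [so hT hr]; rewrite paths_filter // (eq_in_filter (a2 := pred0)).
      by rewrite filter_pred0.
    move=> t /hT Tt; apply/asboolP => -[x [h1 /bruhat_ell]]; rewrite (ell1 cox); lia.
  - by move=> x m; rewrite /delta; case: eqP => // ->; case: eqP => // ->; rewrite (ell1 cox).
  - by move=> x m _; rewrite /delta; case: (_ && _).
have [R [hR bR tR]] := IHn _ (leq_trans hi hn).
exists (fun (x : W) (m : nat) => if rdn x (s i) then R (x * s i)%g m else R (x * s i)%g m + shift R x m)%N.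
have ly := ell_dn cox hi.
split.
- move=> lt ts rolt adm; apply/funext => x; apply/funext => m.
  exact: (paths_descent hi hR rolt adm).
- move=> x m; case: ifP => hx; first by move=> /bR; rewrite ly (ell_dn cox hx); lia.
  have lx := ell_up cox (negbT hx).
  case: (pselect (R (x * s i) m = 0%N)) => [->|/bR]; last by rewrite lx; lia.
  by case: m => // m; rewrite add0n /shift => /bR; lia.
- move=> x m e; case: ifP => hx.
    by apply: tR; have := ell_dn cox hx; lia.
  have lx := ell_up cox (negbT hx).
  have -> : R (x * s i) m = 0%N.
    by apply: contrapT => /bR; rewrite lx; lia.
  case: m e => // m e; rewrite add0n /shift; apply: tR; lia.
Qed.

Fixpoint walk x (c : seq W) y : Prop :=
  if c is t :: c' then (l x < l (x * t))%N /\ walk (x * t) c' y else x = y.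

Lemma paths_gt0 ts c x y : subseq c ts -> walk x c y ->
  (0 < paths ts (delta y) x (size c))%N.
Proof.
elim: ts c x => [|t ts IH] [|a c] x //=.
- by move=> _ ->; rewrite /delta !eqxx.
- by move=> _ ->; rewrite /step ltn_addr // (IH [::]) ?sub0seq.
case: eqP => [-> sub [h w]|_ sub w].
  by rewrite /step h ltn_addl // IH.
by rewrite /step ltn_addr // (IH (a :: c)).
Qed.

Lemma paths_gt1 ts c c' x y : subseq c ts -> subseq c' ts -> c <> c' -> size c = size c' ->
  walk x c y -> walk x c' y -> (1 < paths ts (delta y) x (size c))%N.
Proof.
elim: ts c c' x => [|t ts IH] [|a c] [|a' c'] x //= h h' ne [e].
rewrite /step; move: h h'.
case: eqP => [ea|_]; case: eqP => [ea'|_] sub sub' w w'.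
- subst a a'; case: w => h w; case: w' => _ w'; rewrite h ltn_addl //.
  by apply: (IH _ c') => // ec; apply: ne; rewrite ec.
- subst a; case: w => h w; have h2 := paths_gt0 sub w.
  by rewrite h /shift /= e; have := paths_gt0 sub' w'; rewrite /= e in h2 *; lia.
- subst a'; case: w' => h w'; have h2 := paths_gt0 sub' w'.
  by rewrite h /shift /= e; have := paths_gt0 sub w; rewrite /= e => h3; exact: (leq_add h3 h2).
- by rewrite ltn_addr //; apply: (IH (a :: c) (a' :: c')) => //=; rewrite e.
Qed.

(** Both chains are subsequences of one admissible list and have the top length [l y - l x], where
    at most one path is counted. *)
Lemma inc_chain_uniq lt x y ts ts' : ro lt ->
  upchain s x ts y -> sorted lt ts -> upchain s x ts' y -> sorted lt ts' -> ts = ts'.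
Proof.
move=> rolt ch so ch' so'; apply: contrapT => ne.
have tr : transitive lt by move=> b a d; apply: (ro_trans rolt).
have [R [hR _ tR]] := dyer_path_count y.
have [L [LT Lr]] := relevant_finite y.
have [c [soc ec]] := sort_refls rolt LT.
have adm : admissible lt y c by split=> // t; rewrite ec; [apply: LT|apply: Lr].
have labs z us : upchain s z us y -> walk z us y /\ forall t, t \in us -> t \in c.
  elim: us z => [|t us IHus] z //= [Tt e h]; have [h1 h2] := IHus _ h.
  split; first by rewrite e.
  move=> u; rewrite inE => /orP[/eqP->|]; last exact: h2.
  rewrite ec; apply: Lr => //; apply/asboolP; exists z; rewrite e; split=> //.
  exact: upchain_le h.
have subc us : sorted lt us -> (forall t, t \in us -> t \in c) -> subseq us c.
  move=> sous h; have -> : us = [seq t <- c | t \in us]; last exact: filter_subseq.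
  apply: (irr_sorted_eq tr (ro_irr rolt) sous); first exact: sorted_filter.
  by move=> t; rewrite mem_filter; case: (boolP (t \in us)) => // /h ->.
have [w h] := labs _ _ ch; have [w' h'] := labs _ _ ch'.
have el := upchain_ell ch; have el' := upchain_ell ch'.
have es : size ts = size ts' by lia.
have := paths_gt1 (subc _ so h) (subc _ so' h') ne es w w'.
rewrite (hR _ _ rolt adm) => h2; suff : (R x (size ts) <= 1)%N by rewrite leqNgt h2.
by apply: tR; rewrite el addnC.
Qed.

End PathCounting.

(** * Parabolic cosets *)

Section Parabolic.
Variables (I : Type) (W : groupType) (s : I -> W) (J : set I).
Hypothesis cox : coxeter_system s.

Local Notation T := (reflections s).
Local Notation l := (ell s).
Local Notation le := (bruhat_le s).
Local Notation rdn := (right_inversion s).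
Local Notation Ts := (refl_simple s).
Local Notation P := (parabolic s J).
Local Notation minr := (min_rep s J).
Local Notation maxr := (max_rep s J).
Implicit Types (t u v w x y z : W).

Lemma parabolic1 : P 1. Proof. exact: generated1. Qed.
Lemma parabolicM u v : P u -> P v -> P (u * v). Proof. exact: generatedM. Qed.
Lemma parabolicV u : P u -> P u^-1. Proof. exact: generatedV. Qed.
Lemma parabolicS j : J j -> P (s j).
Proof. by move=> Jj; apply: generated_sub; exists j. Qed.

Lemma parabolic_conjS v j : P v -> J j -> P (v * s j * v^-1).
Proof.
by move=> Pv Jj; apply: parabolicM (parabolicV Pv); apply: parabolicM (parabolicS Jj).
Qed.

Lemma parabolic_word u : P u -> exists2 c, all (fun j => `[< J j >]) c & word s c = u.
Proof.
apply: (generated_min (B := fun u => exists2 c, all (fun j => `[< J j >]) c & word s c = u)).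
  split.
  - by exists [::]; rewrite // word_nil.
  - move=> x y [c hc <-] [d hd <-]; exists (c ++ d); rewrite ?all_cat ?hc //.
    exact: word_cat.
  - by move=> x [c hc <-]; exists (rev c); rewrite ?all_rev // (word_rev cox).
move=> _ [j Jj <-]; exists [:: j]; last exact: word1.
by rewrite /= andbT; apply/asboolP.
Qed.

(** Take a word of [u] that is shortest among those with letters in [J], not yet known to be
    reduced. Exchange keeps the letters in [J], so if its last letter were not a descent, a shorter
    such word would exist. *)
Lemma parabolic_descent u : P u -> u <> 1 -> exists2 j, J j & rdn u (s j).
Proof.
move=> Pu u1.
pose A n := `[< exists c, [/\ all (fun j => `[< J j >]) c, word s c = u & size c = n] >].
have exA : exists n, A n.
  by have [c h1 h2] := parabolic_word Pu; exists (size c); apply/asboolP; exists c.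
have [n /asboolP [c [hc ec sc]] nmin] := ex_minnP exA.
case/lastP: c hc ec sc => [_ e|c j]; first by rewrite word_nil in e; case: u1.
rewrite all_rcons -cats1 word_cat word1 size_cat addn1 => /andP[/asboolP Jj hc] ec sc.
exists j => //; apply: contrapT => nd.
have h : rdn (word s c) (s j).
  move/negP: nd; rewrite -ec (rdn_S cox) negbK //.
have [[c' [h1 h2 h3]] _] := rdn_exchange_word cox (Ts j) h.
have : A (size c') by apply/asboolP; exists c'; split; rewrite -?h2 //; apply: h3.
by move/nmin; rewrite -sc; lia.
Qed.

Lemma parabolic_ind (Q : W -> Prop) : Q 1 ->
  (forall u j, P u -> J j -> ~~ rdn u (s j) -> Q u -> Q (u * s j)) ->
  forall u, P u -> Q u.
Proof.
move=> Q1 QS u; have [n] := ubnP (l u); elim: n u => // n IH u; rewrite ltnS => hn Pu.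
case: (pselect (u = 1)) => [-> //|/(parabolic_descent Pu)[j Jj hj]].
rewrite -(mulgSK cox j u); have Puj := parabolicM Pu (parabolicS Jj).
apply: QS => //; first by rewrite (rdn_S cox) hj.
by apply: IH => //; apply: leq_trans hj hn.
Qed.

(** A letter that raises [v] but not [w * v] would, by the cocycle identity, give [w] an inversion
    in [W_J]. *)
Lemma ell_min_rep w u : minr w -> P u -> l (w * u) = (l w + l u)%N.
Proof.
move=> mw; elim/parabolic_ind => [|v j Pv Jj nd IH]; first by rewrite mulg1 (ell1 cox) addn0.
rewrite gmulA (ell_up cox nd) addnS -IH (ell_up cox) //.
rewrite (rdn_mul cox) ?(negbTE nd) /=; last exact: Ts.
rewrite /right_inversion -leqNgt; apply: mw.
exact: parabolic_conjS.
Qed.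

Lemma max_rep_rdn x t : maxr x -> T t -> P t -> rdn x t.
Proof.
move=> mx Tt Pt; rewrite /right_inversion ltn_neqAle (ell_refl_neq cox) //=; exact: mx.
Qed.

Lemma ell_max_rep x u : maxr x -> P u -> (l (x * u) + l u)%N = l x.
Proof.
move=> mx; elim/parabolic_ind => [|v j Pv Jj nd IH]; first by rewrite mulg1 (ell1 cox) addn0.
rewrite gmulA (ell_up cox nd) -IH.
have h : rdn (x * v) (s j).
  rewrite (rdn_mul cox) ?(negbTE nd) /=; last exact: Ts.
  apply: max_rep_rdn => //; first exact: (refl_conjV _ (Ts j)).
  exact: parabolic_conjS.
by rewrite (ell_dn cox h); lia.
Qed.

Lemma ell_max_repV x u : maxr x -> P u -> (l (x * u^-1) + l u)%N = l x.
Proof. by move=> mx /parabolicV Pu; rewrite -(ell_max_rep mx Pu) (ellV cox u). Qed.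

Lemma min_rep_uniq w w' u u' : minr w -> minr w' -> P u -> P u' ->
  w * u = w' * u' -> w = w' /\ u = u'.
Proof.
move=> mw mw' Pu Pu' e.
have P1 : P (u * u'^-1) by apply: parabolicM => //; apply: parabolicV.
have e' : w' = w * (u * u'^-1) by rewrite gmulA e mulgK.
have e'' : w = w' * (u * u'^-1)^-1 by rewrite e' mulgK.
have := ell_min_rep mw P1; rewrite -e'.
have := ell_min_rep mw' (parabolicV P1); rewrite -e'' (ellV cox (_ * _)) => h1 h2.
have h : l (u * u'^-1) = 0%N by lia.
have {}e' : w' = w by rewrite e' (ell_eq0 cox h) mulg1.
by split=> //; apply: (mulgI w); rewrite e e'.
Qed.

Lemma max_rep_uniq x x' u u' : maxr x -> maxr x' -> P u -> P u' ->
  x * u = x' * u' -> x = x' /\ u = u'.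
Proof.
move=> mx mx' Pu Pu' e.
have P1 : P (u * u'^-1) by apply: parabolicM => //; apply: parabolicV.
have e' : x' = x * (u * u'^-1) by rewrite gmulA e mulgK.
have e'' : x = x' * (u * u'^-1)^-1 by rewrite e' mulgK.
have := ell_max_rep mx P1; rewrite -e'.
have := ell_max_rep mx' (parabolicV P1); rewrite -e'' (ellV cox (_ * _)) => h1 h2.
have h : l (u * u'^-1) = 0%N by lia.
have {}e' : x' = x by rewrite e' (ell_eq0 cox h) mulg1.
by split=> //; apply: (mulgI x); rewrite e e'.
Qed.

Lemma min_rep_exists y : exists w u, [/\ minr w, P u & y = w * u].
Proof.
pose A n := `[< exists2 u, P u & l (y * u) = n >].
have exA : exists n, A n by exists (l (y * 1)); apply/asboolP; exists 1 => //; apply: parabolic1.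
have [n /asboolP [u Pu e] nmin] := ex_minnP exA.
exists (y * u), u^-1; split; [|exact: parabolicV|by rewrite mulgK].
move=> v Pv; rewrite e; apply: nmin; apply/asboolP; exists (u * v); first exact: parabolicM.
by rewrite gmulA.
Qed.

(** Finiteness of [W_J] bounds the lengths in a coset. The inverse on [u] matches the normalization
    by [x * u^-1]. *)
Lemma max_rep_exists y : finite_set P -> exists x u, [/\ maxr x, P u & y = x * u^-1].
Proof.
move=> /finite_seqP [L eL].
pose A n := `[< exists2 u, P u & l (y * u) = n >].
have exA : exists n, A n by exists (l (y * 1)); apply/asboolP; exists 1 => //; apply: parabolic1.
have bA n : A n -> (n <= \max_(u <- L) l (y * u))%N.
  move=> /asboolP [u Pu <-]; apply: (@leq_bigmax_seq _ L xpredT (fun u => l (y * u))) => //.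
  by have : P u := Pu; rewrite eL.
have [n /asboolP [u Pu e] nmax] := ex_maxnP exA bA.
exists (y * u), u; split=> //; last by rewrite mulgK.
move=> v Pv; rewrite e; apply: nmax; apply/asboolP; exists (u * v); first exact: parabolicM.
by rewrite gmulA.
Qed.

Lemma min_rep1 : minr 1.
Proof. by move=> u _; rewrite (ell1 cox). Qed.

Lemma bruhat_min_rep w u : minr w -> P u -> le w (w * u).
Proof.
move=> mw Pu; rewrite -{1}(mulg1 w); apply: bruhat_mul_l => //; first exact: bruhat1.
exact: ell_min_rep.
Qed.

Lemma bruhat_proj w w' u u' : minr w -> minr w' -> P u -> P u' ->
  le (w * u) (w' * u') -> le w w'.
Proof.
move=> mw mw' Pu Pu'; move: u' Pu' u Pu; apply: parabolic_ind => [|v j Pv Jj nd IH] u Pu.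
  by rewrite mulg1; apply: bruhat_trans; apply: bruhat_min_rep.
rewrite gmulA => /(bruhat_mulS_r cox j); rewrite (mulgSK cox) => -[|]; first exact: IH.
by rewrite -gmulA; apply: IH; apply: parabolicM => //; apply: parabolicS.
Qed.

Lemma bruhat_coset w u v z : minr w -> P u -> P v -> le (w * u) z -> le z (w * v) ->
  exists2 z', P z' & z = w * z'.
Proof.
move=> mw Pu Pv; have [w' [z' [mw' Pz' ->]]] := min_rep_exists z => h1 h2.
have e : w = w'.
  by apply: (bruhat_antisym (s := s)); [apply: bruhat_proj h1|apply: bruhat_proj h2].
by exists z' => //; rewrite e.
Qed.

Lemma bruhat_parabolic z v : P v -> le z v -> P z.
Proof.
move=> Pv h; have [||z' Pz' ->] := bruhat_coset min_rep1 parabolic1 Pv (z := z).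
- by rewrite mulg1; apply: bruhat1.
- by rewrite mul1g.
- by rewrite mul1g.
Qed.

(** A chain from [w * u] to [w * v] stays in the coset, so each edge multiplies the [W_J]-part by a
    reflection. The corresponding edge in [x * W_J] points the other way, because there the length
    is [l x] minus that of the [W_J]-part. *)
Lemma bruhat_antitone w x u v : minr w -> maxr x -> P u -> P v ->
  le (w * u) (w * v) -> le (x * v^-1) (x * u^-1).
Proof.
move=> mw mx Pu Pv.
suff h y : le (w * u) y -> forall v, P v -> y = w * v -> le (x * v^-1) (x * u^-1).
  by move=> h1; apply: h h1 _ Pv erefl.
elim=> [v' _ /mulgI -> |y' t uy IH Tt h v' Pv' e]; first exact: bruhat_refl.
have [v2 Pv2 e2] : exists2 z, P z & y' = w * z.
  by apply: bruhat_coset mw Pu Pv' uy _; rewrite -e; apply: bruhat_edge.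
apply: bruhat_trans (IH _ Pv2 e2).
have ev : v' = v2 * t by apply: (mulgI w); rewrite gmulA -e2.
have -> : x * v2^-1 = x * v'^-1 * (v2 * t * v2^-1).
  by rewrite ev invgM (reflV cox Tt); gsimp; rewrite (mulgTK cox).
apply: bruhat_edge; first exact: refl_conjV.
have -> : x * v'^-1 * (v2 * t * v2^-1) = x * v2^-1.
  by rewrite ev invgM (reflV cox Tt); gsimp; rewrite (mulgTK cox).
have := ell_max_repV mx Pv2; have := ell_max_repV mx Pv'.
have := ell_min_rep mw Pv2; have := ell_min_rep mw Pv'; rewrite -e -e2; lia.
Qed.

Lemma bruhat_antitoneW x z v : maxr x -> P v -> le z v -> le (x * v^-1) (x * z^-1).
Proof.
move=> mx Pv h; apply: (bruhat_antitone min_rep1 mx) => //; last by rewrite !mul1g.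
exact: bruhat_parabolic h.
Qed.

End Parabolic.

(** * Increasing Bruhat chains read downwards *)

Section DownChains.
Variables (I : Type) (W : groupType) (s : I -> W) (J : set I).
Hypothesis cox : coxeter_system s.

Local Notation T := (reflections s).
Local Notation l := (ell s).
Local Notation le := (bruhat_le s).
Local Notation P := (parabolic s J).
Local Notation ro := (refl_order s).
Implicit Types (t u v w x y z : W) (ts : seq W) (lt : rel W).

Fixpoint downchain y ts x : Prop :=
  if ts is t :: ts' then [/\ T t, l y = (l (y * t)).+1 & downchain (y * t) ts' x]
  else y = x.

Lemma downchain_rev y ts x : downchain y ts x <-> upchain s x (rev ts) y.
Proof.
elim: ts y => [|t ts IH] y; first by split=> /= ->.
rewrite rev_cons /= upchain_rcons; split=> [[h1 h2 /IH h3]|[z [/IH h1 h2 h3 h4]]].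
  by exists (y * t); rewrite (mulgTK cox).
by rewrite -h4 (mulgTK cox) // h4.
Qed.

Lemma downchain_cat y ts ts' x :
  downchain y (ts ++ ts') x <-> exists z, downchain y ts z /\ downchain z ts' x.
Proof.
rewrite downchain_rev rev_cat upchain_cat.
by split=> -[z [h1 h2]]; exists z; rewrite !downchain_rev in h1 h2 *.
Qed.

Lemma downchain_fun y ts x x' : downchain y ts x -> downchain y ts x' -> x = x'.
Proof.
elim: ts y => [|t ts IH] y /=; first by move=> <- <-.
by move=> [_ _ h1] [_ _]; apply: IH.
Qed.

Lemma downchain_le y ts x : downchain y ts x -> le x y.
Proof. by rewrite downchain_rev => /upchain_le. Qed.

Lemma sorted_rev_lt lt ts : sorted (fun a b => lt b a) (rev ts) = sorted lt ts.
Proof. by rewrite rev_sorted. Qed.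

Lemma downchain_exists lt x y : ro lt -> le x y -> exists2 ts, downchain y ts x & sorted lt ts.
Proof.
move=> /(refl_order_rev cox) rolt /(inc_chain_last cox rolt) [ts [h1 h2 _]].
exists (rev ts); first by rewrite downchain_rev revK.
by rewrite -sorted_rev_lt revK.
Qed.

Lemma downchain_uniq lt x y ts ts' : ro lt -> downchain y ts x -> sorted lt ts ->
  downchain y ts' x -> sorted lt ts' -> ts = ts'.
Proof.
move=> /(refl_order_rev cox) rolt /downchain_rev h1; rewrite -sorted_rev_lt => h2.
move=> /downchain_rev h3; rewrite -sorted_rev_lt => h4.
by apply: (can_inj revK); apply: (inc_chain_uniq cox rolt h1 h2 h3 h4).
Qed.

(** Read upwards, the chain is increasing for the reversed order. By uniqueness it is then the
    greedy chain of [inc_chain_last], whose label at [y] is extremal. *)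
Lemma downchain_first lt x y t0 ts t : ro lt -> downchain y (t0 :: ts) x -> sorted lt (t0 :: ts) ->
  T t -> le x (y * t) -> l y = (l (y * t)).+1 -> t = t0 \/ lt t0 t.
Proof.
move=> /(refl_order_rev cox) rolt; rewrite downchain_rev -sorted_rev_lt => h1 h2 Tt h3 h4.
have [ts' [h5 h6 h7]] := inc_chain_last cox rolt (upchain_le h1).
have e := inc_chain_uniq cox rolt h1 h2 h5 h6.
have [ts2 [t2 [e2]]] := h7 t Tt h3 h4.
by rewrite -e rev_cons in e2; move/rcons_inj: e2 => [_ ->].
Qed.

Lemma upchain_first lt x y t0 ts t : ro lt -> upchain s x (t0 :: ts) y -> sorted lt (t0 :: ts) ->
  T t -> le (x * t) y -> l (x * t) = (l x).+1 -> t = t0 \/ lt t0 t.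
Proof.
move=> rolt h1 h2 Tt h3 h4.
have [ts' [h5 h6 h7]] := inc_chain_first cox rolt (upchain_le h1).
have e := inc_chain_uniq cox rolt h1 h2 h5 h6.
have [t2 [ts2 [e2]]] := h7 t Tt h3 h4.
by rewrite -e in e2; case: e2 => -> _.
Qed.

Lemma downchain_parabolic y ts x : (forall t, t \in ts -> P t) -> downchain y ts x ->
  exists2 u, P u & y = x * u.
Proof.
elim: ts y => [|t ts IH] y hP /=; first by move=> ->; exists 1; rewrite ?mulg1 //; apply: parabolic1.
case=> Tt _ h; have [|u Pu e] := IH (y * t) _ h; first by move=> a ah; apply: hP; rewrite inE ah orbT.
exists (u * t); first by apply: parabolicM => //; apply: hP; rewrite inE eqxx.
by rewrite gmulA -e (mulgTK cox).
Qed.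

Lemma downchain_in_coset w v ts : min_rep s J w -> P v -> downchain (w * v) ts w ->
  forall t, t \in ts -> P t.
Proof.
move=> mw; elim: ts v => // t ts IH v Pv /= [Tt e h] a.
have hw := downchain_le h.
have h1 : le (w * 1) (w * v * t) by rewrite mulg1.
have h2 : le (w * v * t) (w * v).
  by rewrite -{2}(mulgTK cox (w * v) Tt); apply: bruhat_edge; rewrite // (mulgTK cox) // e.
have [v' Pv' e'] := bruhat_coset cox mw (@parabolic1 I W s J) Pv h1 h2.
have et : t = v^-1 * v' by apply: (mulgI (w * v)); rewrite e' gmulA mulgK.
rewrite inE => /orP[/eqP->|]; first by rewrite et; apply: parabolicM => //; apply: parabolicV.
by apply: (IH v') => //; rewrite -e'.
Qed.

End DownChains.

(** * The poset [QJ] and its edges *)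

Section Poset.
Variables (I : Type) (W : groupType) (s : I -> W) (J : set I).
Hypothesis cox : coxeter_system s.
Hypothesis finJ : finite_set (parabolic s J).

Local Notation T := (reflections s).
Local Notation l := (ell s).
Local Notation le := (bruhat_le s).
Local Notation P := (parabolic s J).
Local Notation minr := (min_rep s J).
Local Notation maxr := (max_rep s J).
Local Notation ro := (refl_order s).
Local Notation Q := (QJ s J).
Local Notation tle := (triple_le s J).
Local Notation Qle := (@QJ_le I W s J).
Local Notation edge := (@edge_label I W s J).
Local Notation P1 := (@parabolic1 I W s J).
Implicit Types (t u v w x y z : W) (ts : seq W) (lt : rel W) (a b : IJ s J) (p q r : Q).

Lemma IJ_val a x u w : val a = (x, u, w) ->
  [/\ maxr x, P u, minr w & le x (w * u)].
Proof. by move=> e; have := set_mem (valP a); rewrite e. Qed.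

Lemma IJ_mk x u w : maxr x -> P u -> minr w -> le x (w * u) ->
  exists a, val a = (x, u, w).
Proof.
move=> h1 h2 h3 h4.
have h : (x, u, w) \in IJ s J by apply/mem_set.
by exists (exist (fun e : W * W * W => e \in IJ s J) _ h).
Qed.

Lemma factorization1l u : P u -> reduced_factorization s J u 1 u.
Proof. by move=> Pu; split; rewrite ?mul1g ?(ell1 cox) //; apply: P1. Qed.

(* The middle inequality in the definition of the order is automatic. *)
Lemma triple_mid x u w u1 u2 : maxr x -> minr w -> reduced_factorization s J u u1 u2 ->
  le x (w * u) -> le (x * u2^-1) (w * u1).
Proof.
move=> mx mw [Pu1 Pu2 eu _] h; have [z zu2 hz] := bruhat_mulV cox u2 h.
have e : w * u * u2^-1 = w * u1 by rewrite -eu gmulA mulgK.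
by rewrite e in hz; apply: bruhat_trans hz; apply: (bruhat_antitoneW cox mx Pu2 zu2).
Qed.

Lemma triple_low x u w : minr w -> P u -> le (x * u^-1) w -> le x (w * u).
Proof.
by move=> mw Pu h; rewrite -(mulgVK u x); apply: (bruhat_mul_r cox) => //; apply: (ell_min_rep cox mw).
Qed.

(* Passing from [w'] to [w * u] in the order on triples amounts to enlarging the
   [W_J]-part of [w'] by a Demazure product. *)
Lemma triple_le_key a b x u w x' v w' : val a = (x, u, w) -> val b = (x', v, w') ->
  tle (val b) (val a) ->
  exists u', [/\ P u', le (w' * u') (w * u) & le (x * u'^-1) (x' * v^-1)].
Proof.
move=> ea eb; rewrite ea eb => -[v1 [v2 [[Pv1 Pv2 ev lv] h1 _ h3]]].
have [mx Pu mw h] := IJ_val ea; have [mx' Pv mw' h'] := IJ_val eb.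
have [z zv1 hz] := bruhat_mulV cox v1 h1.
have Pz := bruhat_parabolic cox Pv1 zv1.
exists (z * u); split; first exact: parabolicM.
  rewrite gmulA; apply: (bruhat_mul_r cox) => //; last exact: (ell_min_rep cox mw).
  apply: bruhat_trans h3; apply: (bruhat_mul_l cox) => //; exact: (ell_min_rep cox mw').
by rewrite invgM gmulA -ev invgM gmulA.
Qed.

(** If [s i] is a descent of [v2^-1], the letter moves from the left of [v2] to the right of [v1].
    If not, it is a descent of [x1 * v2^-1] and the factorization stays as it is. *)
Lemma triple_le_step x1 v w1 c d i : maxr x1 -> J i -> ~~ right_inversion s d (s i) ->
  (exists v1 v2, [/\ reduced_factorization s J v v1 v2, le c (x1 * v2^-1) & le (w1 * v1) d]) ->
  (exists v1 v2, [/\ reduced_factorization s J v v1 v2, le (c * s i) (x1 * v2^-1)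
     & le (w1 * v1) (d * s i)]).
Proof.
move=> mx1 Ji hd [v1 [v2 [[Pv1 Pv2 ev lv] h1 h2]]].
have Pi := @parabolicS I W s J i Ji.
have Psv2 : P (s i * v2) by apply: parabolicM.
have E : (s i * v2)^-1 = v2^-1 * s i by rewrite invgM (simpleV cox).
have lsv : l (s i * v2) = l (v2^-1 * s i) by rewrite -E (ellV cox).
case: (boolP (right_inversion s v2^-1 (s i))) => hv2; last first.
  exists v1, v2; split=> //; last exact: bruhat_trans (bruhat_S_up cox hd).
  have hx : right_inversion s (x1 * v2^-1) (s i).
    rewrite /right_inversion -gmulA -E.
    have := ell_max_repV cox mx1 Pv2; have := ell_max_repV cox mx1 Psv2.
    have := ell_up cox hv2; rewrite -lsv (ellV cox); lia.
  by apply: (lift_mulS_le cox).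
have lv2 := ell_dn cox hv2; rewrite -lsv (ellV cox) in lv2.
exists (v1 * s i), (s i * v2); split.
- split=> //; [exact: parabolicM|by rewrite gmulA (mulgSK cox)|].
  have h3 := ell_mulS cox v1 i; have := ellM cox (v1 * s i) (s i * v2).
  rewrite gmulA (mulgSK cox) ev lv lv2; move: h3; case: ifP; rewrite /right_inversion; lia.
- have nd : ~~ right_inversion s (x1 * v2^-1) (s i).
    rewrite /right_inversion -leqNgt -gmulA -E.
    by have := ell_max_repV cox mx1 Pv2; have := ell_max_repV cox mx1 Psv2; lia.
  by rewrite E gmulA; apply: (lift_mulS_up cox).
- by rewrite gmulA; apply: (lift_mulS_up cox).
Qed.


(** The first comparison bounds the pair [x2 * u^-1], [w2], while the second needs the pair
    [x2 * u2^-1], [w2 * u1]. Right multiplication by the letters of a reduced word of [u1] leads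
    from one to the other. *)
Lemma triple_le_trans a1 a2 a3 :
  tle (val a1) (val a2) -> tle (val a2) (val a3) -> tle (val a1) (val a3).
Proof.
case e1: (val a1) => [[x1 v] w1]; case e2: (val a2) => [[x2 u] w2].
case e3: (val a3) => [[x3 u3] w3].
have [mx1 Pv mw1 h1] := IJ_val e1; have [mx2 Pu mw2 h2] := IJ_val e2.
move=> [v1 [v2 [fv hx _ hw]]] [u1 [u2 [[Pu1 Pu2 eu lu] hx' _ hw']]].
have key g : P g -> forall h, P h -> g * h = u -> l u = (l g + l h)%N ->
    exists v1 v2, [/\ reduced_factorization s J v v1 v2,
      le (x2 * u^-1 * g) (x1 * v2^-1) & le (w1 * v1) (w2 * g)].
  move: g; apply: (parabolic_ind cox) => [|g j Pg Jj nd IH] h Ph egh lgh.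
    by exists v1, v2; rewrite !mulg1.
  have Pj : P (s j) by apply: parabolicS.
  rewrite !gmulA; apply: triple_le_step => //.
    have Pgj : P (g * s j) by apply: parabolicM.
    rewrite /right_inversion -leqNgt -gmulA (ell_min_rep cox mw2 Pg) (ell_min_rep cox mw2 Pgj).
    by rewrite (ell_up cox nd) leq_add2l.
  apply: (IH (s j * h)); [exact: parabolicM|by rewrite gmulA|].
  have := ellM cox g (s j * h); rewrite gmulA egh.
  have := ellM cox (s j) h; rewrite (ell_simple1 cox).
  move: lgh; rewrite (ell_up cox nd); lia.
have [v1' [v2' [fv' hx2 hw2]]] := key u1 Pu1 u2 Pu2 eu lu.
have E : x2 * u^-1 * u1 = x2 * u2^-1 by rewrite -eu invgM gmulA mulgVK.
rewrite E in hx2; exists v1', v2'; split=> //; [exact: bruhat_trans hx2| |exact: bruhat_trans hw'].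
exact: (triple_mid mx1 mw1 fv' h1).
Qed.

Lemma QJ_le_trans q p r : Qle p q -> Qle q r -> Qle p r.
Proof.
case: p => [a1|] //; case: q => [a2|] //; case: r => [a3|] //; exact: triple_le_trans.
Qed.

(** The length difference of [w * u] and [x], plus one to leave rank 0 to the bottom. The
    subtraction is not truncated, as [x] is below [w * u]. *)
Definition QJ_rank (q : Q) : nat :=
  if q is Some a then let: (x, u, w) := val a in (l w + l u - l x).+1 else 0%N.

Lemma QJ_rankE a x u w : val a = (x, u, w) -> QJ_rank (Some a) = (l w + l u - l x).+1.
Proof. by rewrite /QJ_rank => ->. Qed.

Lemma QJ_le_rank p q : Qle p q -> (QJ_rank p <= QJ_rank q)%N.
Proof.
case: p => [b|] //; case: q => [a|] //.
case ea: (val a) => [[x u] w]; case eb: (val b) => [[x' v] w'].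
rewrite (QJ_rankE ea) (QJ_rankE eb) /= ea eb => -[v1 [v2 [[Pv1 Pv2 ev lv] h1 _ h3]]].
have [mx Pu mw h] := IJ_val ea; have [mx' Pv mw' h'] := IJ_val eb.
have := bruhat_ell h1; have := bruhat_ell h3.
have := ell_max_repV cox mx Pu; have := ell_max_repV cox mx' Pv2.
have := ell_min_rep cox mw' Pv1; lia.
Qed.

Lemma QJ_le_rank_eq p q : Qle p q -> (QJ_rank q <= QJ_rank p)%N -> p = q.
Proof.
case: p => [b|]; case: q => [a|] //; last by move=> _; rewrite /QJ_rank; case: (val a) => [[x u] w].
case ea: (val a) => [[x u] w]; case eb: (val b) => [[x' v] w'].
rewrite (QJ_rankE ea) (QJ_rankE eb) /= ea eb => -[v1 [v2 [[Pv1 Pv2 ev lv] h1 _ h3]]] hr.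
have [mx Pu mw h] := IJ_val ea; have [mx' Pv mw' h'] := IJ_val eb.
have l1 := ell_max_repV cox mx Pu; have l2 := ell_max_repV cox mx' Pv2.
have l3 := ell_min_rep cox mw' Pv1; have l4 := ell_min_rep cox mw Pu.
have l5 := ell_min_rep cox mw' Pv.
have l6 := bruhat_ell h; have l7 := bruhat_ell h'.
have l8 := bruhat_ell h1; have l9 := bruhat_ell h3.
have ew : w' * v1 = w by apply: (bruhat_eq h3); lia.
have ex : x * u^-1 = x' * v2^-1 by apply: (bruhat_eq h1); lia.
have [ew' ev1] : w' = w /\ v1 = 1.
  by apply: (min_rep_uniq cox mw' mw Pv1 P1); rewrite mulg1.
have [ex' eu] := max_rep_uniq cox mx mx' (parabolicV Pu) (parabolicV Pv2) ex.
congr Some; apply: val_inj; rewrite ea eb ew' ex' -ev ev1 mul1g.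
by congr (_, _, _); apply: invg_inj.
Qed.

Lemma QJ_cover_rank p q : Qle p q -> QJ_rank q = (QJ_rank p).+1 -> covers Qle p q.
Proof.
move=> pq e; split=> // [epq|r pr rq]; first by move: e; rewrite epq => /n_Sn.
have h1 := QJ_le_rank pr; have h2 := QJ_le_rank rq.
case: (leqP (QJ_rank r) (QJ_rank p)) => h; first by left; apply/esym/QJ_le_rank_eq.
by right; apply: QJ_le_rank_eq => //; rewrite e.
Qed.

Lemma edge_cover p q lab : edge p q lab -> covers Qle q p.
Proof.
case=> [a b x u w x' v w' v1 v2 ea eb fv ex hm|a b x u w x' v w' v1 v2 ea eb fv cv hm ew|a x u w ea ex].
- move=> /(coversP cox) [h1 h2]; have [Pv1 Pv2 ev lv] := fv.
  have [mx Pu mw h] := IJ_val ea; have [mx' Pv mw' h'] := IJ_val eb.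
  apply: QJ_cover_rank.
    by rewrite /= ea eb; exists v1, v2; split=> //; rewrite ex; apply: bruhat_refl.
  rewrite (QJ_rankE ea) (QJ_rankE eb).
  have := ell_max_repV cox mx Pu; have := ell_max_repV cox mx' Pv2.
  have := ell_min_rep cox mw' Pv1; rewrite -ex; have := ell_min_rep cox mw Pu.
  have := ell_min_rep cox mw' Pv.
  have := bruhat_ell h; have := bruhat_ell h'; lia.
- move: cv => /(coversP cox) [h1 h2]; have [Pv1 Pv2 ev lv] := fv.
  have [mx Pu mw h] := IJ_val ea; have [mx' Pv mw' h'] := IJ_val eb.
  apply: QJ_cover_rank.
    by rewrite /= ea eb; exists v1, v2; split=> //; rewrite ew; apply: bruhat_refl.
  rewrite (QJ_rankE ea) (QJ_rankE eb).
  have := ell_max_repV cox mx Pu; have := ell_max_repV cox mx' Pv2.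
  have := ell_min_rep cox mw' Pv1; rewrite ew; have := ell_min_rep cox mw Pu.
  have := ell_min_rep cox mw' Pv.
  have := bruhat_ell h; have := bruhat_ell h'; lia.
- have [mx Pu mw h] := IJ_val ea.
  apply: QJ_cover_rank => //; rewrite (QJ_rankE ea) ex (@ell_min_rep I W s J cox) //=; lia.
Qed.

Lemma edge1_spec p q t : edge p q (Label1 t) ->
  exists a b x u w v w', [/\ p = Some a, q = Some b, val a = (x, u, w), val b = (x, v, w') &
    [/\ T t, ~ P t, w' * v = w * u * t, l (w * u) = (l (w' * v)).+1 & (l w' < l w)%N]].
Proof.
move e: (Label1 t) => lab h; case: h e => // a b x u w x' v w' v1 v2 ea eb fv ex hm.
move=> /(coversP cox) [h1 h2] [->]; have [Pv1 Pv2 ev lv] := fv.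
have [mx Pu mw h] := IJ_val ea; have [mx' Pv mw' h'] := IJ_val eb.
have [ex' eu'] := max_rep_uniq cox mx mx' (parabolicV Pu) (parabolicV Pv2) ex.
have eu : u = v2 by apply: invg_inj.
have [t0 Tt0 et0] := bruhat_step1 h1 h2.
have ew : w' * v1 = w * t0 by rewrite et0 (mulgTK cox).
have eL : (w * u)^-1 * (w' * v) = u^-1 * t0 * u.
  by rewrite -ev -eu (gmulA w') ew invgM; gsimp.
have lmin := ell_min_rep cox mw' Pv1.
exists a, b, x, u, w, v, w'; split=> //; first by rewrite eb ex'.
rewrite eL; split.
- exact: refl_conj.
- move=> Pt.
  have E : w' * v1 = w * (u * (u^-1 * t0 * u) * u^-1) by rewrite ew; gsimp.
  have Put : P (u * (u^-1 * t0 * u) * u^-1) by apply: parabolicM (parabolicV Pu); apply: parabolicM.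
  have [eww _] := min_rep_uniq cox mw' mw Pv1 Put E.
  by move: h2; rewrite lmin eww; lia.
- by rewrite -ev -eu gmulA ew; gsimp.
- rewrite !(@ell_min_rep I W s J cox) // lv -eu; move: h2; rewrite lmin; lia.
- by move: h2; rewrite lmin; lia.
Qed.

(** The factorization of [v] has to be [v * u^-1] times [u], and the point is that it is reduced. If
    [w' * (v * u^-1)] were not shorter than [w], projecting to minimal representatives would give
    [w = w'] and put [t] into [W_J]. *)
Lemma edge1_intro a b x u w v w' t : val a = (x, u, w) -> val b = (x, v, w') ->
  T t -> ~ P t -> w' * v = w * u * t -> l (w * u) = (l (w' * v)).+1 ->
  edge (Some a) (Some b) (Label1 t).
Proof.
move=> ea eb Tt nPt et el.
have [mx Pu mw h] := IJ_val ea; have [_ Pv mw' h'] := IJ_val eb.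
have elab : t = (w * u)^-1 * (w' * v) by rewrite et gmulA mulVg mul1g.
have Pvu : P (v * u^-1) by apply: parabolicM => //; apply: parabolicV.
have hle : le (w' * v) (w * u).
  have -> : w * u = w' * v * t by rewrite et (mulgTK cox).
  by apply: bruhat_edge => //; rewrite et (mulgTK cox) // -et el.
have ew : w' * (v * u^-1) = w * (u * t * u^-1) by rewrite gmulA et; gsimp.
have Tc : T (u * t * u^-1) by apply: refl_conjV.
have ww : le w' w by apply: (bruhat_proj cox mw' mw Pv Pu hle).
have lt : (l (w' * (v * u^-1)) < l w)%N.
  rewrite ltnNge; apply/negP => hge; have [e|ne] := pselect (w = w').
    have et2 : t = u^-1 * v.
      by rewrite elab e invgM -gmulA; congr (_ * _); rewrite gmulA mulVg mul1g.
    by apply: nPt; rewrite et2; apply: parabolicM => //; apply: parabolicV.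
  apply: ne; apply: (bruhat_antisym (s := s)) ww.
  apply: (bruhat_proj cox mw mw' P1 Pvu); rewrite mulg1 ew; apply: bruhat_edge => //.
  by rewrite ltn_neqAle eq_sym (ell_refl_neq cox) // -ew.
have lv : l v = (l (v * u^-1) + l u)%N.
  have := ellM cox (v * u^-1) u; rewrite mulgVK.
  move: lt el; rewrite (ell_min_rep cox mw' Pvu) (ell_min_rep cox mw Pu) (ell_min_rep cox mw' Pv); lia.
rewrite elab; apply: (@edge_type1 _ _ s J a b x u w x v w' (v * u^-1) u) => //.
- by split=> //; rewrite mulgVK.
- by apply: (triple_mid mx mw' _ h'); split=> //; rewrite mulgVK.
- apply/(coversP cox); have lw : l w = (l (w' * (v * u^-1))).+1.
    by move: el; rewrite (ell_min_rep cox mw' Pvu) (ell_min_rep cox mw Pu) (ell_min_rep cox mw' Pv); lia.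
  split=> //; have -> : w = w' * (v * u^-1) * (u * t * u^-1) by rewrite ew (mulgTK cox).
  by apply: bruhat_edge => //; rewrite ew (mulgTK cox) // -ew lw.
Qed.

Lemma edge2_spec p q t : edge p q (Label2 t) ->
  exists a b x u w x' v, [/\ p = Some a, q = Some b, val a = (x, u, w), val b = (x', v, w) &
    [/\ T t, x' * v^-1 = x * u^-1 * t & l (x' * v^-1) = (l (x * u^-1)).+1]].
Proof.
move e: (Label2 t) => lab h; case: h e => // a b x u w x' v w' v1 v2 ea eb fv.
move=> /(coversP cox) [h1 h2] hm ew [->]; have [Pv1 Pv2 ev lv] := fv.
have [mx Pu mw h] := IJ_val ea; have [mx' Pv mw' h'] := IJ_val eb.
have [ew' ev1] : w' = w /\ v1 = 1.
  by apply: (min_rep_uniq cox mw' mw Pv1 P1); rewrite mulg1.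
have evv : v2 = v by rewrite -ev ev1 mul1g.
rewrite evv in h1 h2; have [t0 Tt0 et0] := bruhat_step1 h1 h2.
have eL : (x' * v^-1)^-1 * (x * u^-1) = t0.
  by rewrite et0 invgM (reflV cox Tt0) -gmulA mulVg mulg1.
exists a, b, x, u, w, x', v; split=> //; first by rewrite eb ew'.
by rewrite eL.
Qed.

Lemma edge2_intro a b x u w x' v t : val a = (x, u, w) -> val b = (x', v, w) ->
  T t -> x' * v^-1 = x * u^-1 * t -> l (x' * v^-1) = (l (x * u^-1)).+1 ->
  edge (Some a) (Some b) (Label2 t).
Proof.
move=> ea eb Tt et el.
have [mx Pu mw h] := IJ_val ea; have [mx' Pv _ h'] := IJ_val eb.
have elab : t = (x' * v^-1)^-1 * (x * u^-1).
  by rewrite et invgM (reflV cox Tt) -gmulA mulVg mulg1.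
have fv := factorization1l Pv.
rewrite elab; apply: (@edge_type2 _ _ s J a b x u w x' v w 1 v) => //.
- apply/(coversP cox); split=> //; rewrite et; apply: bruhat_edge => //.
  by rewrite -et el.
- exact: triple_mid fv h'.
- by rewrite mulg1.
Qed.

Lemma edge3_spec p q : edge p q (LabelEmpty W) ->
  exists a x u w, [/\ p = Some a, q = None, val a = (x, u, w) & x = w * u].
Proof.
move e: (LabelEmpty W) => lab h; case: h e => // a x u w ea ex _.
by exists a, x, u, w.
Qed.

End Poset.

(** * Increasing chains of [QJ] *)

Section LabeledChains.
Variables (I : Type) (W : groupType) (s : I -> W) (J : set I) (preceq : rel W).
Hypothesis cox : coxeter_system s.
Hypothesis finJ : finite_set (parabolic s J).
Hypothesis rord : reflection_order s preceq.
Hypothesis plast : parabolic_last s J preceq.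

Local Notation T := (reflections s).
Local Notation l := (ell s).
Local Notation le := (bruhat_le s).
Local Notation P := (parabolic s J).
Local Notation minr := (min_rep s J).
Local Notation maxr := (max_rep s J).
Local Notation Q := (QJ s J).
Local Notation Qle := (@QJ_le I W s J).
Local Notation edge := (@edge_label I W s J).
Local Notation P1 := (@parabolic1 I W s J).
Local Notation llt := (label_lt preceq).
Implicit Types (t u v w x y z : W) (ts : seq W) (a b : IJ s J) (p q r : Q) (ls : seq (label W)).

Definition slt : rel W := fun t t' => [&& `[< T t >], `[< T t' >] & strict preceq t t'].

Let ro : refl_order s slt. Proof. exact: refl_order_of. Qed.

Lemma slt_strict t t' : slt t t' -> strict preceq t t'.
Proof. by case/and3P. Qed.

Lemma strict_slt t t' : T t -> T t' -> strict preceq t t' = slt t t'.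
Proof. by move=> Tt Tt'; rewrite /slt !asboolT. Qed.

Lemma slt_last t t' : T t -> ~ P t -> T t' -> P t' -> slt t t'.
Proof. by move=> h1 h2 h3 h4; rewrite -strict_slt //; apply: plast. Qed.

Lemma slt_trans : transitive slt.
Proof. by move=> t2 t1 t3; apply: (ro_trans ro). Qed.

Lemma sorted_split ts : (forall t, t \in ts -> T t) -> sorted slt ts ->
  exists ts1 ts2, [/\ ts = ts1 ++ ts2, (forall t, t \in ts1 -> ~ P t) & (forall t, t \in ts2 -> P t)].
Proof.
elim: ts => [|t ts IH] hT so; first by exists [::], [::].
have Tt : T t by apply: hT; rewrite inE eqxx.
have hT' u : u \in ts -> T u by move=> h; apply: hT; rewrite inE h orbT.
case: (pselect (P t)) => Pt.
  exists [::], (t :: ts); split=> // u; rewrite inE => /orP[/eqP-> //|uts].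
  apply: contrapT => nP; have h := slt_last (hT' _ uts) nP Tt Pt.
  have /allP/(_ _ uts) h' := order_path_min slt_trans so.
  exact: (ro_asym ro h h').
have [ts1 [ts2 [-> h1 h2]]] := IH hT' (path_sorted so).
exists (t :: ts1), ts2; split=> // u; rewrite inE => /orP[/eqP->|] //; exact: h1.
Qed.

Lemma sorted_cat_parabolic ts1 ts2 :
  (forall t, t \in ts1 -> T t) -> (forall t, t \in ts2 -> T t) ->
  sorted slt ts1 -> sorted slt ts2 ->
  (forall t, t \in ts1 -> ~ P t) -> (forall t, t \in ts2 -> P t) ->
  sorted slt (ts1 ++ ts2).
Proof.
move=> T1 T2 so1 so2 h1 h2.
have tr := slt_trans.
rewrite sorted_pairwise // pairwise_cat -!sorted_pairwise // so1 so2 !andbT.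
by apply/allrelP => u v hu hv; apply: slt_last; [apply: T1|apply: h1|apply: T2|apply: h2].
Qed.

Lemma downchain_T y ts x : downchain s y ts x -> forall t, t \in ts -> T t.
Proof.
elim: ts y => // t ts IH y /= [Tt _ h] u; rewrite inE => /orP[/eqP-> //|].
exact: IH h u.
Qed.

Lemma upchain_T y ts x : upchain s y ts x -> forall t, t \in ts -> T t.
Proof.
elim: ts y => // t ts IH y /= [Tt _ h] u; rewrite inE => /orP[/eqP-> //|].
exact: IH h u.
Qed.

Lemma downchain_extend y ts w u : minr w -> P u -> downchain s y ts (w * u) ->
  sorted slt ts -> (forall t, t \in ts -> ~ P t) ->
  exists ts', [/\ downchain s y (ts ++ ts') w, sorted slt (ts ++ ts') & forall t, t \in ts' -> P t].
Proof.
move=> mw Pu ch so nP.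
have [ts' ch' so'] := downchain_exists cox ro (bruhat_min_rep cox mw Pu).
have hP := downchain_in_coset cox mw Pu ch'.
exists ts'; split=> //; first by apply/(downchain_cat cox); exists (w * u).
by apply: sorted_cat_parabolic => //; apply: downchain_T; [exact: ch|exact: ch'].
Qed.

(* The increasing chains from [y] to elements of [w * W_J] that avoid [W_J] all extend
   to the unique increasing chain from [y] to [w], so they are one and the same. *)
Lemma coset_max y w : minr w -> le w y ->
  exists ts v, [/\ P v, downchain s y ts (w * v), sorted slt ts, (forall t, t \in ts -> ~ P t)
    & forall u, P u -> le (w * u) y -> le (w * u) (w * v)].
Proof.
move=> mw wy.
have part z : forall u, P u -> z = w * u -> le z y -> exists ts v,
    [/\ P v, downchain s y ts (w * v), sorted slt ts, (forall t, t \in ts -> ~ P t) & le z (w * v)].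
  move=> u Pu ez zy.
  have [ts ch so] := downchain_exists cox ro zy.
  have [ts1 [ts2 [ets n1 p2]]] := sorted_split (downchain_T ch) so.
  move: ch; rewrite ets => /(downchain_cat cox)[m [ch1 ch2]].
  have [v Pv em] := downchain_parabolic cox p2 ch2.
  exists ts1, (u * v); rewrite gmulA -ez -em; split=> //.
  - exact: parabolicM.
  - move: so; rewrite ets sorted_pairwise; last exact: slt_trans.
    by rewrite pairwise_cat sorted_pairwise; [case/and3P|exact: slt_trans].
  - exact: (downchain_le cox ch2).
have [ts [v [Pv ch so nP _]]] := part w 1 P1 (esym (mulg1 w)) wy.
exists ts, v; split=> // u Pu uy.
have [ts' [v' [Pv' ch' so' nP' h]]] := part _ u Pu erefl uy.
have [e1 [c1 s1 p1]] := downchain_extend mw Pv ch so nP.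
have [e2 [c2 s2 p2]] := downchain_extend mw Pv' ch' so' nP'.
have e := downchain_uniq cox ro c1 s1 c2 s2.
suff ets : ts = ts' by rewrite ets in ch; rewrite (downchain_fun ch ch').
have f (c d : seq W) : (forall t, t \in c -> ~ P t) -> (forall t, t \in d -> P t) ->
    [seq t <- c ++ d | `[< ~ P t >]] = c.
  move=> hc hd; rewrite filter_cat (_ : [seq t <- d | _] = [::]) ?cats0.
    by apply/all_filterP/allP => t /hc h1; apply/asboolP.
  apply/eqP; rewrite -(negbK (_ == _)) -has_filter; apply/hasPn => t /hd h1.
  by apply/asboolP => /(_ h1).
by rewrite -(f ts e1 nP p1) e f.
Qed.

(* Chains of labeled edges, read downwards. *)
Fixpoint edge_chain q (c : seq Q) ls p : Prop :=
  match c, ls with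
  | [::], [::] => q = p
  | r :: c', lab :: ls' => edge q r lab /\ edge_chain r c' ls' p
  | _, _ => False
  end.

Lemma edge_chain_cat q r p c c' ls ls' :
  edge_chain q c ls r -> edge_chain r c' ls' p -> edge_chain q (c ++ c') (ls ++ ls') p.
Proof.
elim: c q ls => [|r0 c IH] q [|lab ls] //=; first by move=> ->.
by move=> [h1 h2] h3; split=> //; apply: IH.
Qed.

Lemma edge_chain_le q c ls p : edge_chain q c ls p -> Qle p q.
Proof.
elim: c q ls => [|r c IH] q [|lab ls] //=.
  move=> ->; case: p => [a|] //=; case ea: (val a) => [[x u] w].
  have [mx Pu mw h] := IJ_val ea; have f := factorization1l cox Pu.
  exists 1, u; split=> //; rewrite ?mulg1; try exact: bruhat_refl.
  by rewrite -[X in le _ X]mulg1; apply: (triple_mid cox mx mw f h).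
move=> [/(edge_cover cox)[h1 _ _] /IH h2]; exact: (QJ_le_trans cox h2 h1).
Qed.

Lemma chain_type1 x y ts m : maxr x -> le x m -> downchain s y ts m ->
  (forall t, t \in ts -> ~ P t) ->
  forall a u w, val a = (x, u, w) -> w * u = y ->
  exists b c u' w', [/\ val b = (x, u', w'), w' * u' = m &
    edge_chain (Some a) c [seq Label1 t | t <- ts] (Some b)].
Proof.
move=> mx xm; elim: ts y => [|t ts IH] y /=.
  by move=> -> _ a u w ea ey; exists a, [::], u, w.
move=> [Tt e ch] nP a u w ea ey.
have [w2 [u2 [mw2 Pu2 e2]]] := min_rep_exists s J (y * t).
have xle : le x (w2 * u2).
  by rewrite -e2; apply: bruhat_trans xm (downchain_le cox ch).
have [b eb] := IJ_mk mx Pu2 mw2 xle.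
have nP' t' : t' \in ts -> ~ P t' by move=> h; apply: nP; rewrite inE h orbT.
have [b' [c [u' [w' [eb' em ec]]]]] := IH _ ch nP' b u2 w2 eb (esym e2).
exists b', (Some b :: c), u', w'; split=> //=; split=> //.
apply: (edge1_intro cox ea eb) => //; first by apply: nP; rewrite inE eqxx.
  by rewrite -e2 ey.
by rewrite -e2 ey.
Qed.

Lemma chain_type2 w y ts m : minr w -> le m w -> upchain s y ts m ->
  forall a x u, val a = (x, u, w) -> x * u^-1 = y ->
  exists b c x' u', [/\ val b = (x', u', w), x' * u'^-1 = m &
    edge_chain (Some a) c [seq Label2 t | t <- ts] (Some b)].
Proof.
move=> mw mle; elim: ts y => [|t ts IH] y /=.
  by move=> -> a x u ea ey; exists a, [::], x, u.
move=> [Tt e ch] a x u ea ey.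
have [x2 [u2 [mx2 Pu2 e2]]] := max_rep_exists (y * t) finJ.
have xle : le x2 (w * u2).
  apply: (triple_low cox mw Pu2); rewrite -e2.
  exact: bruhat_trans (upchain_le ch) mle.
have [b eb] := IJ_mk mx2 Pu2 mw xle.
have [b' [c [x' [u' [eb' em ec]]]]] := IH _ ch b x2 u2 eb (esym e2).
exists b', (Some b :: c), x', u'; split=> //=; split=> //.
by apply: (edge2_intro cox ea eb) => //; rewrite -e2 ey.
Qed.

Lemma sorted_label2 ts : sorted slt ts -> sorted llt [seq Label2 t | t <- ts].
Proof.
rewrite sorted_map; apply: sub_sorted => t t' h; exact: slt_strict.
Qed.

Lemma sorted_label_cat ts ls : sorted slt ts -> sorted llt ls ->
  (forall t ls', ls <> Label1 t :: ls') -> sorted llt ([seq Label1 t | t <- ts] ++ ls).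
Proof.
move=> so sl h; elim: ts so => [|t ts IH] //= so.
case: ts IH so => [|t2 ts] IH /=.
  by case: ls sl h {IH} => [|lab ls] //= -> h _; case: lab h => [t' /(_ t' ls)|//|//].
by case/andP=> /slt_strict -> so; apply: IH.
Qed.


Lemma chain_exists p q : Qle p q -> exists c ls, edge_chain q c ls p /\ sorted llt ls.
Proof.
case: q => [a|]; last by case: p => [b|] // _; exists [::], [::].
case ea: (val a) => [[x u] w]; have [mx Pu mw h] := IJ_val ea.
case: p => [b|] pq; last first.
  have [ts ch so] := downchain_exists cox ro h.
  have [ts1 [ts2 [ets n1 p2]]] := sorted_split (downchain_T ch) so.
  have e2 : ts2 = [::].
    (* The parabolic part descends to [x] from an element of the coset of [x], where [x] is longest;
       so that part is empty. *)
    move: ch; rewrite ets => /(downchain_cat cox)[m [_ ch2]].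
    have [v Pv em] := downchain_parabolic cox p2 ch2.
    move/(downchain_rev cox)/upchain_ell: ch2; rewrite size_rev.
    have := mx v Pv; rewrite -em; case: ts2 {p2 ets} => //= t2 ts2; lia.
  rewrite ets e2 cats0 in ch so.
  have [b [c [u' [w' [eb em ec]]]]] := chain_type1 mx (bruhat_refl s x) ch n1 ea erefl.
  exists (c ++ [:: None]), ([seq Label1 t | t <- ts1] ++ [:: LabelEmpty W]); split.
    apply: edge_chain_cat ec _; split=> //; exact: edge_type3 eb (esym em).
  by apply: sorted_label_cat.
case eb: (val b) => [[x' v] w']; have [mx' Pv mw' h'] := IJ_val eb.
have [u0 [Pu0 k1 k2]] := triple_le_key cox ea eb pq.
have wy : le w' (w * u) by apply: bruhat_trans k1; apply: (bruhat_min_rep cox mw' Pu0).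
have [ts [v2 [Pv2 ch so nP max]]] := coset_max mw' wy.
(* [w' * v2] dominates [w' * u0], so passing from [u0] to [v2] only lowers the left-hand side. *)
have k3 : le (x * v2^-1) (x' * v^-1).
  by apply: bruhat_trans k2; apply: (bruhat_antitone cox mw' mx) => //; apply: max.
have k4 : le (x' * v^-1) w'.
  by have := triple_mid cox mx' mw' (factorization1l cox Pv) h'; rewrite mulg1.
have xm : le x (w' * v2) by apply: (triple_low cox mw' Pv2); apply: bruhat_trans k3 k4.
have [b1 [c1 [u1 [w1 [eb1 em1 ec1]]]]] := chain_type1 mx xm ch nP ea erefl.
have [_ Pu1 mw1 _] := IJ_val eb1.
have [ew1 eu1] := min_rep_uniq cox mw1 mw' Pu1 Pv2 em1; rewrite ew1 eu1 in eb1.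
have [ts' [ch' so' _]] := inc_chain_first cox ro k3.
have [b2 [c2 [x2 [u2 [eb2 em2 ec2]]]]] := chain_type2 mw' k4 ch' eb1 erefl.
have [mx2 Pu2 _ _] := IJ_val eb2.
have [ex2 eu2] := max_rep_uniq cox mx2 mx' (parabolicV Pu2) (parabolicV Pv) em2.
have eb' : b2 = b.
  by apply: val_inj; rewrite eb2 eb ex2; congr (_, _, _); apply: invg_inj.
rewrite eb' in ec2.
exists (c1 ++ c2), ([seq Label1 t | t <- ts] ++ [seq Label2 t | t <- ts']); split.
  exact: edge_chain_cat ec1 ec2.
apply: sorted_label_cat => //; first exact: sorted_label2.
by case: (ts').
Qed.

Lemma edge_None q lab : ~ edge None q lab.
Proof. by move e: None => r h; case: h e. Qed.

Lemma edge1_refl p q t : edge p q (Label1 t) -> T t.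
Proof. by case/(edge1_spec cox)=> a [b [x [u [w [v [w' [_ _ _ _ []]]]]]]]. Qed.
Lemma edge2_refl p q t : edge p q (Label2 t) -> T t.
Proof. by case/(edge2_spec cox)=> a [b [x [u [w [v [w' [_ _ _ _ []]]]]]]]. Qed.

(** The label gives the new element [w * u * t] or [x * u^-1 * t], and its coset decomposition is
    unique. Chains from a common top can therefore be compared by their labels alone. *)
Lemma edge_target p q r lab : edge p q lab -> edge p r lab -> q = r.
Proof.
case: lab => [t||t].
- move=> /(edge1_spec cox)[a [b [x [u [w [v [w' [-> -> ea eb [_ _ e _ _]]]]]]]]].
  move=> /(edge1_spec cox)[a2 [b2 [x2 [u2 [w2 [v2 [w2' [[ea2] -> ea3 eb2 [_ _ e2 _ _]]]]]]]]].
  rewrite -ea2 ea in ea3; case: ea3 => ex eu ew; rewrite -eu -ew in e2.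
  have [_ Pv mw' _] := IJ_val eb; have [_ Pv2 mw2' _] := IJ_val eb2.
  have [e3 e4] := min_rep_uniq cox mw' mw2' Pv Pv2 (etrans e (esym e2)).
  by congr Some; apply: val_inj; rewrite eb eb2 e3 e4 ex.
- by move=> /edge3_spec[a [x [u [w [_ -> _ _]]]]] /edge3_spec[a2 [x2 [u2 [w2 [_ -> _ _]]]]].
- move=> /(edge2_spec cox)[a [b [x [u [w [x' [v [-> -> ea eb [_ e _]]]]]]]]].
  move=> /(edge2_spec cox)[a2 [b2 [x2 [u2 [w2 [x2' [v2 [[ea2] -> ea3 eb2 [_ e2 _]]]]]]]]].
  rewrite -ea2 ea in ea3; case: ea3 => ex eu ew; rewrite -eu -ex in e2.
  have [mx' Pv _ _] := IJ_val eb; have [mx2' Pv2 _ _] := IJ_val eb2.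
  have [e3 e4] := max_rep_uniq cox mx' mx2' (parabolicV Pv) (parabolicV Pv2) (etrans e (esym e2)).
  by congr Some; apply: val_inj; rewrite eb eb2 e3 ew; congr (_, _, _); apply: invg_inj.
Qed.

Lemma edge_label_uniq p q lab lab' : edge p q lab -> edge p q lab' -> lab = lab'.
Proof.
have no12 t t' : edge p q (Label1 t) -> edge p q (Label2 t') -> False.
  move=> /(edge1_spec cox)[a [b [x [u [w [v [w' [-> -> ea eb [_ _ _ _ hw]]]]]]]]].
  move=> /(edge2_spec cox)[a2 [b2 [x2 [u2 [w2 [x2' [v2 [[ea2] [eb2] ea3 eb3 _]]]]]]]].
  rewrite -ea2 ea in ea3; rewrite -eb2 eb in eb3; case: ea3 eb3 => _ _ ew [_ _ e].
  by move: hw; rewrite ew e ltnn.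
case: lab lab' => [t||t] [t'||t'] //.
- move=> /(edge1_spec cox)[a [b [x [u [w [v [w' [-> -> ea eb [_ _ e _ _]]]]]]]]].
  move=> /(edge1_spec cox)[a2 [b2 [x2 [u2 [w2 [v2 [w2' [[ea2] [eb2] ea3 eb3 [_ _ e2 _ _]]]]]]]]].
  rewrite -ea2 ea in ea3; rewrite -eb2 eb in eb3; case: ea3 eb3 => _ eu ew [_ ev ew'].
  by congr (Label1 _); apply: (mulgI (w * u)); rewrite -e eu ew -e2 ev ew'.
- by move=> /(edge1_spec cox)[a [b [x [u [w [v [w' [_ -> _ _ _]]]]]]]] /edge3_spec[a2 [x2 [u2 [w2 [_]]]]].
- by move=> h1 /(no12 _ _ h1).
- by move=> /edge3_spec[a2 [x2 [u2 [w2 [_ -> _ _]]]]] /(edge1_spec cox)[a [b [x [u [w [v [w' []]]]]]]].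
- by move=> /edge3_spec[a2 [x2 [u2 [w2 [_ -> _ _]]]]] /(edge2_spec cox)[a [b [x [u [w [v [w' []]]]]]]].
- by move=> h1 h2; case: (no12 _ _ h2 h1).
- by move=> /(edge2_spec cox)[a [b [x [u [w [v [w' [_ -> _ _ _]]]]]]]] /edge3_spec[a2 [x2 [u2 [w2 [_]]]]].
- move=> /(edge2_spec cox)[a [b [x [u [w [x' [v [-> -> ea eb [_ e _]]]]]]]]].
  move=> /(edge2_spec cox)[a2 [b2 [x2 [u2 [w2 [x2' [v2 [[ea2] [eb2] ea3 eb3 [_ e2 _]]]]]]]]].
  rewrite -ea2 ea in ea3; rewrite -eb2 eb in eb3; case: ea3 eb3 => ex eu _ [ex' ev _].
  by congr (Label2 _); apply: (mulgI (x * u^-1)); rewrite -e ex eu -e2 ex' ev.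
Qed.

(** A repeated reflection would undo the first step, as [t * t = 1]. Hence the weak inequalities in
    [increasing] are strict along a chain of edges. *)
Lemma edge_repeat q r p lab : edge q r lab -> edge r p lab -> False.
Proof.
case: lab => [t||t].
- move=> /(edge1_spec cox)[a [b [x [u [w [v [w' [_ -> ea eb [Tt _ e h _]]]]]]]]].
  move=> /(edge1_spec cox)[a2 [b2 [x2 [u2 [w2 [v2 [w2' [[ea2] _ ea3 _ [_ _ e2 h2 _]]]]]]]]].
  rewrite -ea2 eb in ea3; case: ea3 => _ ev ew; rewrite -ev -ew in e2 h2.
  by move: h h2; rewrite e2 e (mulgTK cox) //; lia.
- by move=> /edge3_spec[a [x [u [w [_ -> _ _]]]]] /edge_None.
- move=> /(edge2_spec cox)[a [b [x [u [w [x' [v [_ -> ea eb [Tt e h]]]]]]]]].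
  move=> /(edge2_spec cox)[a2 [b2 [x2 [u2 [w2 [x2' [v2 [[ea2] _ ea3 _ [_ e2 h2]]]]]]]]].
  rewrite -ea2 eb in ea3; case: ea3 => ex ev _; rewrite -ex -ev in e2 h2.
  by move: h h2; rewrite e2 e (mulgTK cox) //; lia.
Qed.

Lemma label_lt_asym p q p' q' lab lab' : edge p q lab -> edge p' q' lab' ->
  llt lab lab' -> llt lab' lab -> False.
Proof.
case: lab lab' => [t||t] [t'||t'] //= h h'.
- have Tt := edge1_refl h; have Tt' := edge1_refl h'.
  by rewrite !strict_slt // => h1 h2; apply: (ro_asym ro h1 h2).
- have Tt := edge2_refl h; have Tt' := edge2_refl h'.
  by rewrite !strict_slt // => h1 h2; apply: (ro_asym ro h1 h2).
Qed.

Lemma edge_chain_peel1 a c ls p x u w : edge_chain (Some a) c ls p -> val a = (x, u, w) ->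
  exists ts ls2 a1 u1 w1 c2, [/\ val a1 = (x, u1, w1), ls = [seq Label1 t | t <- ts] ++ ls2,
    downchain s (w * u) ts (w1 * u1), (forall t, t \in ts -> ~ P t) &
    edge_chain (Some a1) c2 ls2 p /\ forall t ls', ls2 <> Label1 t :: ls'].
Proof.
elim: c a ls u w => [|r c IH] a [|lab ls] u w //=.
  by move=> h ea; exists [::], [::], a, u, w, [::].
move=> [h1 h2] ea0; have {ea0} ea : val a = (x, u, w) := ea0.
have stop : (forall t, lab <> Label1 t) -> exists ts ls2 a1 u1 w1 c2,
    [/\ val a1 = (x, u1, w1), lab :: ls = [seq Label1 t | t <- ts] ++ ls2,
      downchain s (w * u) ts (w1 * u1), (forall t, t \in ts -> ~ P t) &
      edge_chain (Some a1) c2 ls2 p /\ forall t ls', ls2 <> Label1 t :: ls'].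
  move=> nl; exists [::], (lab :: ls), a, u, w, (r :: c); split=> //; split=> //.
  by move=> t ls' [/nl].
case: lab h1 stop => [t||t] h1 stop; [|exact: stop|exact: stop].
have [a0 [b [x0 [u0 [w0 [v [w' [[ea0] er ea1 eb [Tt nPt e hl _]]]]]]]]] := edge1_spec cox h1.
rewrite -ea0 ea in ea1; case: ea1 => ex eu ew; rewrite -ex in eb; rewrite -eu -ew in e hl.
rewrite er in h2.
have [ts [ls2 [a1 [u1 [w1 [c2 [h3 h4 h5 h6 h7]]]]]]] := IH b ls v w' h2 eb.
exists (t :: ts), ls2, a1, u1, w1, c2; split=> //=.
- by rewrite h4.
- by rewrite -e.
- by move=> t'; rewrite inE => /orP[/eqP->|] //; apply: h6.
Qed.

(** Type 2 labels are the largest, so after one of them an increasing chain has only Type 2 labels: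
    [w] stays fixed and the chain does not reach the bottom. *)
Lemma edge_chain_type2 a c t ls p x u w : edge_chain (Some a) c (Label2 t :: ls) p ->
  sorted llt (Label2 t :: ls) -> val a = (x, u, w) ->
  exists ts b x' v, [/\ p = Some b, val b = (x', v, w), ls = [seq Label2 t | t <- ts] &
    upchain s (x * u^-1) (t :: ts) (x' * v^-1)].
Proof.
elim: c a t ls x u => [|r c IH] a t ls x u //= [h1 h2] so ea0.
have {ea0} ea : val a = (x, u, w) := ea0.
have [a0 [b [x0 [u0 [w0 [x' [v [[ea0] er ea1 eb [Tt e hl]]]]]]]]] := edge2_spec cox h1.
rewrite -ea0 ea in ea1; case: ea1 => ex eu ew; rewrite -ew in eb; rewrite -ex -eu in e hl.
rewrite er in h2; case: ls so h2 => [|[t2||t2] ls] //=.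
  by case: c {IH} => // _ <-; exists [::], b, x', v; split=> //=; split=> //; rewrite -e.
move=> /andP[_ so] h2.
have [ts [b' [x2 [v2 [h3 h4 h5 h6]]]]] := IH b t2 ls x' v h2 so eb.
by exists (t2 :: ts), b', x2, v2; split=> //=; [rewrite h5|split; rewrite -?e].
Qed.

Lemma sorted_label1_inv ts : (forall t, t \in ts -> T t) ->
  sorted llt [seq Label1 t | t <- ts] -> sorted slt ts.
Proof.
move=> hT; rewrite sorted_map; apply: (sub_in_sorted (P := fun t => `[< T t >])).
  by move=> t t' /asboolP Tt /asboolP Tt' /=; rewrite strict_slt.
by apply/allP => t /hT h; apply/asboolP.
Qed.
Lemma sorted_label2_inv ts : (forall t, t \in ts -> T t) ->
  sorted llt [seq Label2 t | t <- ts] -> sorted slt ts.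
Proof.
move=> hT; rewrite sorted_map; apply: (sub_in_sorted (P := fun t => `[< T t >])).
  by move=> t t' /asboolP Tt /asboolP Tt' /=; rewrite strict_slt.
by apply/allP => t /hT h; apply/asboolP.
Qed.

(* If the first label is of Type 1, the Type 1 part of the chain extends to the
   increasing Bruhat chain from [w * u] down to [w'], whose first label is minimal. *)
Lemma edge_chain_first q r c lab ls p r2 lab2 : edge_chain q (r :: c) (lab :: ls) p ->
  sorted llt (lab :: ls) -> edge q r2 lab2 -> Qle p r2 -> lab = lab2 \/ llt lab lab2.
Proof.
case: q => [a|]; last by case=> /edge_None.
case ea: (val a) => [[x u] w] ch so h2 pr2; have [mx Pu mw h] := IJ_val ea.
case: lab ch so => [t||t] ch so.
- case: lab2 h2 => [t2||t2] h2; try by right.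
  have [a2 [b2 [x2 [u2 [w2 [v2 [w2' [[ea2] er2 ea3 eb2 [Tt2 _ e2 l2 _]]]]]]]]] := edge1_spec cox h2.
  rewrite -ea2 ea in ea3; case: ea3 => ex eu ew; rewrite -ex in eb2; rewrite -eu -ew in e2 l2.
  rewrite er2 in pr2; have [_ Pv2 mw2' hb2] := IJ_val eb2.
  have [ts [ls2 [a1 [u1 [w1 [c2 [ea1 els dch nP [ch2 nl]]]]]]]] := edge_chain_peel1 ch ea.
  case: ts els dch nP => [|t0 ts] els dch nP; first by case: (nl t ls); rewrite els.
  case: els => et els; rewrite -et in dch nP.
  have sots : sorted slt (t :: ts).
    apply: sorted_label1_inv; first exact: downchain_T dch.
    by move: so; rewrite els -cat_cons -map_cons => /cat_sorted2[].
  have [_ Pu1 mw1 _] := IJ_val ea1.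
  suff [ts' [z [dch' so' hz]]] : exists ts' z, [/\ downchain s (w * u) (t :: ts') z,
      sorted slt (t :: ts') & le z (w * u * t2)].
    by case: (downchain_first cox ro dch' so' Tt2 hz) => [|->|/slt_strict]; [rewrite -e2|left|right].
  (* For the bottom, the Type 1 part ends at [w1 * u1 = x]. Otherwise it ends in the coset of [w']
     and is prolonged down to [w'] by labels in [W_J]. *)
  case: p ch ch2 pr2 => [b|] ch ch2 pr2; last first.
    exists ts, (w1 * u1); split=> //; rewrite -e2.
    case: ls2 els nl ch2 => [|[t3||t3] ls2] els nl ch2; first by case: c2 ch2.
    + by case: (nl t3 ls2).
    + case: c2 ch2 => //= r3 c3 [/edge3_spec[a3 [x3 [u3 [w3 [[ea3] _ ea4 ex3]]]]] _].
      by rewrite -ea3 ea1 in ea4; case: ea4 => ex4 eu4 ew4; rewrite ew4 eu4 -ex3 -ex4.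
    + move: so; rewrite els -cat_cons -map_cons => /cat_sorted2[_ so2].
      by have [? [? [? [? []]]]] := edge_chain_type2 ch2 so2 ea1.
  case eb: (val b) => [[x' v] w']; have [mx' Pv mw' h'] := IJ_val eb.
  have ew1 : w1 = w'.
    case: ls2 els nl ch2 => [|[t3||t3] ls2] els nl ch2.
    + by case: c2 ch2 => // -[e]; move: ea1; rewrite e eb => -[].
    + by case: (nl t3 ls2).
    + case: c2 ch2 => //= r3 c3 [/edge3_spec[a3 [x3 [u3 [w3 [_ -> _ _]]]]]].
      by case: c3 => [|r4 c4]; case: (ls2) => //= ? ? [/edge_None].
    + move: so; rewrite els -cat_cons -map_cons => /cat_sorted2[_ so2].
      have [ts3 [b3 [x3 [v3 [[eb3] eb4 _ _]]]]] := edge_chain_type2 ch2 so2 ea1.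
      by rewrite -eb3 eb in eb4; case: eb4.
  rewrite ew1 in dch.
  have [ts' [c1 c3 _]] := downchain_extend mw' Pu1 dch sots nP.
  exists (ts ++ ts'), w'; split=> //; rewrite -e2.
  have [u0 [Pu0 k1 _]] := triple_le_key cox eb2 eb pr2.
  by apply: bruhat_trans k1; apply: (bruhat_min_rep cox mw' Pu0).
(* An edge to the bottom requires [x = w * u], and then a Type 1 edge would lead to an element
   strictly shorter than [x] but above it. *)
- move: ch => /= [/edge3_spec[a1 [x1 [u1 [w1 [[ea1] _ ea2 ex1]]]]] _].
  rewrite -ea1 ea in ea2; case: ea2 => ex eu ew; rewrite -ex -eu -ew in ex1.
  case: lab2 h2 => [t2||t2] h2; [|by left|by right].
  have [a2 [b2 [x2 [u2 [w2 [v2 [w2' [[ea2] _ ea3 eb2 [Tt2 _ e2 l2 _]]]]]]]]] := edge1_spec cox h2.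
  rewrite -ea2 ea in ea3; case: ea3 => ex2 eu2 ew2; rewrite -ex2 in eb2; rewrite -eu2 -ew2 in l2.
  have [_ _ _ /bruhat_ell] := IJ_val eb2.
  by rewrite ex1 l2 ltnn.
- have [ts [b [x' [v [ep eb els uch]]]]] := edge_chain_type2 ch so ea.
  have [mx' Pv _ h'] := IJ_val eb.
  rewrite ep in pr2.
  (* The chain keeps [w] down to [p]. A competing Type 1 edge makes [w] strictly shorter, so [p]
     cannot lie below its target. *)
  case: lab2 h2 => [t2||t2] h2.
  + have [a2 [b2 [x2 [u2 [w2 [v2 [w2' [[ea2] er2 ea3 eb2 [_ _ _ _ hw]]]]]]]]] := edge1_spec cox h2.
    rewrite -ea2 ea in ea3; case: ea3 => _ _ ew; rewrite -ew in hw.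
    move: pr2; rewrite er2 /= eb eb2 => -[v1 [v3 [[Pv1 _ _ _] _ _ /bruhat_ell]]].
    by rewrite (ell_min_rep cox mw Pv1); lia.
  + by have [a2 [x2 [u2 [w2 [_ er2 _ _]]]]] := edge3_spec h2; rewrite er2 in pr2.
  + have [a2 [b2 [x2 [u2 [w2 [x2' [v2 [[ea2] er2 ea3 eb2 [Tt2 e2 l2]]]]]]]]] := edge2_spec cox h2.
    rewrite -ea2 ea in ea3; case: ea3 => ex eu ew; rewrite -ex -eu in e2 l2; rewrite -ew in eb2.
    move: pr2; rewrite er2 /= eb eb2 => -[v1 [v3 [[Pv1 Pv3 ev _] k1 _ k3]]].
    have ev1 : v1 = 1.
      apply: (ell_eq0 cox); have := bruhat_ell k3; rewrite (ell_min_rep cox mw Pv1); lia.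
    have ev3 : v3 = v by rewrite -ev ev1 mul1g.
    rewrite ev3 e2 in k1.
    have so' : sorted slt (t :: ts).
      by apply: sorted_label2_inv; [exact: upchain_T uch|rewrite map_cons -els].
    have l2' : l (x * u^-1 * t2) = (l (x * u^-1)).+1 by rewrite -e2.
    by case: (upchain_first cox ro uch so' Tt2 k1 l2') => [->|/slt_strict]; [left|right].
Qed.

(** [edge_chain_first] asks of the competing chain only that its first edge ends above [p]. When the
    first labels agree the targets agree, and the comparison passes to the rest. *)
Lemma edge_chain_lex p q c ls c' ls' : edge_chain q c ls p -> sorted llt ls ->
  edge_chain q c' ls' p -> c' = c \/ lex_lt llt ls ls'.
Proof.
elim: c q ls c' ls' => [|r c IH] q [|lab ls] [|r' c'] [|lab' ls'] //=.
- by left.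
- by move=> _ _ _; right.
- move=> [h1 h2] _ e; case: (edge_cover cox h1) => k1 k2 _; case: k2.
  rewrite e in k1 *; have h3 := edge_chain_le h2.
  apply: (QJ_le_rank_eq cox k1); exact: (QJ_le_rank cox h3).
- move=> [h1 h2] so [h1' h2'].
  have hr := edge_chain_le h2'.
  have [el|h] := edge_chain_first (conj h1 h2) so h1' hr; last by right; left.
  rewrite -el in h1' *; have er := edge_target h1 h1'; rewrite -er in h2' *.
  case: (IH r ls c' ls' h2 (path_sorted so) h2') => [->|h]; first by left.
  by right; right.
Qed.

Lemma edge_chain_inc_uniq p q c ls c' ls' : edge_chain q c ls p -> sorted llt ls ->
  edge_chain q c' ls' p -> sorted llt ls' -> c' = c.
Proof.
elim: c q ls c' ls' => [|r c IH] q [|lab ls] [|r' c'] [|lab' ls'] //=.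
- move=> e _ [h1 h2] _; case: (edge_cover cox h1) => k1 k2 _; case: k2.
  rewrite e in k1 *; have h3 := edge_chain_le h2.
  apply: (QJ_le_rank_eq cox k1); exact: (QJ_le_rank cox h3).
- move=> [h1 h2] _ e; case: (edge_cover cox h1) => k1 k2 _; case: k2.
  rewrite e in k1 *; have h3 := edge_chain_le h2.
  apply: (QJ_le_rank_eq cox k1); exact: (QJ_le_rank cox h3).
- move=> [h1 h2] so [h1' h2'] so'.
  have hr := edge_chain_le h2; have hr' := edge_chain_le h2'.
  have el : lab = lab'.
    have [//|k] := edge_chain_first (conj h1 h2) so h1' hr'.
    have [//|k'] := edge_chain_first (conj h1' h2') so' h1 hr.
    by case: (label_lt_asym h1 h1' k k').
  rewrite -el in h1'; have er := edge_target h1 h1'; rewrite -er in h2' *.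
  by congr (_ :: _); apply: (IH r ls c' ls' h2 (path_sorted so) h2' (path_sorted so')).
Qed.

Lemma increasing_strict q c ls p : edge_chain q c ls p -> increasing llt ls -> sorted llt ls.
Proof.
elim: c q ls => [|r c IH] q [|lab ls] //= [h1 h2].
case: c ls IH h2 => [|r2 c] [|lab2 ls] //= IH h2 /andP[h3 h4]; apply/andP; split.
  case/orP: h3 => // /asboolP e; rewrite -e in h2; by case: (edge_repeat h1 (proj1 h2)).
exact: (IH r (lab2 :: ls)).
Qed.

(** Edges are labeled by a relation while [EL_labeling] takes a function; pairs that are not edges
    receive the default [LabelEmpty]. *)
Definition the_label q r : label W := 
  if pselect (exists lab, edge q r lab) is left h then projT1 (cid h) else LabelEmpty W.

Lemma the_labelE q r lab : edge q r lab -> the_label q r = lab.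
Proof.
move=> h; rewrite /the_label; case: pselect => [h'|[]]; last by exists lab.
by case: (cid h') => lab' /= h2; apply: edge_label_uniq h2 h.
Qed.

(** The three types exhaust the covers: the chain of edges from [q] down to [p] starts with an edge
    whose lower end lies in the interval, and in a cover this end must be [p]. *)
Lemma cover_edge p q : covers Qle p q -> edge q p (the_label q p).
Proof.
move=> [pq ne hc]; have [c [ls [ch so]]] := chain_exists pq.
case: c ls ch so => [|r c] [|lab ls] //=; first by move=> e; case: ne.
move=> [h1 h2] _; have pr := edge_chain_le h2; have [rq nrq _] := edge_cover cox h1.
have [e|e] := hc r pr rq; last by case: nrq.
by rewrite e in h1; rewrite (the_labelE h1).
Qed.

Lemma maximal_chainP p q c : maximal_chain Qle p q c <->
  edge_chain q c (pairmap the_label q c) p.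
Proof.
elim: c q => [|r c IH] q /=; first by split=> [[]|->].
split=> [[/= /andP[/asboolP h1 h2] h3]|[h1 /IH[h2 h3]]].
  by split; [exact: cover_edge|apply/IH].
split=> //=; apply/andP; split=> //; apply/asboolP; exact: (edge_cover cox h1).
Qed.

Lemma edge_chain_labels q c ls p : edge_chain q c ls p -> ls = pairmap the_label q c.
Proof.
elim: c q ls => [|r c IH] q [|lab ls] //= [h1 /IH ->].
by rewrite (the_labelE h1).
Qed.

End LabeledChains.

Theorem theorem1p2 (I : Type) (W : groupType) (s : I -> W) (J : set I)
    (preceq : rel W) :
  coxeter_system s ->
  finite_set (parabolic s J) ->
  reflection_order s preceq ->
  parabolic_last s J preceq ->
  exists lab : QJ s J -> QJ s J -> label W,
    (forall p q, covers (@QJ_le I W s J) q p ->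
       forall l, edge_label p q l <-> l = lab p q) /\
    EL_labeling (@QJ_le I W s J) (label_lt preceq) lab.
Proof.
move=> cox finJ rord plast.
exists (@the_label I W s J); split=> [p q cov l|p q pq].
  have h := cover_edge cox finJ rord plast cov.
  by split=> [/(the_labelE cox)->|->].
have [c [ls [ch so]]] := chain_exists cox finJ rord plast pq.
have els := edge_chain_labels cox ch.
have P := maximal_chainP cox finJ rord plast.
exists c; rewrite -els; split.
- by apply/P; rewrite -els.
- by apply: sub_sorted so => x y ->; rewrite orbT.
- move=> c' /P ch' inc.
  exact: (edge_chain_inc_uniq cox rord plast ch so ch' (increasing_strict cox ch' inc)).
- move=> c' /P ch' ne.
  by have [] := edge_chain_lex cox rord plast ch so ch'.
Qed.
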